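(* Let $\mathscr{X}=\mathbb{R}^2$ be the two-dimensional Euclidean space with its Borel $\sigma$-field $\mathscr{B}(\mathscr{X})$. Let $k\ge 1$ be an integer, let $\{(0,\theta_1],(\theta_1,\theta_2],\ldots,(\theta_{k-1},2\pi]\}$ be the partition of the interval $[0,2\pi]$ formed by $k$ equally spaced subintervals, and put $\theta_k=2\pi$ (so $\theta_j=2\pi j/k$ for $j=1,\ldots,k$). Let $$A_{\theta_j}=\begin{pmatrix}\cos\theta_j & -\sin\theta_j\\ \sin\theta_j & \cos\theta_j\end{pmatrix},\qquad j=1,\ldots,k.$$ Then $\mathscr{G}=\{A_{\theta_1},\ldots,A_{\theta_k}\}$ is a finite group of orthogonal matrices. Moreover, let $\alpha>0$, let $H$ be a $\mathscr{G}$-invariant probability measure on $(\mathscr{X},\mathscr{B}(\mathscr{X}))$, and let $\boldsymbol{X}_1,\ldots,\boldsymbol{X}_m$ be a sample from an unknown bivariate spherically symmetric distribution $F$ on $(\mathscr{X},\mathscr{B}(\mathscr{X}))$, where the prior placed on $F$ is the Dirichlet invariant process $P\sim DIP(\alpha H)$ with respect to $\mathscr{G}$. Then the posterior, i.e. the conditional distribution of $P$ given $\boldsymbol{X}_1,\ldots,\boldsymbol{X}_m$, is the Dirichlet invariant process $DIP(\alpha_m^* H_{k,m}^* )$ with respect to $\mathscr{G}$, with parameters $\alpha_m^*=\alpha+m$ and $$H_{k,m}^*=\frac{\alpha H+\frac1k\sum_{j=1}^k\sum_{i=1}^m\delta_{A_{\theta_j}\boldsymbol{X}_i}}{\alpha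+m}.$$
   Context: $\delta_x$ denotes the Dirac measure at $x$. For a finite group $\mathscr{G}$ of measurable transformations of $\mathscr{X}$, a measure $\nu$ is $\mathscr{G}$-invariant if $\nu(g(B))=\nu(B)$ for all $g\in\mathscr{G}$ and all Borel sets $B$. Let $\mathscr{P}(\mathscr{X})$ be the space of Borel probability measures on $\mathscr{X}$ with the Borel $\sigma$-field of the weak topology. A $\mathscr{G}$-invariant random probability measure is a random element $P$ of $\mathscr{P}(\mathscr{X})$ with $P(A)=P(g(A))$ for all $g\in\mathscr{G}$ and all Borel $A$. For $\alpha>0$ and a $\mathscr{G}$-invariant probability measure $H$, a $\mathscr{G}$-invariant random probability measure $P$ is a Dirichlet invariant process with respect to $\mathscr{G}$, written $P\sim DIP(\alpha H)$, if for every finite measurable partition $B_1,\ldots,B_n$ of $\mathscr{X}$ into $\mathscr{G}$-invariant sets, $(P(B_1),\ldots,P(B_n))$ has the Dirichlet distribution $Dir(\alpha H(B_1),\ldots,\alpha H(B_n))$; components with parameter $0$ are taken to be $0$ with probability one. A matrix acts on $\mathbb{R}^2$ by multiplication. A random vector $\boldsymbol{X}\in\mathbb{R}^p$ (or its distribution) is spherically symmetric if $\boldsymbol{X}\stackrel{d}{=}A\boldsymbol{X}$ for all $p\times p$ orthogonal matrices $A$; in the model, this symmetry is encoded through invariance under the group $\mathscr{G}$. ''Sample with prior $P$ on $F$'' means that, conditionally on $P$, the observations $\boldsymbol{X}_1,\ldots,\boldsymbol{X}_m$ are i.i.d. with distribution $P$. *)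

(* Defs.v *)
From HB Require Import structures.
From mathcomp Require Import all_boot all_order all_algebra.
From mathcomp Require Import all_classical all_reals all_analysis.
From mathcomp Require Import measurable_realfun.

Set Implicit Arguments.
Unset Strict Implicit.
Unset Printing Implicit Defensive.

Import Order.TTheory GRing.Theory Num.Theory.
Import numFieldNormedType.Exports.

Local Open Scope classical_set_scope.
Local Open Scope ring_scope.
Local Open Scope ereal_scope.

Notation borel T := (g_sigma_algebraType (@open T)).

Notation plane R := (borel 'cV[R]_2).

Section weak_topology.
Context (T : ptopologicalType) (R : realType).

Definition bounded_continuous : Type :=
  {f : T -> R | continuous f /\ bounded_fun (f : T -> R^o)}.

Definition integrate (mu : probability (borel T) R) :
    prod_topology (fun _ : bounded_continuous => R) :=
  fun f => (\int[mu]_x (sval f x))%R.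

(* The initial topology for [integrate] into the product is the coarsest
   topology making mu |-> \int f dmu continuous for each bounded continuous f,
   i.e., the topology of weak convergence. *)
Definition weak_prob := initial_topology integrate.

End weak_topology.

Notation random_prob T R := (borel (weak_prob T R)).

Section dirichlet.
Context {R : realType}.

Definition Gamma (a : R) : R :=
  (\int[lebesgue_measure]_(x in `]0, +oo[) (x `^ (a - 1) * expR (- x)))%R.

Definition gamma_pdf (a : R) : R -> R :=
  (fun x => x `^ (a - 1) * expR (- x) / Gamma a)%R \_ `]0%R, +oo[.

(* The Gamma(a, 1) distribution, degenerate at 0 for a = 0. *)
Definition gamma_prob (a : R) (U : set R) : \bar R :=
  if (0 < a)%R then \int[lebesgue_measure]_(x in U) (gamma_pdf a x)%:E
  else \d_(0%R : R) U.

Lemma Gamma_ge0 (a : R) : (0 <= Gamma a)%R.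
Proof.
by apply: Rintegral_ge0 => x _; rewrite mulr_ge0 ?powR_ge0 ?expR_ge0.
Qed.

Lemma gamma_pdf_ge0 (a x : R) : (0 <= gamma_pdf a x)%R.
Proof.
apply: restrict_ge0 => {}x _.
by rewrite divr_ge0 ?Gamma_ge0// mulr_ge0 ?powR_ge0 ?expR_ge0.
Qed.

Lemma measurable_gamma_pdf (a : R) : measurable_fun [set: R] (gamma_pdf a).
Proof.
apply/measurable_restrict => //; apply: measurable_funTS.
apply: measurable_funM => //; apply: measurable_funM.
  exact: measurable_powR.
exact: measurableT_comp.
Qed.

Section gamma_measure.
Variable a : R.

Let gamma_prob0 : gamma_prob a set0 = 0.
Proof.
by rewrite /gamma_prob; case: ifP => _; [exact: integral_set0|exact: measure0].
Qed.

Let gamma_prob_ge0 U : 0 <= gamma_prob a U.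
Proof.
rewrite /gamma_prob; case: ifP => // _.
by apply: integral_ge0 => x _; rewrite lee_fin gamma_pdf_ge0.
Qed.

Let gamma_prob_sigma_additive : semi_sigma_additive (gamma_prob a).
Proof.
have -> : gamma_prob a =
    if (0 < a)%R then fun U => \int[lebesgue_measure]_(x in U) (gamma_pdf a x)%:E
    else \d_(0%R : R).
  by apply/funext => U; rewrite /gamma_prob; case: ifP.
case: ifP => _; last exact: measure_semi_sigma_additive.
move=> /= F mF tF mUF; apply: cvg_toP.
  apply: ereal_nondecreasing_is_cvgn => m n mn.
  apply: lee_sum_nneg_natr => // k _ _; apply: integral_ge0 => /= x Fkx.
  by rewrite lee_fin gamma_pdf_ge0.
rewrite ge0_integral_bigcup//=.
- have mpdf : measurable_fun [set: R] (EFin \o gamma_pdf a).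
    by apply/measurable_EFinP; exact: measurable_gamma_pdf.
  exact: measurable_funS measurableT (@subsetT _ _) mpdf.
- by move=> x _; rewrite lee_fin gamma_pdf_ge0.
Qed.

HB.instance Definition _ := isMeasure.Build _ _ _ (gamma_prob a)
  gamma_prob0 gamma_prob_ge0 gamma_prob_sigma_additive.

End gamma_measure.

(* The expectation of f (Y_1, ..., Y_n) for independent Y_i ~ Gamma(a_i, 1),
   that is, the integral of f against the product of the gamma_prob a_i. *)
Fixpoint gamma_expectation (a : seq R) (f : seq R -> \bar R) : \bar R :=
  if a is a0 :: a' then
    \int[gamma_prob a0]_y gamma_expectation a' (fun ys => f (y :: ys))
  else f [::].

(* The Dirichlet distribution with nonnegative, not all zero, parameters is the
   law of (Y_1, ..., Y_n) / (Y_1 + ... + Y_n) for independent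
   Y_i ~ Gamma(a_i, 1) (Ferguson, 1973); a component with parameter 0 is 0
   almost surely. *)
Definition dirichlet n (a : n.-tuple R) (C : set (n.-tuple R)) : \bar R :=
  gamma_expectation a (fun y =>
    (\1_C [tuple (y`_i / \sum_(z <- y) z)%R | i < n])%:E).

End dirichlet.

Section dirichlet_invariant_process.
Context {T : ptopologicalType} {R : realType}.

Definition invariant_measure (G : set (T -> T)) (nu : set (borel T) -> \bar R) :=
  forall g (A : set (borel T)), G g -> measurable A -> nu (g @` A) = nu A.

Definition invariant_partition (G : set (T -> T)) n
    (B : 'I_n -> set (borel T)) :=
  [/\ forall i, measurable (B i), trivIset setT B, \bigcup_i B i = setT &
      forall i g, G g -> g @` B i = B i].

(* The law Q on the space of probability measures is that of a Dirichlet
   invariant process DIP(alpha H) with respect to G. *)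
Definition is_DIP (G : set (T -> T)) (alpha : {posnum R})
    (H : probability (borel T) R)
    (Q : {measure set (random_prob T R) -> \bar R}) :=
  [/\ invariant_measure G H,
      \forall mu \ae Q, invariant_measure G (mu : probability (borel T) R) &
      forall n (B : 'I_n -> set (borel T)), invariant_partition G B ->
      forall C : set (n.-tuple R), measurable C ->
        Q [set mu | C [tuple fine ((mu : probability (borel T) R) (B i))
                      | i < n]] =
        dirichlet [tuple (alpha%:num * fine (H (B i)))%R | i < n] C].

End dirichlet_invariant_process.

Section bayes.
Context d (Omega : measurableType d) (R : realType) (Pr : probability Omega R).

(* Given P, the X_i are i.i.d. with law P: a version of the conditional
   probability of {X_i \in A_i for all i} given P is \prod_i P(A_i). *)
Definition is_sample (T : ptopologicalType) (P : {RV Pr >-> random_prob T R})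
    m (X : 'I_m -> {RV Pr >-> borel T}) :=
  forall (C : set (random_prob T R)) (A : 'I_m -> set (borel T)),
    measurable C -> (forall i, measurable (A i)) ->
    Pr ((P @^-1` C) `&` \bigcap_i (X i @^-1` A i)) =
    \int[Pr]_(w in P @^-1` C) \prod_(i < m) (P w : probability (borel T) R) (A i).

Definition sample_tuple d' (S : measurableType d') m
    (X : 'I_m -> {RV Pr >-> S}) (w : Omega) : m.-tuple S :=
  [tuple X i w | i < m].

Definition is_conditional_distribution d1 d2 (S1 : measurableType d1)
    (S2 : measurableType d2) (P : {RV Pr >-> S2}) (X : Omega -> S1)
    (kappa : R.-pker S1 ~> S2) :=
  forall (E : set S1) (C : set S2), measurable E -> measurable C ->
    Pr ((X @^-1` E) `&` (P @^-1` C)) = \int[Pr]_(w in X @^-1` E) kappa (X w) C.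

End bayes.

Section rotations.
Context {R : realType}.

Definition finite_orthogonal_group n (G : set 'M[R]_n) :=
  [/\ finite_set G,
      forall A, G A -> A *m A^T = 1%:M,
      G 1%:M,
      forall A B, G A -> G B -> G (A *m B) &
      forall A, G A -> A \in unitmx /\ G (invmx A)].

Definition theta (k j : nat) : R := (2 * pi * j%:R / k%:R)%R.

Definition rotation (t : R) : 'M[R]_2 :=
  \matrix_(i < 2, j < 2)
    (nth [::] [:: [:: cos t; - sin t]; [:: sin t; cos t]] i)`_j%R.

Definition rotation_group (k : nat) : set 'M[R]_2 :=
  [set rotation (theta k j) | j in [set j : nat | (1 <= j <= k)%N]].

Definition matrix_action (G : set 'M[R]_2) : set ('cV[R]_2 -> 'cV[R]_2) :=
  [set (fun x => A *m x)%R | A in G].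

(* H^*_{k,m} for the observations x; the hypothesis on k makes it a probability
   measure. *)
Definition posterior_base (k : nat) (_ : (0 < k)%N) (alpha : {posnum R})
    (H : probability (plane R) R) (m : nat) (x : m.-tuple (plane R))
    (U : set (plane R)) : \bar R :=
  ((alpha%:num + m%:R)^-1)%:E *
  (alpha%:num%:E * H U +
   (k%:R^-1)%:E * \sum_(1 <= j < k.+1) \sum_(i < m)
     \d_((rotation (theta k j) *m tnth x i)%R : plane R) U).

Section posterior_base.
Variables (k : nat) (k_gt0 : (0 < k)%N) (alpha : {posnum R}).
Variables (H : probability (plane R) R) (m : nat) (x : m.-tuple (plane R)).

Local Notation Hkm := (posterior_base k_gt0 alpha H x).

Let atoms : {measure set (plane R) -> \bar R} :=
  msum (fun j => msum (fun i =>
    \d_((rotation (theta k j.+1) *m nth 0%R x i)%R : plane R)) m) k.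

Let posterior_baseE : Hkm =
  mscale ((alpha%:num + m%:R)^-1)%:nng%R
    (measure_add (mscale (alpha%:num)%:nng%R H) (mscale (k%:R^-1)%:nng%R atoms)).
Proof.
apply/funext => U.
rewrite /posterior_base [RHS](congr1 _ (measure_addE _ _ U)).
congr (_ * (_ + _ * _)); rewrite /= /msum big_add1 big_mkord.
apply: eq_bigr => j _; apply: eq_bigr => i _.
by rewrite (tnth_nth 0%R).
Qed.

Let posterior_base0 : Hkm set0 = 0.
Proof. by rewrite posterior_baseE measure0. Qed.

Let posterior_base_ge0 U : 0 <= Hkm U.
Proof. by rewrite posterior_baseE measure_ge0. Qed.

Let posterior_base_sigma_additive : semi_sigma_additive Hkm.
Proof. rewrite posterior_baseE; exact: measure_semi_sigma_additive. Qed.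

HB.instance Definition _ := isMeasure.Build _ _ _ Hkm
  posterior_base0 posterior_base_ge0 posterior_base_sigma_additive.

Let posterior_base_setT : Hkm [set: _] = 1.
Proof.
rewrite /posterior_base probability_setT mule1.
have -> : \sum_(1 <= j < k.+1) \sum_(i < m)
    \d_((rotation (theta k j) *m tnth x i)%R : plane R) [set: plane R] =
    (k%:R * m%:R)%:E :> \bar R.
  under eq_bigr do under eq_bigr do rewrite diracT.
  rewrite big_add1 /= big_mkord !sumEFin sumr_const card_ord sumr_const card_ord.
  by rewrite mulr_natl.
rewrite -EFinM mulKf ?pnatr_eq0 -?lt0n//.
by rewrite -[LHS]/(((alpha%:num + m%:R)^-1 * (alpha%:num + m%:R))%:E) mulVf.
Qed.

HB.instance Definition _ := Measure_isProbability.Build _ _ _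
  Hkm posterior_base_setT.

End posterior_base.

End rotations.

(* Main.v *)
(* A Dirichlet vector is the vector of proportions of independent gamma
   variables, and by Lukacs' theorem these proportions are independent of the
   total.  Hence, for D ~ Dir(a) with b = a_1 + ... + a_n, and independent
   s ~ Gamma(b), e ~ Gamma(1),
     (s D + e e_j) / (s + e) ~ Dir(a + e_j)                              (1)
     E (D_j f(D)) = (a_j / b) E f(D') for D' ~ Dir(a + e_j).             (2)
   Let o_x be the uniform law on the orbit of x.  By (1), if mu ~ DIP(a H) then
   (s mu + e o_x) / (s + e) ~ DIP(a H + o_x) for s ~ Gamma(a), e ~ Gamma(1);
   this yields an explicit law Q_x, measurable in x.  By (2), the law Q of mu satisfies the Palm formula
     E (mu(A); mu in C) = int_A Q_x(C) H(dx),
   which is Bayes' formula for one observation: as mu is invariant, mu(A) is the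
   integral of o_x(A), which takes finitely many values, so that only the masses
   of the cells of a finite invariant partition matter when C is a cylinder.
   The m observations are then processed one at a time. *)

Require Import Defs.
From HB Require Import structures.
From mathcomp Require Import all_boot all_order all_algebra.
From mathcomp Require Import all_classical all_reals all_analysis.
From mathcomp Require Import measurable_realfun.
From mathcomp Require Import lra ring.

Set Implicit Arguments.
Unset Strict Implicit.
Unset Printing Implicit Defensive.

Import Order.TTheory GRing.Theory Num.Theory.
Import numFieldNormedType.Exports.

Local Open Scope classical_set_scope.
Local Open Scope ring_scope.

(** * Measures and disintegration *)

(** The hypothesis [is_DIP] constrains only the masses of cells, whereas laws of P and the posterior
    kernel live on the Borel sets of the weak topology. This forces the identification of that
    sigma-field with the one generated by the evaluations mu -> mu(A), for which a countable basis
    of the weak topology is exhibited. After that, every identity is proved on a pi-system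
    (cylinders of laws, rectangles of observations) and extended by uniqueness of finite measures.
    Nothing has to be constructed from scratch: the prior law is given, and the posterior is
    assembled from it, gamma variables and orbits. Since [dirichlet] is an iterated gamma integral,
    multivariate densities and beta integrals are avoided altogether. Everything rests on two
    one-dimensional changes of the gamma density, scaling ([gamma_scale]) and size-biasing
    ([gamma_shift]), carried over to product laws by induction. The constant a_j / b of (2) appears
    as a ratio of gamma means, and these are linear in the parameter because they are additive and
    nonnegative. *)

Section measure_theory.
Local Open Scope ereal_scope.

Lemma finite_measure_eq d (T : measurableType d) (R : realType)
    (G : set (set T)) (m1 m2 : {measure set T -> \bar R}) :
  measurable = <<s G >> -> setI_closed G ->
  m1 setT = m2 setT -> m1 setT < +oo ->
  (forall A, G A -> m1 A = m2 A) ->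
  forall A, measurable A -> m1 A = m2 A.
Proof.
move=> GE GI m12T m1T m12 A mA.
(* [measure_unique] wants the space exhausted by members of the generator. Adjoining the whole space
   keeps stability under intersection and makes a constant sequence exhaust it. *)
pose G' := G `|` [set setT].
have G'E : measurable = <<s G' >>.
  rewrite GE eqEsubset; split.
    by apply: sub_sigma_algebra2 => X GX; left.
  apply: smallest_sub; first exact: smallest_sigma_algebra.
  move=> X [GX|->]; first exact: sub_sigma_algebra.
  by rewrite -GE; exact: measurableT.
apply: (@measure_unique _ _ _ G' (fun=> setT)) => //.
- move=> X Y [GX|->] [GY|->]; rewrite ?setIT ?setTI.
  + by left; exact: GI.
  + by left.
  + by left.
  + by right.
- by move=> n; right.
- exact: bigcup_const.
- by move=> X [GX|->] //; exact: m12.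
Qed.

Import HBNNSimple.

(** The usual passage from indicators to simple functions to monotone limits, stated once as an
    induction principle. *)
Lemma ge0_measurable_ind d (T : measurableType d) (R : realType)
    (P : (T -> \bar R) -> Prop) :
  (forall A, measurable A -> P (fun x => (\1_A x)%:E)) ->
  (forall (c : R) f, (0 <= c)%R -> (forall x, 0 <= f x) ->
     measurable_fun setT f -> P f -> P (fun x => c%:E * f x)) ->
  (forall f g, (forall x, 0 <= f x) -> measurable_fun setT f ->
     (forall x, 0 <= g x) -> measurable_fun setT g ->
     P f -> P g -> P (fun x => f x + g x)) ->
  (forall (f_ : (T -> \bar R)^nat) f, (forall n x, 0 <= f_ n x) ->
     (forall n, measurable_fun setT (f_ n)) ->
     (forall x, {homo f_^~ x : n m / (n <= m)%N >-> n <= m}) ->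
     (forall n, P (f_ n)) -> f = (fun x => limn (f_^~ x)) -> P f) ->
  forall f, (forall x, 0 <= f x) -> measurable_fun setT f -> P f.
Proof.
move=> P1 PZ PD Plim f f0 mf.
pose f_ := nnsfun_approx measurableT mf.
apply: (Plim (fun n x => (f_ n x)%:E)).
- by move=> n x; rewrite lee_fin.
- by move=> n; exact/measurable_EFinP.
- by move=> x n m nm; rewrite lee_fin; exact/lefP/nd_nnsfun_approx.
- move=> n.
  (* The induction on the list of values forgets that they are values of a nonnegative function. The
     guard on r restores the sign, at no cost since the preimage of a negative value is empty. *)
  have -> : (fun x => (f_ n x)%:E) =
    (fun x => \sum_(r <- finmap.enum_fset (fset_set (range (f_ n))))
                (if (0 <= r)%R then r%:E * (\1_(f_ n @^-1` [set r]) x)%:E else 0)).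
    apply/funext => x; rewrite fimfunE fsbig_finite//= -sumEFin.
    apply: eq_bigr => r _; case: ifPn => // r0.
    rewrite (_ : _ @^-1` _ = set0) ?indic0 ?mulr0//.
    by apply: preimage_nnfun0; rewrite ltNge.
  have mr (r : R) : measurable_fun setT
     (fun x => if (0 <= r)%R then r%:E * (\1_(f_ n @^-1` [set r]) x)%:E else 0).
    have [r0|r0] := leP 0%R r => //; apply: measurable_funeM.
    exact/measurable_EFinP.
  have ge0r (r : R) x :
      0 <= (if (0 <= r)%R then r%:E * (\1_(f_ n @^-1` [set r]) x)%:E else 0).
    by case: ifPn => // r0; rewrite mule_ge0// lee_fin.
  have P0 : P (fun=> 0).
    have := P1 set0 measurable0.
    by congr P; apply/funext => x; rewrite indic0.
  elim: (finmap.enum_fset _) => [|r s IH].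
    by under eq_fun do rewrite big_nil.
  under eq_fun do rewrite big_cons.
  apply: PD => //.
  + by move=> x; exact: sume_ge0.
  + exact: emeasurable_sum.
  + have [r0|r0] := leP 0%R r => //; apply: PZ => //.
    * exact/measurable_EFinP.
    * exact: P1.
- apply/funext => x; apply/esym/cvg_lim => //.
  exact: cvg_nnsfun_approx.
Qed.

Lemma ge0_integral_density d (T : measurableType d) (R : realType)
    (mu nu : {measure set T -> \bar R}) (f : T -> R) (g : T -> \bar R) :
  (forall x, 0 <= f x)%R -> measurable_fun setT f ->
  (forall A, measurable A -> nu A = \int[mu]_(x in A) (f x)%:E) ->
  (forall x, 0 <= g x) -> measurable_fun setT g ->
  \int[nu]_x g x = \int[mu]_x ((f x)%:E * g x).
Proof.
move=> f0 mf nuE.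
have mF : measurable_fun setT (EFin \o f) by exact/measurable_EFinP.
have F0 x : 0 <= (f x)%:E by rewrite lee_fin.
move: g; apply: ge0_measurable_ind.
- move=> A mA; rewrite integral_indic// setIT nuE//.
  rewrite integral_mkcond; apply: eq_integral => x _.
  by rewrite epatch_indic.
- move=> c g c0 g0 mg IH; rewrite ge0_integralZl//.
  rewrite IH -ge0_integralZl//.
  + by apply: eq_integral => x _; rewrite muleCA.
  + exact: emeasurable_funM.
  + by move=> x _; exact: mule_ge0.
- move=> g h g0 mg h0 mh IHg IHh.
  rewrite ge0_integralD// IHg IHh -ge0_integralD//.
  + by apply: eq_integral => x _; rewrite ge0_muleDr.
  + by move=> x _; exact: mule_ge0.
  + exact: emeasurable_funM.
  + by move=> x _; exact: mule_ge0.
  + exact: emeasurable_funM.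
- move=> g_ g g0 mg ndg IH ->.
  rewrite monotone_convergence//.
  under eq_fun do rewrite IH.
  rewrite -monotone_convergence//.
  + apply: eq_integral => x _; rewrite limeMl//.
    by apply: ereal_nondecreasing_is_cvgn => n m; exact: ndg.
  + by move=> n; exact: emeasurable_funM.
  + by move=> n x _; exact: mule_ge0.
  + by move=> x _ n m nm; apply: lee_wpmul2l => //; exact: ndg.
Qed.

(** The existential hides the image measure, so that only these two equations about it remain
    visible. *)
Lemma exists_pushforward d d' (T : measurableType d) (T' : measurableType d')
    (R : realType) (m : {measure set T -> \bar R}) (f : T -> T') :
  measurable_fun setT f ->
  exists nu : {measure set T' -> \bar R},
    (forall A, nu A = m (f @^-1` A)) /\
    forall g, measurable_fun setT g -> (forall y, 0 <= g y) ->
      \int[nu]_y g y = \int[m]_x g (f x).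
Proof.
move=> mf.
exists (measure_function_pushforward__canonical__measure_function_Measure m mf).
by split=> // g mg g0; rewrite ge0_integral_pushforward.
Qed.

End measure_theory.

(** * Disintegration along a probability kernel *)

Section kernels.
Local Open Scope ereal_scope.
Context d1 d2 (Y : measurableType d1) (Z : measurableType d2) (R : realType).
Variable k : Y -> probability Z R.
Hypothesis mk : forall C, measurable C -> measurable_fun setT (k ^~ C).

Let kk (y : Y) : {measure set Z -> \bar R} := k y.
HB.instance Definition _ := isKernel.Build _ _ _ _ _ kk mk.
Let kk1 y : kk y setT = 1. Proof. exact: probability_setT. Qed.
HB.instance Definition _ := Kernel_isProbability.Build _ _ _ _ _ kk kk1.

Lemma measurable_fun_integral_probability (f : Y * Z -> \bar R) :
  (forall x, 0 <= f x) -> measurable_fun setT f ->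
  measurable_fun setT (fun y => \int[k y]_z f (y, z)).
Proof.
move=> f0 mf.
exact: (@measurable_fun_integral_finite_kernel _ _ _ _ _ f kk).
Qed.

Lemma measurable_xsection_probability (D : set (Y * Z)) : measurable D ->
  measurable_fun setT (fun y => k y (xsection D y)).
Proof.
move=> mD.
rewrite (_ : (fun _ => _) = fun y => \int[k y]_z (\1_D (y, z))%:E).
  apply: (@measurable_fun_integral_probability (fun x => (\1_D x)%:E)).
  - by move=> x; rewrite lee_fin.
  - exact/measurable_EFinP.
apply/funext => y.
rewrite -[in LHS](setIT (xsection _ _)) -integral_indic//; last first.
  exact: measurable_xsection.
by apply: eq_integral => z _; rewrite !indicE mem_xsection.
Qed.

Context d (Omega : measurableType d) (mu : {measure set Omega -> \bar R}).
Variables (U : Omega -> Y) (W : Omega -> Z).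
Hypothesis mU : measurable_fun setT U.
Hypothesis mW : measurable_fun setT W.
Hypothesis muT : mu setT < +oo.

(** The joint law of U and a point drawn from [k (U w)]. Once it is a measure, it can be compared
    with the law of the pair (U, W) on rectangles. *)
Let joint (D : set (Y * Z)) := \int[mu]_w k (U w) (xsection D (U w)).

Let mkU D : measurable D ->
  measurable_fun setT (fun w => k (U w) (xsection D (U w))).
Proof.
move=> mD.
apply: (@measurableT_comp _ _ _ _ _ _ (fun y => k y (xsection D y))) => //.
exact: measurable_xsection_probability.
Qed.

Let joint0 : joint set0 = 0.
Proof.
by rewrite /joint integral0_eq// => w _; rewrite xsection0 measure0.
Qed.

Let joint_ge0 D : 0 <= joint D.
Proof. by apply: integral_ge0 => w _; exact: measure_ge0. Qed.

Let joint_sigma_additive : semi_sigma_additive joint.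
Proof.
move=> F mF tF mUF.
rewrite [X in _ --> X](_ : _ = \sum_(0 <= i <oo) joint (F i)); last first.
  rewrite /joint -integral_nneseries//; last by move=> n; exact: mkU.
  apply: eq_integral => w _; rewrite xsection_bigcup.
  apply/esym/cvg_lim => //.
  apply: measure_semi_sigma_additive.
  - by move=> i; exact: measurable_xsection.
  - exact: trivIset_xsection.
  - by apply: bigcup_measurable => i _; exact: measurable_xsection.
by apply: is_cvg_nneseries => n _ _; exact: joint_ge0.
Qed.

HB.instance Definition _ := isMeasure.Build _ _ _ joint
  joint0 joint_ge0 joint_sigma_additive.

Hypothesis UW : forall E C, measurable E -> measurable C ->
  mu (U @^-1` E `&` W @^-1` C) = \int[mu]_(w in U @^-1` E) k (U w) C.

Let mUW : measurable_fun setT (fun w => (U w, W w)).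
Proof. exact: measurable_fun_pair. Qed.

Let jointE D : measurable D -> mu ((fun w => (U w, W w)) @^-1` D) = joint D.
Proof.
move=> mD.
apply: (@finite_measure_eq _ _ _ [set A `*` B | A in measurable & B in measurable]
  (pushforward mu (fun w => (U w, W w)))) mD => //.
- exact: measurable_prod_measurableType.
- move=> _ _ [A mA [B mB <-]] [A' mA' [B' mB' <-]].
  rewrite -setXI; exists (A `&` A'); first exact: measurableI.
  by exists (B `&` B') => //; exact: measurableI.
- transitivity (\int[mu]_w (cst 1 w)).
    by rewrite integral_cst// mul1e.
  apply: eq_integral => w _.
  by rewrite (_ : xsection _ _ = setT) ?probability_setT// -subTset => z _; rewrite /xsection/= inE.
- move=> _ [A mA [B mB <-]]; rewrite /pushforward/= /joint.
  rewrite -[LHS]/(mu (U @^-1` A `&` W @^-1` B)) UW// integral_mkcond.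
  apply: eq_integral => w _; rewrite patchE; case: ifPn => UA.
    by rewrite in_xsectionX//; rewrite inE in UA; rewrite inE.
  by rewrite notin_xsectionX ?measure0//; apply: contra UA.
Qed.

(** A conditional law known on rectangles computes all joint integrals. It serves with W = P and the
    posterior kernel, and with W the next observation and the predictive kernel. *)
Lemma integral_disintegration (f : Y * Z -> \bar R) :
  (forall x, 0 <= f x) -> measurable_fun setT f ->
  \int[mu]_w f (U w, W w) = \int[mu]_w \int[k (U w)]_z f (U w, z).
Proof.
have mint g : (forall x, 0 <= g x) -> measurable_fun setT g ->
    measurable_fun setT (fun w => \int[k (U w)]_z g (U w, z)).
  move=> g0 mg.
  apply: (@measurableT_comp _ _ _ _ _ _ (fun y => \int[k y]_z g (y, z))) => //.
  exact: measurable_fun_integral_probability.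
have mpair (g : Y * Z -> \bar R) y : measurable_fun setT g ->
    measurable_fun setT (fun z => g (y, z)).
  by move=> mg; apply: measurableT_comp.
move: f; apply: ge0_measurable_ind.
- move=> D mD; transitivity (joint D).
    rewrite -jointE// -[in RHS](setIT (_ @^-1` _)) -integral_indic//.
    by rewrite -[_ @^-1` _]setTI; exact: mUW.
  apply: eq_integral => w _.
  rewrite -[in LHS](setIT (xsection _ _)) -integral_indic//; last first.
    exact: measurable_xsection.
  by apply: eq_integral => z _; rewrite !indicE mem_xsection.
- move=> c g c0 g0 mg IH.
  rewrite ge0_integralZl//; last exact: measurableT_comp mUW.
  rewrite IH -ge0_integralZl//.
  + by apply: eq_integral => w _; rewrite ge0_integralZl//; exact: mpair.
  + exact: mint.
  + by move=> w _; exact: integral_ge0.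
- move=> g h g0 mg h0 mh IHg IHh.
  rewrite ge0_integralD//; [|exact: measurableT_comp mUW..].
  rewrite IHg IHh -ge0_integralD//.
  + by apply: eq_integral => w _; rewrite ge0_integralD//; exact: mpair.
  + by move=> w _; exact: integral_ge0.
  + exact: mint.
  + by move=> w _; exact: integral_ge0.
  + exact: mint.
- move=> g_ g g0 mg ndg IH ->.
  rewrite monotone_convergence//; last by move=> n; exact: measurableT_comp mUW.
  under eq_fun do rewrite IH.
  rewrite -monotone_convergence//.
  + apply: eq_integral => w _; rewrite monotone_convergence//.
    by move=> n; exact: mpair.
  + by move=> n; exact: mint.
  + by move=> n w _; exact: integral_ge0.
  + move=> w _ n m nm; apply: ge0_le_integral => //.
    * exact: mpair.
    * exact: mpair.
    * by move=> z _; exact: ndg.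
Qed.

End kernels.

(** * Borel sets for the weak topology *)

Section plane_borel.
Context {R : realType}.

Definition box (a b : 'cV[R]_2) : set (plane R) :=
  [set x | forall i, (a i ord0 < x i ord0 < b i ord0)%R].

Definition rat_box (p : {ffun 'I_2 -> rat * rat}) : set (plane R) :=
  box (\col_i ratr (p i).1) (\col_i ratr (p i).2).

Lemma open_box a b : open (box a b : set 'cV[R]_2).
Proof.
rewrite openE => x bx.
exists (fun i j => `](a i ord0), (b i ord0)[%classic).
  move=> i j; apply: open_nbhs_nbhs; split; first exact: interval_open.
  by rewrite /= in_itv/= (ord1 j); exact: bx.
by move=> y /= aby i; have := aby i ord0; rewrite in_itv.
Qed.

Lemma measurable_box a b : measurable (box a b).
Proof. by apply: sub_sigma_algebra; exact: open_box. Qed.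

Lemma rat_box_nbhs (U : set 'cV[R]_2) x : open U -> U x ->
  exists2 p, rat_box p x & rat_box p `<=` U.
Proof.
rewrite openE => /[apply] /= /nbhs_ballP[e /= e0 xeU].
have /choice[q qx] : forall i, exists q : rat,
    ratr q \in `](x i ord0 - e)%R, (x i ord0)%R[.
  by move=> i; apply: rat_in_itvoo; rewrite ltrBlDr ltrDl.
have /choice[r rx] : forall i, exists q : rat,
    ratr q \in `](x i ord0)%R, (x i ord0 + e)%R[.
  by move=> i; apply: rat_in_itvoo; rewrite ltrDl.
exists [ffun i => (q i, r i)].
  move=> i; rewrite !mxE !ffunE/=.
  by move: (qx i) (rx i); rewrite !in_itv/= => /andP[_ ->] /andP[].
move=> y xy; apply: xeU; split => // i j; rewrite (ord1 j).
have := xy i; rewrite !mxE !ffunE/= => /andP[qy yr].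
move: (qx i) (rx i); rewrite !in_itv/= => /andP[eq _] /andP[_ re].
rewrite /ball/= ltr_norml ltrBrDl ltrBlDr.
by rewrite ltrBlDl in eq; apply/andP; split; lra.
Qed.

Definition rat_boxes (s : seq {ffun 'I_2 -> rat * rat}) : set (plane R) :=
  [set x | exists2 p, p \in s & rat_box p x].

Lemma measurable_rat_boxes s : measurable (rat_boxes s).
Proof.
rewrite (_ : rat_boxes s = \bigcup_(p in [set` s]) rat_box p); last first.
  by apply/seteqP; split => x [p ps px]; exists p.
by apply: fin_bigcup_measurable => // p _; exact: measurable_box.
Qed.

Lemma borel_plane_boxes : @measurable _ (plane R) = <<s range rat_box >>.
Proof.
rewrite eqEsubset; split; last first.
  apply: smallest_sub; first exact: sigma_algebra_measurable.
  by move=> _ [p _ <-]; exact: measurable_box.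
apply: smallest_sub; first exact: smallest_sigma_algebra.
move=> U oU.
have -> : U = \bigcup_(p in [set p | rat_box p `<=` U]) rat_box p.
  apply/seteqP; split => [x Ux|x [p pU]]; last exact: pU.
  by have [p px pU] := rat_box_nbhs oU Ux; exists p.
rewrite bigcup_mkcond.
apply: (@countable_bigcupT_measurable _
  (g_sigma_algebraType (range rat_box))) => // p.
by case: ifPn => // _; apply: sub_sigma_algebra; exists p.
Qed.

Lemma setI_closed_rat_box : setI_closed (range rat_box).
Proof.
have rmax (p q : rat) : ratr (Num.max p q) = Num.max (ratr p) (ratr q) :> R.
  by rewrite !maxElt ltr_rat; case: ifP.
have rmin (p q : rat) : ratr (Num.min p q) = Num.min (ratr p) (ratr q) :> R.
  by rewrite !minElt ltr_rat; case: ifP.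
move=> _ _ [p _ <-] [q _ <-].
exists [ffun i => (Num.max (p i).1 (q i).1, Num.min (p i).2 (q i).2)] => //.
apply/seteqP; split => [x xi|x [x1 x2] i].
  split => i; move: (xi i); rewrite !mxE ffunE/= rmax rmin gt_max lt_min.
    by move=> /andP[/andP[-> _] /andP[-> _]].
  by move=> /andP[/andP[_ ->] /andP[_ ->]].
rewrite !mxE ffunE/= rmax rmin gt_max lt_min.
by have := x1 i; have := x2 i; rewrite !mxE => /andP[-> ->] /andP[-> ->].
Qed.

Lemma measurable_continuous_real (T : ptopologicalType) (f : T -> R) :
  continuous f -> measurable_fun setT (f : borel T -> R).
Proof.
move=> /continuousP cf; apply: (measurability _ (RGenOpens.measurableE R)).
move=> _ [_ [a [b ->]] <-]; rewrite setTI; apply: sub_sigma_algebra.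
by apply: cf; exact: interval_open.
Qed.

End plane_borel.

Section weak_borel.
Context {R : realType}.
Local Notation S := (random_prob 'cV[R]_2 R).

Lemma continuous_sub_fun (T : topologicalType) (f g : T -> R) :
  continuous f -> continuous g -> continuous (fun x => f x - g x).
Proof. by move=> cf cg x; apply: cvgB; [exact: cf|exact: cg]. Qed.

Lemma continuous_scale_fun (T : topologicalType) (c : R) (f : T -> R) :
  continuous f -> continuous (fun x => c * f x).
Proof. by move=> cf x; apply: cvgM; [exact: cvg_cst|exact: cf]. Qed.

Lemma continuous_min_fun (T : topologicalType) (f g : T -> R) :
  continuous f -> continuous g -> continuous (fun x => Num.min (f x) (g x)).
Proof.
move=> cf cg x.
rewrite (_ : (fun _ => _) = fun x => (f x + g x - `|f x - g x|) / 2).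
  apply: cvgM; last exact: cvg_cst.
  apply: cvgB; first by apply: cvgD; [exact: cf|exact: cg].
  by apply: cvg_norm; apply: cvgB; [exact: cf|exact: cg].
by apply/funext => y; rewrite minr_absE.
Qed.

Lemma continuous_max_fun (T : topologicalType) (f g : T -> R) :
  continuous f -> continuous g -> continuous (fun x => Num.max (f x) (g x)).
Proof.
move=> cf cg x.
rewrite (_ : (fun _ => _) = fun x => (f x + g x + `|f x - g x|) / 2).
  apply: cvgM; last exact: cvg_cst.
  apply: cvgD; first by apply: cvgD; [exact: cf|exact: cg].
  by apply: cvg_norm; apply: cvgB; [exact: cf|exact: cg].
by apply/funext => y; rewrite maxr_absE.
Qed.

Definition box_depth (a b x : 'cV[R]_2) : R :=
  Num.min (Num.min (x ord0 ord0 - a ord0 ord0) (b ord0 ord0 - x ord0 ord0))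
          (Num.min (x ord_max ord0 - a ord_max ord0) (b ord_max ord0 - x ord_max ord0)).

Lemma box_depth_gt0 a b x : (0 < box_depth a b x) = `[< box a b x >].
Proof.
apply/idP/asboolP.
  rewrite /box_depth !lt_min => /andP[/andP[h1 h2] /andP[h3 h4]] i.
  have [->|->] : i = ord0 \/ i = ord_max.
    by case: i => [[|[|//]]] ?; [left|right]; exact/val_inj.
    by apply/andP; split; rewrite -subr_gt0.
  by apply/andP; split; rewrite -subr_gt0.
move=> xab; rewrite /box_depth !lt_min !subr_gt0.
by have /andP[-> ->] := xab ord0; have /andP[-> ->] := xab ord_max.
Qed.

Lemma continuous_box_depth a b : continuous (box_depth a b).
Proof.
have cc i : continuous (fun x : 'cV[R]_2 => x i ord0) by exact: coord_continuous.
have c1 i (c : R) : continuous (fun x : 'cV[R]_2 => x i ord0 - c).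
  by apply: continuous_sub_fun; [exact: cc|exact: cst_continuous].
have c2 i (c : R) : continuous (fun x : 'cV[R]_2 => c - x i ord0).
  by apply: continuous_sub_fun; [exact: cst_continuous|exact: cc].
by apply: continuous_min_fun; apply: continuous_min_fun.
Qed.

(** The depth is continuous and positive exactly on the open box, so these bounded continuous
    functions increase with n to its indicator. Evaluation at a box is thereby a limit of weakly
    continuous integrals. *)
Definition box_bump (a b : 'cV[R]_2) (n : nat) (x : 'cV[R]_2) : R :=
  Num.min 1 (Num.max 0 (n%:R * box_depth a b x)).

Lemma box_bump_ge0 a b n x : 0 <= box_bump a b n x.
Proof. by rewrite /box_bump le_min ler01 le_max lexx. Qed.

Lemma box_bump_le1 a b n x : box_bump a b n x <= 1.
Proof. by rewrite /box_bump ge_min lexx. Qed.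

Lemma continuous_box_bump a b n : continuous (box_bump a b n).
Proof.
apply: continuous_min_fun; first exact: cst_continuous.
apply: continuous_max_fun; first exact: cst_continuous.
by apply: continuous_scale_fun; exact: continuous_box_depth.
Qed.

Lemma box_bump_nd a b x : {homo (box_bump a b)^~ x : n m / (n <= m)%N >-> n <= m}.
Proof.
move=> n m nm; rewrite /box_bump.
have [d0|d0] := leP 0 (box_depth a b x).
  have le : n%:R * box_depth a b x <= m%:R * box_depth a b x :> R.
    by rewrite ler_wpM2r// ler_nat.
  by rewrite le_min2// le_max2.
by rewrite !(max_idPl _)// mulr_ge0_le0// ltW.
Qed.

Lemma box_bump_cvg a b x :
  (box_bump a b n x)%:E @[n --> \oo] --> (\1_(box a b) x : R)%:E.
Proof.
rewrite indicE; have [xab|xab] := pselect (box a b x).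
  rewrite mem_set//; move/asboolP : xab; rewrite -box_depth_gt0 => d0.
  apply: cvg_near_cst; near=> n; congr EFin.
  rewrite /box_bump min_l// le_max; apply/orP; right.
  rewrite -ler_pdivrMr// mul1r.
  by near: n; exact: nbhs_infty_ger.
rewrite memNset//.
have d0 : box_depth a b x <= 0.
  by rewrite leNgt box_depth_gt0; apply/negP => /asboolP.
apply: cvg_near_cst; apply: nearW => n; congr EFin.
by rewrite /box_bump (max_idPl _) ?mulr_ge0_le0// min_r.
Unshelve. all: by end_near. Qed.

Lemma bounded_box_bump a b n : bounded_fun (box_bump a b n : 'cV[R]_2 -> R^o).
Proof.
exists 1; split => // M M1 x _ /=.
by rewrite ger0_norm ?box_bump_ge0// (le_trans (box_bump_le1 _ _ _ _))// ltW.
Qed.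

Lemma continuous_coordinate (I : Type) (K : I -> topologicalType) (i : I) :
  continuous (fun f : prod_topology K => f i).
Proof.
move=> f U fU.
have /cvg_sup/(_ i) h : nbhs (f : prod_topology K) --> (f : prod_topology K) by [].
apply: h; exact: (@initial_continuous _ _ (fun f : (forall i, K i) => f i)).
Qed.

Lemma measurable_integrate (f : bounded_continuous 'cV[R]_2 R) :
  measurable_fun setT
    (fun mu : S => (\int[(mu : probability (plane R) R)]_x (sval f x))%R).
Proof.
apply: (@measurable_continuous_real R (weak_prob 'cV[R]_2 R)).
move=> mu.
apply: (@continuous_comp (weak_prob 'cV[R]_2 R)
  (prod_topology (fun _ : bounded_continuous 'cV[R]_2 R => R)) R
  (@integrate 'cV[R]_2 R) (fun g => g f)).
  exact: initial_continuous.
exact: (@continuous_coordinate _ (fun=> R) f).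
Qed.

Lemma integrable_bounded (mu : probability (plane R) R) (f : 'cV[R]_2 -> R) :
  continuous f -> bounded_fun (f : 'cV[R]_2 -> R^o) ->
  mu.-integrable setT (EFin \o (f : plane R -> R)).
Proof.
move=> cf bf; apply: measurable_bounded_integrable => //.
- by rewrite (le_lt_trans (probability_le1 _ _)) ?ltry.
- exact: (@measurable_continuous_real R 'cV[R]_2).
Qed.

Lemma measurable_evaluation_box a b :
  measurable_fun setT (fun mu : S => (mu : probability (plane R) R) (box a b)).
Proof.
pose f n : bounded_continuous 'cV[R]_2 R :=
  exist _ (box_bump a b n) (conj (@continuous_box_bump a b n) (@bounded_box_bump a b n)).
apply: (emeasurable_fun_cvg (fun n (mu : S) =>
  (\int[(mu : probability (plane R) R)]_x (sval (f n) x))%R%:E)).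
  by move=> n; apply/measurable_EFinP; exact: measurable_integrate.
move=> mu _; set m := (mu : probability (plane R) R).
have intf n : m.-integrable setT (EFin \o (box_bump a b n : plane R -> R)).
  exact: (integrable_bounded m (@continuous_box_bump a b n) (@bounded_box_bump a b n)).
have -> : (fun n => (\int[m]_x sval (f n) x)%R%:E) =
    (fun n => \int[m]_x (box_bump a b n x)%:E)%E.
  by apply/funext => n; rewrite /Rintegral fineK//; apply: (integrable_fin_num _ (intf n)).
have -> : m (box a b) = (\int[m]_x limn (fun n => (box_bump a b n x)%:E))%E.
  rewrite -[box a b]setIT -integral_indic//; last exact: measurable_box.
  by apply: eq_integral => x _; apply/esym/cvg_lim => //; exact: box_bump_cvg.
apply: cvg_monotone_convergence => //.
- by move=> n; exact: measurable_int (intf n).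
- by move=> n x _; rewrite lee_fin box_bump_ge0.
- by move=> x _ n p np; rewrite lee_fin box_bump_nd.
Qed.

(** The sets A with a measurable evaluation form a Dynkin class, and the rational boxes are a
    pi-system inside it. *)
Lemma measurable_evaluation (A : set (plane R)) : measurable A ->
  measurable_fun setT (fun mu : S => (mu : probability (plane R) R) A).
Proof.
move=> mA; rewrite borel_plane_boxes in mA; move: A mA.
apply: dynkin_induction; first exact: borel_plane_boxes.
- exact: setI_closed_rat_box.
- apply: (eq_measurable_fun (fun _ : S => 1%E)); last exact: measurable_cst.
  by move=> mu _; rewrite probability_setT.
- move=> _ [p _ <-]; exact: measurable_evaluation_box.
- move=> A mA PA.
  apply: (eq_measurable_fun (fun mu : S => 1 - (mu : probability (plane R) R) A)%E).
    by move=> mu _; rewrite probability_setC.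
  by apply: emeasurable_funB => //; exact: measurable_cst.
- move=> F mF tF PF.
  apply: (eq_measurable_fun (fun mu : S =>
      \sum_(0 <= n <oo) (mu : probability (plane R) R) (F n))%E).
    move=> mu _; rewrite measure_bigcup//; apply: congr_lim; apply/funext => n.
    by apply: eq_bigl => i; rewrite in_setT.
  by apply: ge0_emeasurable_sum => // n mu _ _; exact: measure_ge0.
Qed.
End weak_borel.

(** * A countable basis of the weak topology *)

Section weak_borel_generated.
Context {R : realType}.
Local Notation S := (random_prob 'cV[R]_2 R).
Local Notation idx := {ffun 'I_2 -> rat * rat}.

(** Portmanteau theorem: weak neighbourhoods are described by lower bounds on masses of open sets.
    Finite unions of rational boxes exhaust every open set from inside, and their index type is
    countable. *)
Definition rat_cylinder (s : seq (seq idx * rat)) : set S :=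
  [set mu | forall p, p \in s ->
    ((ratr p.2)%:E < (mu : probability (plane R) R) (rat_boxes p.1))%E].

Definition cylinder_filter (mu : S) : set_system S :=
  filter_from [set s | rat_cylinder s mu] rat_cylinder.

Local Instance cylinder_filter_filter mu : Filter (cylinder_filter mu).
Proof.
apply: filter_from_filter; first by exists [::].
move=> s t /= smu tmu; exists (s ++ t).
  by move=> p; rewrite mem_cat => /orP[/smu|/tmu].
by move=> nu stnu; split => p pst; apply: stnu; rewrite mem_cat pst ?orbT.
Qed.

Lemma near_cylinder_open (mu : S) (G : set 'cV[R]_2) (e : R) : open G -> 0 < e ->
  cylinder_filter mu [set nu : S |
    fine ((mu : probability (plane R) R) (G : set (plane R))) - e <
    fine ((nu : probability (plane R) R) (G : set (plane R)))].
Proof.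
move=> oG e0.
have mG : measurable (G : set (plane R)) by exact: sub_sigma_algebra.
(* The boxes inside G among the first n codes: an increasing sequence of finite unions with union G.
   Half of e is then spent on approximating G and half on finding a rational bound. *)
pose s n := [seq p <- pmap unpickle (iota 0 n) | `[< @rat_box R p `<=` G >]].
have sG n : @rat_boxes R (s n) `<=` G.
  by move=> x [p]; rewrite mem_filter => /andP[/asboolP pG _] /pG.
have GE : G = \bigcup_n @rat_boxes R (s n).
  apply/seteqP; split => [x Gx|x [n _ /sG]//].
  have [p px pG] := rat_box_nbhs oG Gx.
  exists (pickle p).+1 => //; exists p => //.
  rewrite mem_filter; apply/andP; split; first exact/asboolP.
  by rewrite mem_pmap; apply/mapP; exists (pickle p); rewrite ?pickleK// mem_iota/= add0n.
have nds : nondecreasing_seq (fun n => @rat_boxes R (s n)).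
  move=> n m nm; apply/subsetPset => x [p ps px]; exists p => //.
  move: ps; rewrite !mem_filter => /andP[-> /=]; rewrite !mem_pmap => /mapP[i i_n pE].
  by apply/mapP; exists i => //; move: i_n; rewrite !mem_iota/= !add0n => /leq_trans; apply.
set m := (mu : probability (plane R) R).
have : (m (rat_boxes (s n)) @[n --> \oo] --> m G)%E.
  rewrite [in X in _ --> X]GE; apply: nondecreasing_cvg_mu => //.
  - by move=> n; exact: measurable_rat_boxes.
  - by apply: bigcup_measurable => n _; exact: measurable_rat_boxes.
have fm (A : set (plane R)) : measurable A -> m A \is a fin_num.
  by move=> mA; exact: fin_num_measure.
rewrite -(fineK (fm _ mG)) => /fine_cvgP[_] /cvgrPdist_lt/(_ (e / 2)).
rewrite divr_gt0// => /(_ isT)[n _ /(_ n (leqnn n))] /=.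
rewrite ltr_norml => /andP[_]; rewrite ltrBlDr => mGn.
have [q] : exists q : rat, ratr q \in
    `](fine (m (rat_boxes (s n))) - e / 2)%R, (fine (m (rat_boxes (s n))))%R[.
  by apply: rat_in_itvoo; rewrite ltrBlDr ltrDl divr_gt0.
rewrite in_itv/= => /andP[q1 q2].
exists [:: (s n, q)].
  move=> p; rewrite inE => /eqP ->/=.
  by rewrite -[X in (_ < X)%E]fineK ?lte_fin// fm//; exact: measurable_rat_boxes.
move=> nu /(_ (s n, q)); rewrite inE eqxx => /(_ isT)/= qnu.
have : (ratr q <= fine ((nu : probability (plane R) R) G)).
  rewrite -lee_fin fineK; last exact: fin_num_measure.
  apply: (le_trans (ltW qnu)); apply: le_measure => //; rewrite inE//.
  exact: measurable_rat_boxes.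
by rewrite -/m; lra.
Qed.

(** The sum counts the naturals below z, so it is the ceiling of z. This is a discrete layer-cake
    formula. *)
Lemma layer_count (L : nat) (z : R) : 0 <= z <= L%:R ->
  z <= \sum_(i < L) (i%:R < z)%R%:R :> R /\ \sum_(i < L) (i%:R < z)%R%:R <= z + 1.
Proof.
move=> /andP[z0 zL]; split.
  suff : forall n : nat, Num.min z n%:R <= \sum_(i < n) (i%:R < z)%R%:R :> R.
    by move=> /(_ L); rewrite min_l.
  elim=> [|n IH]; first by rewrite big_ord0 ge_min lexx orbT.
  rewrite big_ord_recr/=; have [nz|zn] := ltP n%:R z.
    move: IH; rewrite (min_r (ltW nz)) => IH.
    by rewrite ge_min -natr1 lerD2r IH orbT.
  by rewrite addr0 (le_trans _ IH)// ge_min le_min lexx zn.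
elim: L {zL} => [|n IH]; first by rewrite big_ord0 addr_ge0.
rewrite big_ord_recr/=; have [nz|zn] := ltP n%:R z; last by rewrite addr0.
rewrite lerD2r (le_trans _ (ltW nz))//.
rewrite (le_trans (y := \sum_(i < n) 1))//; first by apply: ler_sum => i _; case: ltP.
by rewrite sumr_const card_ord.
Qed.

(** Two unit errors, one from rounding up to the ceiling and one from the cylinder, are absorbed by
    the gap 2 < N (a - c). *)
Lemma layer_slack (N a b c M s t : R) : 0 < N -> 2 < N * (a - c) ->
  N * (a + M) <= s -> t <= N * (b + M) + 1 -> s - 1 <= t -> c < b.
Proof.
rewrite !mulrBr !mulrDr => N0 NE h1 h2 h3.
by rewrite -(ltr_pM2l N0); lra.
Qed.

Lemma dist_slack (a b e : R) : a - e < b -> - a - e < - b -> `|a - b| < e.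
Proof. by rewrite ltr_norml => h1 h2; apply/andP; split; lra. Qed.

(** Shifted by M and stretched by N, f becomes a function z with values in [0, L], whose integral is
    within 1 of the total mass of its L open superlevel sets. Lower bounds on those masses give one
    on the integral, and N is chosen large enough to make unit errors harmless. *)
Lemma near_cylinder_integrate (mu : S) (f : bounded_continuous 'cV[R]_2 R) (c : R) :
  c < integrate mu f -> cylinder_filter mu [set nu : S | c < integrate nu f].
Proof.
case: f => f [cf bf]; rewrite /integrate/= => cmu.
have [M fM] : exists M : nat, forall x, `|f x| <= M%:R.
  case: bf => B [_ /(_ (Num.max B 0 + 1))] h.
  exists (Num.truncn (Num.max B 0 + 1)).+1 => x.
  apply: (@le_trans _ _ (Num.max B 0 + 1)).
    by apply: h => //; rewrite (@le_lt_trans _ _ (Num.max B 0)) ?le_max ?lexx// ltrDl.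
  by rewrite ltW// truncnS_gt.
pose e := (\int[(mu : probability (plane R) R)]_x f x)%R - c.
have e0 : 0 < e by rewrite subr_gt0.
pose N := (Num.truncn (2 / e)).+1.
have NE : 2 < N%:R * e by rewrite -ltr_pdivrMr// truncnS_gt.
pose L := (2 * M * N)%N.
pose z (x : 'cV[R]_2) := N%:R * (f x + M%:R).
have zL x : 0 <= z x <= L%:R.
  have := fM x; rewrite ler_norml => /andP[f1 f2].
  rewrite /z mulr_ge0//= ?/L; last by rewrite -lerBlDr sub0r.
  by rewrite natrM mulrC ler_wpM2r// mul2n -addnn natrD lerD2r.
pose G i : set 'cV[R]_2 := [set x | i%:R < z x].
have cz : continuous z.
  apply: continuous_scale_fun; rewrite (_ : (fun _ => _) = (fun x => f x - (- M%:R))).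
    by apply: continuous_sub_fun => //; exact: cst_continuous.
  by apply/funext => x; rewrite opprK.
have oG i : open (G i).
  have -> : G i = z @^-1` `]i%:R, +oo[%classic.
    by apply/seteqP; split => x /=; rewrite in_itv/= andbT.
  by move/continuousP : cz; apply; exact: interval_open.
have mG i : measurable (G i : set (plane R)) by exact: sub_sigma_algebra.
pose E (nu : S) := \sum_(i < L) fine ((nu : probability (plane R) R) (G i)).
have bz : bounded_fun (z : 'cV[R]_2 -> R^o).
  exists L%:R; split => // B LB x _ /=.
  by have /andP[z0 zl] := zL x; rewrite ger0_norm// (le_trans zl)// ltW.
have mz : measurable_fun setT (EFin \o (z : plane R -> R)).
  by apply/measurable_EFinP; exact: (@measurable_continuous_real R 'cV[R]_2).
have GE i x : (i%:R < z x)%R%:R = \1_(G i : set (plane R)) x :> R.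
  by rewrite indicE; congr ((nat_of_bool _)%:R); apply/idP/idP; rewrite inE.
have mc : measurable_fun setT
    (fun x : plane R => (\sum_(i < L) (i%:R < z x)%R%:R)%:E : \bar R).
  apply/measurable_EFinP; apply: measurable_sum => i.
  by under eq_fun do rewrite GE; exact: measurable_indic.
have z0 x : 0 <= z x by have /andP[] := zL x.
have intz (nu : S) : (\int[(nu : probability (plane R) R)]_x (z x)%:E)%E =
    (N%:R * ((\int[(nu : probability (plane R) R)]_x f x)%R + M%:R))%:E.
  set m := (nu : probability (plane R) R).
  have If := integrable_bounded m cf bf.
  have IM : m.-integrable setT (EFin \o (cst (M%:R : R) : plane R -> R)).
    exact: finite_measure_integrable_cst.
  rewrite -[LHS]fineK; last first.
    by apply: (integrable_fin_num _ (integrable_bounded m cz bz)).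
  congr EFin; rewrite -[LHS]/(\int[m]_x z x)%R RintegralZl//; last first.
    exact: (integrableD measurableT If IM).
  rewrite RintegralD// Rintegral_cst//.
  rewrite -[in RHS](mulr1 M%:R).
  exact: (congr1 (fun t => N%:R * (_ + M%:R * fine t)) (probability_setT m)).
have intE (nu : S) : (\int[(nu : probability (plane R) R)]_x
    (\sum_(i < L) (i%:R < z x)%R%:R)%:E)%E = (E nu)%:E.
  under eq_integral do rewrite -sumEFin.
  rewrite ge0_integral_sum//; last first.
    move=> i; apply/measurable_EFinP.
    by under eq_fun do rewrite GE; exact: measurable_indic.
  rewrite /E -sumEFin; apply: eq_bigr => i _.
  rewrite fineK; last exact: fin_num_measure.
  rewrite -[X in _ = _ X]setIT -integral_indic//.
  by apply: eq_integral => x _; rewrite GE.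
have Ez (nu : S) : N%:R * ((\int[(nu : probability (plane R) R)]_x f x)%R + M%:R) <= E nu.
  rewrite -lee_fin -intz -intE; apply: ge0_le_integral => //.
  - by move=> x _; rewrite lee_fin.
  - by move=> x _; rewrite lee_fin; exact: (layer_count (zL x)).1.
have Ez1 (nu : S) : E nu <= N%:R * ((\int[(nu : probability (plane R) R)]_x f x)%R + M%:R) + 1.
  rewrite -lee_fin EFinD -intz -intE.
  have <- : (\int[(nu : probability (plane R) R)]_x (cst 1 x) = 1)%E.
    rewrite integral_cst// mul1e.
    exact: (@probability_setT _ _ _ (nu : probability (plane R) R)).
  rewrite -ge0_integralD//; last by move=> x _; rewrite lee_fin.
  apply: ge0_le_integral => //.
  - by move=> x _; rewrite lee_fin sumr_ge0.
  - exact: emeasurable_funD.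
  - by move=> x _; rewrite lee_fin; exact: (layer_count (zL x)).2.
(* Each of the L levels may lose at most 1 / (L + 1), so together they lose at most 1; the extra
   unit also covers L = 0. *)
have : cylinder_filter mu [set nu : S | forall i : 'I_L,
    fine ((mu : probability (plane R) R) (G i)) - L.+1%:R^-1 <
    fine ((nu : probability (plane R) R) (G i))].
  apply: (@filter_forall _ _ (fun i : 'I_L => [set nu : S |
    fine ((mu : probability (plane R) R) (G i)) - L.+1%:R^-1 <
    fine ((nu : probability (plane R) R) (G i))]) _ (cylinder_filter_filter mu)) => i.
  by apply: near_cylinder_open; [exact: oG|rewrite invr_gt0].
apply: filterS => nu /= h.
have : E mu - 1 <= E nu.
  rewrite lerBlDr; apply: (@le_trans _ _ (E nu + \sum_(i < L) L.+1%:R^-1)).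
    rewrite -big_split/=; apply: ler_sum => i _; rewrite -lerBlDr; exact: ltW.
  rewrite lerD2l sumr_const card_ord -(mulr_natl _ L) ler_pdivrMr// mul1r.
  by rewrite ler_nat.
apply: (layer_slack _ NE (Ez mu) (Ez1 nu)).
by rewrite ltr0n.
Qed.

(** Weakly open sets are preimages under [integrate], so it is enough that [integrate] converges
    along the cylinders at mu, one coordinate of the product at a time. *)
Lemma open_rat_cylinder (U : set (weak_prob 'cV[R]_2 R)) mu : open U -> U mu ->
  exists2 s, rat_cylinder s mu & rat_cylinder s `<=` U.
Proof.
move=> [V oV <-] /= Vmu.
suff : @integrate 'cV[R]_2 R @ cylinder_filter mu --> (integrate mu :
    prod_topology (fun _ : bounded_continuous 'cV[R]_2 R => R)).
  move=> /(_ V) /=; apply.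
  by apply: open_nbhs_nbhs.
apply/cvg_sup => f A /=.
move=> [_ [[B oB <-]] /= Bmu BA].
have : (fun nu => integrate nu f) @ cylinder_filter mu --> integrate mu f.
  case: f {B oB Bmu BA} => f [cf bf].
  (* Cylinders bound integrals from below only; the upper bound is the lower bound for the negated
     function. *)
  have cNf : continuous (fun x => 0 - f x).
    by apply: continuous_sub_fun => //; exact: cst_continuous.
  have bNf : bounded_fun ((fun x => 0 - f x) : 'cV[R]_2 -> R^o).
    case: bf => B [Br fB]; exists B; split => // M BM x Mx /=.
    by rewrite sub0r normrN; exact: fB.
  have NfE (nu : S) : integrate nu (exist _ (fun x => 0 - f x) (conj cNf bNf)) =
      - integrate nu (exist _ f (conj cf bf)).
    rewrite /integrate/= RintegralB//.
    + by rewrite Rintegral_cst// mul0r sub0r.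
    + exact: finite_measure_integrable_cst.
    + exact: integrable_bounded.
  apply/(@cvgrPdist_lt _ _ _ (cylinder_filter mu) (cylinder_filter_filter mu)) => e e0.
  have h1 : integrate mu (exist _ f (conj cf bf)) - e < integrate mu (exist _ f (conj cf bf)).
    by rewrite ltrBlDr ltrDl.
  have h2 : integrate mu (exist _ (fun x => 0 - f x) (conj cNf bNf)) - e <
      integrate mu (exist _ (fun x => 0 - f x) (conj cNf bNf)).
    by rewrite ltrBlDr ltrDl.
  have := @filterI _ _ (cylinder_filter_filter mu) _ _
    (near_cylinder_integrate h1) (near_cylinder_integrate h2).
  apply: (@filterS _ (cylinder_filter mu) (cylinder_filter_filter mu)) => nu [] /=.
  by rewrite !NfE; exact: dist_slack.
move=> /(_ B) /= hB.
apply: (@filterS _ _ _ _ _ BA); apply: hB.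
exact: open_nbhs_nbhs.
Qed.

(* The rational cylinders form a countable basis of the weak topology. *)
Lemma measurable_random_prob d (Z : measurableType d) (f : Z -> S) :
  (forall A, measurable A ->
     measurable_fun setT (fun z => (f z : probability (plane R) R) A)) ->
  measurable_fun setT f.
Proof.
move=> mf; apply: (@measurability _ _ Z S _ _ open) => //.
move=> _ [U oU <-]; rewrite setTI.
have -> : U = \bigcup_(s in [set s | rat_cylinder s `<=` U]) rat_cylinder s.
  apply/seteqP; split => [mu Umu|mu [s sU]]; last exact: sU.
  by have [s smu sU] := open_rat_cylinder oU Umu; exists s.
rewrite preimage_bigcup bigcup_mkcond; apply: countable_bigcupT_measurable => // s.
case: ifPn => // _.
rewrite (_ : _ @^-1` _ = \bigcap_(p in [set` s])
  [set z | (ratr p.2)%:E < (f z : probability (plane R) R) (rat_boxes p.1)]%E).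
  apply: fin_bigcap_measurable => // p _.
  rewrite -[X in measurable X]setTI; apply: emeasurable_fun_o_infty => //.
  by apply: mf; exact: measurable_rat_boxes.
by apply/seteqP; split => z h p; exact: h.
Qed.

End weak_borel_generated.

Section random_prob_generators.
Context {R : realType}.
Local Notation S := (random_prob 'cV[R]_2 R).

(** A pi-system. Sequences over nat, read up to n, make the intersection of two cylinders a
    concatenation. *)
Definition evaluation_cylinders : set (set S) :=
  [set D | exists n (A : nat -> set (plane R)) (q : nat -> R),
    (forall i, measurable (A i)) /\
    D = [set mu : S | forall i, (i < n)%N ->
           ((q i)%:E < (mu : probability (plane R) R) (A i))%E]].

Lemma setI_closed_evaluation_cylinders : setI_closed evaluation_cylinders.
Proof.
move=> _ _ [n [A [q [mA ->]]]] [m [B [r [mB ->]]]].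
exists (n + m)%N, (fun i => if (i < n)%N then A i else B (i - n)%N),
  (fun i => if (i < n)%N then q i else r (i - n)%N); split.
  by move=> i; case: ifP.
apply/seteqP; split => [mu [muA muB] i inm|mu h].
  by case: ltnP => ni; [exact: muA|apply: muB; rewrite ltn_subLR].
split => i ni.
  by have := h i; rewrite ni; apply; rewrite ltn_addr.
have := h (n + i)%N; rewrite ltn_add2l => /(_ ni).
by rewrite ltnNge leq_addr /= addKn.
Qed.

(** For the inclusion that rests on the countable basis, [measurable_random_prob] is applied to the
    identity from the space carrying the generated sigma-field. *)
Lemma random_prob_generated : @measurable _ S = <<s evaluation_cylinders >>.
Proof.
rewrite eqEsubset; split.
  move=> D mD.
  have : measurable_fun setT
      (id : g_sigma_algebraType evaluation_cylinders -> S).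
    apply: measurable_random_prob => A mA.
    apply: (measurability _ (ErealGenOInfty.measurableE R)) => _ [_ [q ->] <-].
    rewrite setTI; apply: sub_sigma_algebra.
    exists 1%N, (fun=> A), (fun=> q); split => //.
    apply/seteqP; split => mu /=; rewrite in_itv/= andbT; first by [].
    by move=> /(_ 0%N isT).
  by move=> /(_ measurableT _ mD); rewrite setTI.
apply: smallest_sub; first exact: sigma_algebra_measurable.
move=> _ [n [A [q [mA ->]]]].
have -> : [set mu : S | forall i, (i < n)%N ->
      ((q i)%:E < (mu : probability (plane R) R) (A i))%E] =
    \bigcap_(i in `I_n)
      [set mu : S | ((q i)%:E < (mu : probability (plane R) R) (A i))%E].
  by [].
apply: fin_bigcap_measurable => // i _.
rewrite -[X in measurable X]setTI; apply: emeasurable_fun_o_infty => //.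
exact: measurable_evaluation.
Qed.

End random_prob_generators.

(** * Gamma variables *)

Section gamma_distribution.
Context {R : realType}.
Local Notation leb := (@lebesgue_measure R).
Local Open Scope ereal_scope.

(** The image of Lebesgue measure under multiplication by t, rescaled by t, gives every half-open
    interval its length. *)
Lemma ge0_integral_lebesgue_scale (t : R) (f : R -> \bar R) : (0 < t)%R ->
  (forall x, 0 <= f x) -> measurable_fun setT f ->
  \int[leb]_x f x = t%:E * \int[leb]_x f (t * x)%R.
Proof.
move=> t0 f0 mf.
have mt : measurable_fun setT (( *%R t) : measurableTypeR R -> measurableTypeR R).
  exact: measurable_funM.
have [nu [nuE nuI]] := exists_pushforward leb mt.
pose m := mscale (NngNum (ltW t0)) nu.
have mE A : measurable A -> leb A = m A.
  move: A; apply: (@lebesgue_measure_unique _ m) => _ [[a b] ] _ <-.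
  rewrite -[RHS]/(t%:E * nu `]a, b]%classic) nuE.
  rewrite (_ : _ @^-1` _ = `](a / t)%R, (b / t)%R]%classic); last first.
    by apply/seteqP; split => x /=; rewrite !in_itv/= ltr_pdivrMr// ler_pdivlMr// (mulrC t).
  rewrite lebesgue_measure_itv [X in _ = _ * X]lebesgue_measure_itv/= !lte_fin.
  rewrite ltr_pM2r ?invr_gt0//.
  case: ifPn => ab; last by rewrite mule0.
  by rewrite -!EFinD -EFinM; congr EFin; field; rewrite gt_eqF.
rewrite (eq_measure_integral m); last by move=> A mA _; exact: mE.
by rewrite ge0_integral_mscale//= nuI.
Qed.

(** Raise x / (2a) <= exp(x / (2a)) to the power a. Half of the exponential decay of the gamma
    density is left for integrability at infinity. *)
Lemma powR_le_expR (a x : R) : (0 < a)%R -> (1 <= x)%R ->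
  (x `^ (a - 1) <= (2 * a) `^ a * expR (x / 2))%R.
Proof.
move=> a0 x1; apply: (@le_trans _ _ (x `^ a)%R).
  by rewrite ler_powR// gerBl.
have -> : (expR (x / 2) = (expR (x / (2 * a))) `^ a)%R.
  by rewrite -expRM; congr expR; field; rewrite gt_eqF.
have a20 : (0 <= 2 * a)%R by rewrite mulr_ge0 ?ltW.
rewrite -powRM ?expR_ge0//.
apply: ge0_ler_powR; rewrite ?nnegrE ?mulr_ge0 ?expR_ge0//; first exact: ltW.
  exact: le_trans x1.
  exact: ltW.
rewrite -ler_pdivrMl ?mulr_gt0//.
by rewrite (le_trans _ (expR_ge1Dx _))// mulrC lerDr.
Qed.

Lemma integral_powR01 (a : R) : (0 < a)%R ->
  \int[leb]_(x in `]0%R, 1%R]) (x `^ (a - 1))%:E <= (a^-1)%:E.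
Proof.
move=> a0.
(* For a < 1 the integrand is unbounded at 0, so the antiderivative x^a / a is used away from 0 and
   the endpoint is sent to 0. The offset 2 keeps that endpoint strictly below 1. *)
pose F n : set R := `[(n.+2%:R^-1)%R, 1%R]%classic.
have -> : `]0%R, 1%R]%classic = \bigcup_n F n.
  apply/seteqP; split => x; rewrite /= ?in_itv/=.
    move=> /andP[x0 x1]; exists (Num.truncn x^-1) => //.
    rewrite /F/= in_itv/= x1 andbT.
    rewrite invf_ple ?posrE ?ltr0n// (le_trans (ltW (truncnS_gt _)))// ler_nat//.
  move=> [n _]; rewrite /F/= !in_itv/= => /andP[nx ->]; rewrite andbT.
  by rewrite (lt_le_trans _ nx)// invr_gt0.
have mp (D : set R) : measurable_fun D (fun x : R => (x `^ (a - 1))%:E).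
  by apply/measurable_EFinP; apply: measurable_funTS; exact: measurable_powR.
have cvgF : \int[leb]_(x in F n) (x `^ (a - 1))%:E @[n --> \oo] -->
    \int[leb]_(x in \bigcup_n F n) (x `^ (a - 1))%:E.
  apply: ge0_nondecreasing_set_cvg_integral => //.
  - move=> n m nm; apply/subsetPset => x; rewrite /F/= !in_itv/= => /andP[nx ->].
    by rewrite andbT (le_trans _ nx)// lef_pV2 ?posrE// ler_nat.
  - by move=> n; exact: measurable_itv.
  - by move=> n; exact: mp.
  - by move=> n x _; rewrite lee_fin powR_ge0.
rewrite -(cvg_lim _ cvgF)//; apply: lime_le; first exact: cvgP cvgF.
apply: nearW => n.
have n1 : (n.+2%:R^-1 < 1 :> R)%R by rewrite invf_lt1// ltr1n.
have n0 : (0 < n.+2%:R^-1 :> R)%R by rewrite invr_gt0.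
have dF (x : R) : (0 < x)%R -> is_derive x 1%R (fun x : R => a^-1 * x `^ a)%R (x `^ (a - 1))%R.
  move=> x0; have dp := is_derive1_powR a x0.
  apply: is_derive_eq; rewrite /GRing.scale/= mulrA mulVf ?mul1r// gt_eqF//.
have cF (x : R) : (0 < x)%R -> {for x, continuous (fun x : R => a^-1 * x `^ a)%R}.
  by move=> x0; apply: differentiable_continuous; apply/derivable1_diffP; have [] := dF _ x0.
rewrite (@continuous_FTC2 _ _ (fun x : R => a^-1 * x `^ a)%R)//.
- rewrite powR1 mulr1 -EFinB lee_fin gerBl mulr_ge0// ?powR_ge0// invr_ge0; exact: ltW.
- apply: derivable_within_continuous => x; rewrite in_itv/= => /andP[nx _].
  by apply: derivable_powR; rewrite in_itv/= andbT (lt_le_trans n0).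
- split.
  + move=> x; rewrite in_itv/= => /andP[nx _].
    by have [] := dF x (lt_trans n0 nx).
  + by apply: cvg_at_right_filter; exact: cF.
  + by apply: cvg_at_left_filter; exact: cF.
- move=> x; rewrite in_itv/= => /andP[nx _].
  by have [_] := dF x (lt_trans n0 nx); rewrite derive1E.
Qed.

End gamma_distribution.

Section gamma_probability.
Context {R : realType}.
Local Notation leb := (@lebesgue_measure R).
Local Open Scope ereal_scope.

Let h (a x : R) : R := (x `^ (a - 1) * expR (- x))%R.

Let h_ge0 a x : (0 <= h a x)%R.
Proof. by rewrite mulr_ge0 ?powR_ge0 ?expR_ge0. Qed.

Let measurable_h a (D : set R) : measurable_fun D (h a).
Proof.
apply: measurable_funTS; apply: measurable_funM; first exact: measurable_powR.
exact: measurableT_comp.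
Qed.

Let Eh a (D : set R) : measurable_fun D (fun x => (h a x)%:E).
Proof. exact/measurable_EFinP. Qed.

Let integral_h_lty a : (0 < a)%R ->
  \int[leb]_(x in `]0%R, +oo[) (h a x)%:E < +oo.
Proof.
move=> a0.
have -> : `]0%R, +oo[%classic = `]0%R, 1%R] `|` `]1%R, +oo[ :> set R.
  apply/seteqP; split => x /=; rewrite !in_itv/= !andbT.
    by move=> x0; case: (leP x 1%R) => x1; [left|right]; rewrite ?x0.
  by move=> [/andP[]//|x1]; exact: lt_trans x1.
rewrite ge0_integral_setU//=; last 3 first.
- exact: Eh.
- by move=> x _; rewrite lee_fin.
- apply/disj_setPLR => x; rewrite /= !in_itv/= andbT => /andP[_ x1] /lt_geF.
  by rewrite x1.
apply: lte_add_pinfty.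
  apply: (@le_lt_trans _ _ (\int[leb]_(x in `]0%R, 1%R]) (x `^ (a - 1))%:E)).
    apply: ge0_le_integral => //=.
    - by move=> x _; rewrite lee_fin.
    - exact: Eh.
    - by apply/measurable_EFinP; apply: measurable_funTS; exact: measurable_powR.
    - move=> x; rewrite in_itv/= => /andP[x0 _]; rewrite lee_fin.
      by rewrite /h ler_piMr ?powR_ge0// expR_le1 oppr_le0 ltW.
  by rewrite (le_lt_trans (integral_powR01 a0))// ltry.
(* The factor 2 cancels the rate 1/2 in the exponential density that dominates the tail. *)
pose C : R := ((2 * a) `^ a * 2)%R.
have C0 : (0 <= C)%R by rewrite mulr_ge0 ?powR_ge0.
have half0 : (0 < 2^-1 :> R)%R by [].
apply: (@le_lt_trans _ _ (\int[leb]_x (C%:E * (exponential_pdf 2^-1 x)%:E))).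
  rewrite integral_mkcond; apply: ge0_le_integral => //=.
  - by move=> x _; apply: erestrict_ge0 => y _; rewrite lee_fin.
  - by apply/(measurable_restrictT _ _).1 => //; exact: Eh.
  - apply: measurable_funeM; apply/measurable_EFinP.
    exact: measurable_exponential_pdf.
  - move=> x _; rewrite patchE; case: ifPn; last first.
      by move=> _; rewrite -EFinM lee_fin mulr_ge0// exponential_pdf_ge0.
    rewrite inE/= in_itv/= andbT => x1.
    rewrite -EFinM lee_fin exponential_pdfE ?(le_trans _ (ltW x1))//.
    have -> : (C * (2^-1 * expR (- 2^-1 * x)) = (2 * a) `^ a * expR (- 2^-1 * x))%R.
      by rewrite /C; field.
    rewrite /h.
    apply: le_trans (ler_wpM2r (expR_ge0 _) (powR_le_expR a0 (ltW x1))) _.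
    rewrite -mulrA -expRD ler_wpM2l ?powR_ge0// ler_expR.
    lra.
rewrite ge0_integralZl//=; last 2 first.
- by apply/measurable_EFinP; exact: measurable_exponential_pdf.
- by move=> x _; rewrite lee_fin exponential_pdf_ge0.
by rewrite integral_exponential_pdf// mule1 ltry.
Qed.

Let integral_h_gt0 a : (0 < a)%R ->
  0 < \int[leb]_(x in `]0%R, +oo[) (h a x)%:E.
Proof.
move=> a0.
(* On [1, 2] the power x^(a - 1) = x^a / x is at least 1/2 whatever the sign of a - 1. *)
apply: (@lt_le_trans _ _ (\int[leb]_(x in `[1%R, 2%R]) ((expR (- 2) / 2)%:E))).
  rewrite integral_cst//= lebesgue_measure_itv/= lte_fin ltr1n/=.
  by rewrite -EFinB -EFinM lte_fin mulr_gt0 ?divr_gt0 ?expR_gt0// subr_gt0 ltr1n.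
apply: (@le_trans _ _ (\int[leb]_(x in `[1%R, 2%R]) (h a x)%:E)).
  apply: ge0_le_integral => //=.
  - by apply: (Eh a).
  - move=> x; rewrite in_itv/= => /andP[x1 x2]; rewrite lee_fin /h mulrC.
    have x0 : (0 < x)%R by exact: lt_le_trans x1.
    apply: ler_pM => //; rewrite ?invr_ge0 ?expR_ge0//; last by rewrite ler_expR lerN2.
    rewrite -(ler_pM2l x0) mulr_powRB1 ?(ltW x0)//.
    have : (1 <= x `^ a)%R by rewrite -(powRr0 x) ler_powR// ltW.
    by move=> xa1; apply: le_trans xa1; rewrite ler_pdivrMr// mul1r.
apply: ge0_subset_integral => //=.
- exact: Eh.
- by move=> x _; rewrite lee_fin.
- by move=> x /=; rewrite !in_itv/= andbT => /andP[x1 _]; exact: lt_le_trans x1.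
Qed.

(** Both bounds on the integral enter: [Gamma] is a [fine] value, which would be 0 for an infinite
    integral. *)
Lemma Gamma_gt0 (a : R) : (0 < a)%R -> (0 < Gamma a)%R.
Proof.
by move=> a0; apply: fine_gt0; rewrite integral_h_gt0//= integral_h_lty.
Qed.

Let GammaE a : (0 < a)%R ->
  \int[leb]_(x in `]0%R, +oo[) (h a x)%:E = (Gamma a)%:E.
Proof.
move=> a0; rewrite /Gamma /Rintegral fineK//.
rewrite ge0_fin_numE; first exact: integral_h_lty.
by apply: integral_ge0 => x _; rewrite lee_fin; exact: h_ge0.
Qed.

Lemma gamma_prob_setT (a : R) : gamma_prob a setT = 1.
Proof.
rewrite /gamma_prob; case: ifPn => a0; last by rewrite diracT.
have -> : (fun x => (gamma_pdf a x)%:E) =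
    (fun x => (h a x * (Gamma a)^-1)%:E) \_ `]0%R, +oo[.
  by apply/funext => x; rewrite /gamma_pdf !patchE; case: ifP.
rewrite -integral_mkcond.
under eq_integral do rewrite mulrC EFinM.
rewrite ge0_integralZl//=; last 3 first.
- exact: Eh.
- by move=> x _; rewrite lee_fin.
- by rewrite lee_fin invr_ge0 ltW// Gamma_gt0.
by rewrite GammaE// -EFinM mulVf// gt_eqF// Gamma_gt0.
Qed.

HB.instance Definition _ (a : R) := Measure_isProbability.Build _ _ _
  (gamma_prob a) (gamma_prob_setT a).

Lemma ge0_integral_gamma (a : R) (f : R -> \bar R) : (0 < a)%R ->
  (forall x, 0 <= f x) -> measurable_fun setT f ->
  \int[gamma_prob a]_x f x = \int[leb]_x ((gamma_pdf a x)%:E * f x).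
Proof.
move=> a0 f0 mf.
(* Lebesgue measure is carried by [measurableTypeR R]; its image under the identity lives on the
   same space as [gamma_prob a]. *)
have mid : measurable_fun setT (id : measurableTypeR R -> R) by [].
have [nu [nuE nuI]] := exists_pushforward leb mid.
have mpdf : measurable_fun setT (EFin \o gamma_pdf a).
  by apply/measurable_EFinP; exact: measurable_gamma_pdf.
have pdf0 x : 0 <= (gamma_pdf a x)%:E by rewrite lee_fin gamma_pdf_ge0.
rewrite (@ge0_integral_density _ _ _ nu _ (gamma_pdf a))//.
- rewrite nuI//; first exact: emeasurable_funM.
  by move=> x; rewrite mule_ge0.
- exact: measurable_gamma_pdf.
- move=> A mA; rewrite -[LHS]/(gamma_prob a A) /gamma_prob a0.
  rewrite [RHS]integral_mkcond nuI//.
  + by rewrite [LHS]integral_mkcond.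
  + apply: (measurable_restrictT _ mA).1; apply: measurable_funTS; exact: mpdf.
  + by move=> x; rewrite patchE; case: ifP.
Qed.

Lemma ge0_integral_gamma0 (f : R -> \bar R) :
  measurable_fun setT f ->
  \int[gamma_prob 0]_x f x = f 0%R.
Proof.
move=> mf; rewrite (eq_measure_integral (\d_(0%R : R))); last first.
  by move=> A mA _; rewrite -[LHS]/(gamma_prob 0 A) /gamma_prob ltxx.
by rewrite integral_dirac// diracT mul1e.
Qed.

Lemma gamma_pdf_gt0E (a x : R) : (0 < x)%R ->
  gamma_pdf a x = (x `^ (a - 1) * expR (- x) / Gamma a)%R.
Proof. by move=> x0; rewrite /gamma_pdf patchE mem_set//= in_itv/= x0. Qed.

Lemma gamma_pdf_le0E (a x : R) : (x <= 0)%R -> gamma_pdf a x = 0%R.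
Proof.
by move=> x0; rewrite /gamma_pdf patchE memNset//= in_itv/= andbT ltNge x0.
Qed.

(** Change of variable x -> t x in the density, with exp(-t x) split as exp(-(t - 1) x) exp(-x) so
    that the same gamma law stands on both sides. The point mass at a = 0 fits because t^0 = 1. *)
Lemma gamma_scale (a t : R) (f : R -> \bar R) : (0 <= a)%R -> (0 < t)%R ->
  (forall x, 0 <= f x) -> measurable_fun setT f ->
  \int[gamma_prob a]_x f x =
  (t `^ a)%:E * \int[gamma_prob a]_x ((expR (- ((t - 1) * x)))%:E * f (t * x)%R).
Proof.
move=> a0 t0 f0 mf.
have ml (c : R) : measurable_fun setT (fun x : R => c * x)%R.
  exact: measurable_funM.
have mft : measurable_fun setT (fun x => f (t * x)%R).
  exact: (measurableT_comp mf (ml t)).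
have me : measurable_fun setT (fun x : R => (expR (- ((t - 1) * x)))%:E).
  apply/measurable_EFinP; apply: (measurableT_comp (@measurable_expR R)).
  exact: (measurableT_comp (@oppr_measurable R setT) (ml _)).
have mg : measurable_fun setT
    (fun x => (expR (- ((t - 1) * x)))%:E * f (t * x)%R).
  exact: emeasurable_funM.
have g0 x : 0 <= (expR (- ((t - 1) * x)))%:E * f (t * x)%R.
  by rewrite mule_ge0// lee_fin expR_ge0.
move: a0; rewrite le_eqVlt => /orP[/eqP <-|a0].
  by rewrite !ge0_integral_gamma0// powRr0 !mulr0 oppr0 expR0 !mul1e.
have mpdf : measurable_fun setT (fun x => (gamma_pdf a x)%:E).
  by apply/measurable_EFinP; exact: measurable_gamma_pdf.
rewrite !ge0_integral_gamma//.
rewrite (ge0_integral_lebesgue_scale t0)//; last 2 first.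
- by move=> x; rewrite mule_ge0// lee_fin gamma_pdf_ge0.
- exact: emeasurable_funM.
rewrite -ge0_integralZl//; last 3 first.
- apply: emeasurable_funM => //.
  exact: (measurableT_comp mpdf (ml t)).
- by move=> x _; rewrite mule_ge0// lee_fin gamma_pdf_ge0.
- by rewrite lee_fin ltW.
rewrite -ge0_integralZl//; last 3 first.
- exact: emeasurable_funM.
- by move=> x _; rewrite mule_ge0// lee_fin gamma_pdf_ge0.
- by rewrite lee_fin powR_ge0.
apply: eq_integral => x _; rewrite !muleA -!EFinM; congr (_%:E * _).
have [x0|x0] := leP x 0%R.
  by rewrite !gamma_pdf_le0E ?mulr0 ?mul0r ?mulr_ge0_le0// ltW.
rewrite !gamma_pdf_gt0E ?mulr_gt0// powRM ?ltW//.
rewrite -(mulr_powRB1 (ltW t0) a0).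
have -> : expR (- (t * x)) = (expR (- ((t - 1) * x)) * expR (- x))%R.
  by rewrite -expRD; congr expR; ring.
by ring.
Qed.

(** The mean of Gamma(a, 1), as [gammaP_mean] shows. Its proportionality to a is obtained in
    [gamma_ratio_linear] from additivity rather than by integration by parts. *)
Definition gamma_ratio (a : R) : R :=
  if (0 < a)%R then (Gamma (a + 1) / Gamma a)%R else 0%R.

Lemma gamma_ratio_gt0 (a : R) : (0 < a)%R -> (0 < gamma_ratio a)%R.
Proof.
by move=> a0; rewrite /gamma_ratio a0 divr_gt0// Gamma_gt0// addr_gt0.
Qed.

(** Size-biasing: a factor x raises the exponent in the density by one. The positive part keeps the
    integrand nonnegative on the whole line and changes it only on a null set. *)
Lemma gamma_shift (a : R) (f : R -> \bar R) : (0 <= a)%R ->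
  (forall x, 0 <= f x) -> measurable_fun setT f ->
  \int[gamma_prob a]_x ((Num.max x 0%R)%:E * f x) =
  (gamma_ratio a)%:E * \int[gamma_prob (a + 1)]_x f x.
Proof.
move=> a0 f0 mf.
have mx : measurable_fun setT (fun x : R => (Num.max x 0%R)%:E).
  by apply/measurable_EFinP; exact: measurable_maxr.
have g0 (x : R) : 0 <= (Num.max x 0%R)%:E * f x.
  by rewrite mule_ge0// lee_fin le_max lexx orbT.
have mg : measurable_fun setT (fun x : R => (Num.max x 0%R)%:E * f x).
  exact: emeasurable_funM.
move: a0; rewrite le_eqVlt => /orP[/eqP <-|a0].
  have -> : gamma_ratio 0 = 0%R by rewrite /gamma_ratio ltxx.
  rewrite mul0e; apply: etrans (ge0_integral_gamma0 mg) _.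
  by rewrite maxxx mul0e.
have a1 : (0 < a + 1)%R by rewrite addr_gt0.
apply: etrans (ge0_integral_gamma a0 g0 mg) _.
apply: etrans _ (esym (congr1 (fun z => _ * z) (ge0_integral_gamma a1 f0 mf))).
rewrite -ge0_integralZl//; last 3 first.
- apply: emeasurable_funM => //; apply/measurable_EFinP.
  exact: measurable_gamma_pdf.
- by move=> x _; rewrite mule_ge0// lee_fin gamma_pdf_ge0.
- by rewrite lee_fin ltW// gamma_ratio_gt0.
apply: eq_integral => x _; rewrite !muleA -!EFinM; congr (_%:E * _).
have [x0|x0] := leP x 0%R.
  by rewrite !gamma_pdf_le0E// ?mulr0 ?mul0r.
rewrite !gamma_pdf_gt0E// /gamma_ratio a0 addrK -(mulr_powRB1 (ltW x0) a0).
have ga := Gamma_gt0 a0; have ga1 : (0 < Gamma (a + 1))%R by rewrite Gamma_gt0// addr_gt0.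
by field; rewrite !gt_eqF.
Qed.

Lemma gamma_prob_le0 (a : R) : (0 < a)%R -> gamma_prob a [set x | (x <= 0)%R] = 0.
Proof.
move=> a0; rewrite /gamma_prob a0 integral0_eq// => x /= x0.
by rewrite gamma_pdf_le0E.
Qed.

End gamma_probability.

(** * Independent gamma variables *)

Section gamma_products.
Context {R : realType}.
Local Open Scope ereal_scope.

(* A copy of gamma_prob, made opaque since unification tends to unfold integrals
   against gamma_prob down to the Lebesgue measure. *)
Definition gammaP (a : R) : probability R R := gamma_prob a.

Lemma gammaP_scale (a t : R) (f : R -> \bar R) : (0 <= a)%R -> (0 < t)%R ->
  (forall x, 0 <= f x) -> measurable_fun setT f ->
  \int[gammaP a]_x f x =
  (t `^ a)%:E * \int[gammaP a]_x ((expR (- ((t - 1) * x)))%:E * f (t * x)%R).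
Proof. exact: gamma_scale. Qed.

Lemma gammaP_shift (a : R) (f : R -> \bar R) : (0 <= a)%R ->
  (forall x, 0 <= f x) -> measurable_fun setT f ->
  \int[gammaP a]_x ((Num.max x 0%R)%:E * f x) =
  (gamma_ratio a)%:E * \int[gammaP (a + 1)]_x f x.
Proof. exact: gamma_shift. Qed.

Lemma gammaP_le0 (a : R) : (0 < a)%R -> gammaP a [set x | (x <= 0)%R] = 0.
Proof. exact: gamma_prob_le0. Qed.

Lemma gammaP_lt0 (a : R) : (0 <= a)%R -> gammaP a [set x | (x < 0)%R] = 0.
Proof.
rewrite le_eqVlt => /orP[/eqP <-|a0].
  rewrite -[LHS]/(gamma_prob 0 _) /gamma_prob ltxx diracE memNset//=.
  by rewrite ltxx.
apply/eqP; rewrite -measure_le0 -(gammaP_le0 a0); apply: le_measure.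
- rewrite inE -[X in measurable X]setTI.
  by apply: measurable_fun_ltr => //; exact: measurable_cst.
- rewrite inE -[X in measurable X]setTI.
  by apply: measurable_fun_ler => //; exact: measurable_cst.
- by move=> x /=; exact: ltW.
Qed.

Lemma gamma_expectation_cons (a : R) (s : seq R) (F : seq R -> \bar R) :
  gamma_expectation (a :: s) F =
  \int[gammaP a]_y gamma_expectation s (fun ys => F (y :: ys)).
Proof. by []. Qed.

Global Opaque gammaP.

Definition tcons n (p : R * n.-tuple R) : n.+1.-tuple R :=
  [tuple of p.1 :: p.2].

Lemma measurable_tcons n : measurable_fun setT (@tcons n).
Proof. exact: measurable_cons. Qed.

HB.instance Definition _ n :=
  isMeasurableFun.Build _ _ _ _ (@tcons n) (@measurable_tcons n).

(** A genuine probability measure in place of the iterated integral [gamma_expectation], so that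
    Fubini and null sets become available. Parameters form a sequence over nat, so that passing to
    the tail is a composition with the successor. *)
Fixpoint gprod (n : nat) (a : nat -> R) : probability (n.-tuple R) R :=
  match n with
  | 0%N => \d_([tuple])
  | n.+1 => distribution (gammaP (a 0%N) \x gprod n (a \o S)) (@tcons n)
  end.

Lemma measurable_tcons2 n d (T : measurableType d) (f : T -> R)
    (g : T -> n.-tuple R) :
  measurable_fun setT f -> measurable_fun setT g ->
  measurable_fun setT (fun x => tcons (f x, g x)).
Proof. by move=> mf mg; exact: measurable_cons. Qed.

Lemma integral_gprod0 (a : nat -> R) (f : 0.-tuple R -> \bar R) :
  \int[gprod 0 a]_t f t = f [tuple].
Proof.
rewrite integral_dirac//; first by rewrite diracT mul1e.
by move=> _ Y mY; rewrite setTI; case: (pselect (Y (f [tuple]))) => Yf;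
  [rewrite (_ : _ @^-1` _ = setT)//|rewrite (_ : _ @^-1` _ = set0)//];
  apply/seteqP; split => t //=; rewrite (tuple0 t).
Qed.

Lemma integral_gprodS n (a : nat -> R) (f : n.+1.-tuple R -> \bar R) :
  (forall t, 0 <= f t) -> measurable_fun setT f ->
  \int[gprod n.+1 a]_t f t =
  \int[gammaP (a 0%N)]_y \int[gprod n (a \o S)]_t f (tcons (y, t)).
Proof.
move=> f0 mf; rewrite ge0_integral_distribution// fubini_tonelli1//.
  exact: (measurableT_comp mf (@measurable_tcons n)).
by move=> p; exact: f0.
Qed.

Lemma measurable_integral_gprod n a d (T : measurableType d)
    (f : T * n.-tuple R -> \bar R) :
  (forall x, 0 <= f x) -> measurable_fun setT f ->
  measurable_fun setT (fun x => \int[gprod n a]_t f (x, t)).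
Proof. by move=> f0 mf; exact: measurable_fun_fubini_tonelli_F. Qed.

Lemma gamma_expectationE n (s : seq R) (F : seq R -> \bar R) : size s = n ->
  (forall x, 0 <= F x) ->
  measurable_fun setT (fun t : n.-tuple R => F t) ->
  gamma_expectation s F = \int[gprod n (nth 0%R s)]_t F t.
Proof.
elim: s n F => [|x s IH] [|n] F // sn F0 mF.
  exact: (esym (integral_gprod0 (nth 0%R [::]) (fun t => F t))).
have mF' : measurable_fun setT (fun p : R * n.-tuple R => F (tcons p)).
  exact: (measurableT_comp mF (@measurable_tcons n)).
apply: etrans (gamma_expectation_cons x s F) _.
apply: etrans _ (esym (@integral_gprodS n (nth 0%R (x :: s)) (fun t => F t) _ mF)) => //.
apply: eq_integral => y _; apply: (IH n); first by case: sn.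
  by [].
exact: (measurableT_comp mF' (measurable_pair1 y)).
Qed.

Definition tsum n (t : n.-tuple R) : R := \sum_(z <- t) z.
Definition tscale n (c : R) (t : n.-tuple R) : n.-tuple R :=
  [tuple of map ( *%R c) t].

Lemma tsum_cons n (p : R * n.-tuple R) : tsum (tcons p) = (p.1 + tsum p.2)%R.
Proof. by rewrite /tsum big_cons. Qed.

Lemma tscale_cons n c (p : R * n.-tuple R) :
  tscale c (tcons p) = tcons (c * p.1, tscale c p.2)%R.
Proof. exact/val_inj. Qed.

Lemma tsum_scale n c (t : n.-tuple R) : tsum (tscale c t) = (c * tsum t)%R.
Proof. by rewrite /tsum big_map mulr_sumr. Qed.

Lemma measurable_tsum n : measurable_fun setT (@tsum n).
Proof.
rewrite (_ : @tsum n = fun t => \sum_(i < n) tnth t i)%R; last first.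
  by apply/funext => t; rewrite /tsum big_tuple.
by apply: measurable_sum => i; exact: measurable_tnth.
Qed.

Lemma measurable_tscale n d (T : measurableType d) (c : T -> R) (g : T -> n.-tuple R) :
  measurable_fun setT c -> measurable_fun setT g ->
  measurable_fun setT (fun x => tscale (c x) (g x)).
Proof.
move=> mc mg; apply/measurable_fun_tnthP => i.
rewrite (_ : _ \o _ = fun x => c x * tnth (g x) i)%R; last first.
  by apply/funext => x /=; rewrite tnth_map.
by apply: measurable_funM => //; exact: (measurableT_comp (measurable_tnth i) mg).
Qed.

(** The powers of c multiply to one power, and the exponential factors to a function of the total
    alone. This is what singles out gamma variables in Lukacs' theorem. *)
Lemma gprod_scale n (a : nat -> R) (c : R) (f : n.-tuple R -> \bar R) :
  (forall i, 0 <= a i)%R -> (0 < c)%R ->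
  (forall t, 0 <= f t) -> measurable_fun setT f ->
  \int[gprod n a]_t f t = (c `^ (\sum_(i < n) a i))%:E *
    \int[gprod n a]_t ((expR (- ((c - 1) * tsum t)))%:E * f (tscale c t)).
Proof.
move=> + c0; elim: n a f => [|n IH] a f a0 f0 mf.
  rewrite !integral_gprod0 big_ord0 powRr0 mul1e /tsum big_nil mulr0 oppr0 expR0.
  by rewrite mul1e; congr f; exact/val_inj.
have me m : measurable_fun setT (fun t : m.-tuple R => (expR (- ((c - 1) * tsum t)))%:E).
  apply/measurable_EFinP; apply: (measurableT_comp (@measurable_expR R)).
  apply: (measurableT_comp (@oppr_measurable R setT)).
  by apply: measurable_funM => //; exact: measurable_tsum.
have e0 (x : R) : 0 <= (expR x)%:E by rewrite lee_fin expR_ge0.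
have mfs : measurable_fun setT (fun t => f (tscale c t)).
  by apply: (measurableT_comp mf); exact: measurable_tscale.
rewrite !integral_gprodS//; last 2 first.
- by move=> t; exact: mule_ge0.
- exact: (emeasurable_funM (me _) mfs).
pose phi y := \int[gprod n (a \o S)]_t f (tcons (y, t)).
have mphi : measurable_fun setT phi.
  apply: (@measurable_integral_gprod _ _ _ _ (fun p => f (tcons p))) => //.
  exact: (measurableT_comp mf (@measurable_tcons n)).
have phi0 y : 0 <= phi y by exact: integral_ge0.
rewrite -[LHS]/(\int[gammaP (a 0%N)]_y phi y).
rewrite (gammaP_scale (a0 0%N) c0 phi0 mphi).
rewrite big_ord_recl powRD; last by rewrite (gt_eqF c0) implybT.
rewrite EFinM -muleA; congr (_ * _).
rewrite -ge0_integralZl//; last 3 first.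
- apply: (@measurable_integral_gprod _ _ _ _ (fun p =>
    (expR (- ((c - 1) * tsum (tcons p))))%:E * f (tscale c (tcons p)))).
    by move=> p; exact: mule_ge0.
  by apply: emeasurable_funM; [exact: (measurableT_comp (me _) (@measurable_tcons n))
    |exact: (measurableT_comp mfs (@measurable_tcons n))].
- by move=> y _; apply: integral_ge0 => t _; exact: mule_ge0.
- by rewrite lee_fin powR_ge0.
apply: eq_integral => y _.
have mty (z : R) : measurable_fun setT (fun t : n.-tuple R => tcons (z, t)).
  exact: measurable_tcons2.
have mfc z : measurable_fun setT (fun t => f (tcons (z, t))).
  by apply: (measurableT_comp mf); exact: measurable_tcons2.
rewrite /phi IH//=.
have mfcs : measurable_fun setT (fun t => f (tcons ((c * y)%R, tscale c t))).
  by apply: (measurableT_comp (mfc _)); exact: measurable_tscale.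
rewrite -!ge0_integralZl//; last 8 first.
- apply: emeasurable_funM.
    exact: (measurableT_comp (me n.+1) (mty y)).
  exact: (measurableT_comp mfs (mty y)).
- by move=> t _; exact: mule_ge0.
- by rewrite lee_fin powR_ge0.
- by apply: measurable_funeM; exact: (emeasurable_funM (me _) mfcs).
- by move=> t _; rewrite mule_ge0 ?lee_fin ?powR_ge0// mule_ge0.
- exact: (emeasurable_funM (me _) mfcs).
- by move=> t _; exact: mule_ge0.
- by rewrite lee_fin powR_ge0.
apply: eq_integral => t _.
rewrite tsum_cons tscale_cons/= mulrDr opprD expRD EFinM.
by rewrite -!muleA [LHS]muleCA.
Qed.

End gamma_products.

(** * Dirichlet variables *)

Section lukacs.
Context {R : realType}.
Local Open Scope ereal_scope.

(** Inversion is the power -1 on nonnegative reals, including the convention 0^-1 = 0, and its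
    reflection on negative ones. *)
Lemma measurable_invr : measurable_fun setT (@GRing.inv R).
Proof.
rewrite (_ : @GRing.inv R =
    fun x => if (0 <= x)%R then (x `^ (- 1))%R else (- ((- x) `^ (- 1)))%R).
  apply: measurable_fun_ifT.
  - by apply: measurable_fun_ler; [exact: measurable_cst|exact: measurable_id].
  - exact: measurable_powR.
  - apply: (measurableT_comp (@oppr_measurable R setT)).
    exact: (measurableT_comp (measurable_powR _) (@oppr_measurable R setT)).
apply/funext => x; case: leP => x0; first by rewrite powR_inv1.
by rewrite powR_inv1 ?oppr_ge0 ?ltW// invrN opprK.
Qed.

Lemma eq_integral_null d (T : measurableType d) (mu : {measure set T -> \bar R})
    (N : set T) (f g : T -> \bar R) :
  measurable N -> mu N = 0 ->
  (forall x, 0 <= f x) -> measurable_fun setT f ->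
  (forall x, 0 <= g x) -> measurable_fun setT g ->
  (forall x, ~ N x -> f x = g x) -> \int[mu]_x f x = \int[mu]_x g x.
Proof.
move=> mN N0 f0 mf g0 mg fg; apply: ge0_ae_eq_integral => //.
exists N; split => // x /= /not_implyP[_ fgx].
by apply: contrapT => /fg.
Qed.

Lemma integral_cst_probability d (T : measurableType d) (P : probability T R)
    (c : \bar R) : \int[P]_x c = c.
Proof.
apply: etrans (integral_cst _ measurableT c) _.
exact: (etrans (congr1 (fun z => c * z) (probability_setT P)) (mule1 _)).
Qed.

Lemma measurable_le0 : measurable [set x : R | (x <= 0)%R].
Proof.
rewrite -[X in measurable X]setTI.
by apply: measurable_fun_ler => //; exact: measurable_cst.
Qed.

Lemma measurable_lt0 : measurable [set x : R | (x < 0)%R].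
Proof.
rewrite -[X in measurable X]setTI.
by apply: measurable_fun_ltr => //; exact: measurable_cst.
Qed.

Lemma measurable_tsum_preimage n (A : set R) : measurable A ->
  measurable [set t : n.-tuple R | A (tsum t)].
Proof.
by move=> mA; rewrite -[X in measurable X]setTI; exact: measurable_tsum.
Qed.

Lemma gprodS_null n (a : nat -> R) (D : set (n.+1.-tuple R)) (A : set R)
    (B : set (n.-tuple R)) :
  measurable D -> measurable A -> measurable B ->
  (forall y t, D (tcons (y, t)) -> A y \/ B t) ->
  gammaP (a 0%N) A = 0 -> gprod n (a \o S) B = 0 -> gprod n.+1 a D = 0.
Proof.
move=> mD mA mB DAB A0 B0; apply/eqP; rewrite -measure_le0.
pose m : probability _ R := gammaP (a 0%N) \x gprod n (a \o S).
rewrite -[X in X <= _]/(m (@tcons R n @^-1` D)).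
have mAB : measurable ((A `*` setT) `|` (setT `*` B)).
  by apply: measurableU; exact: measurableX.
apply: (@le_trans _ _ (m ((A `*` setT) `|` (setT `*` B)))).
  apply: le_measure; rewrite ?inE//.
    by rewrite -[X in measurable X]setTI; exact: measurable_tcons.
  by move=> [y t] /= /DAB[]; [left|right].
have mA0 : m (A `*` setT) = 0.
  apply: etrans (product_measure1E _ _ mA measurableT) _.
  exact: (etrans (congr1 (fun z => z * _) A0) (mul0e _)).
have mB0 : m (setT `*` B) = 0.
  apply: etrans (product_measure1E _ _ measurableT mB) _.
  exact: (etrans (congr1 (fun z => _ * z) B0) (mule0 _)).
apply: (le_trans (measureU2 m (measurableX mA measurableT) (measurableX measurableT mB))).
suff : m (A `*` setT) + m (setT `*` B) = 0.
  by move/eqP; rewrite eq_le => /andP[].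
by rewrite mA0 mB0 adde0.
Qed.

Lemma gprod_tsum_lt0 n (a : nat -> R) : (forall i, 0 <= a i)%R ->
  gprod n a [set t | (tsum t < 0)%R] = 0.
Proof.
elim: n a => [|n IH] a a0.
  transitivity (\d_([tuple] : 0.-tuple R) [set t | (tsum t < 0)%R] : \bar R) => //.
  rewrite diracE memNset//= /tsum big_nil.
  by apply/negP; rewrite ltxx.
apply: (@gprodS_null _ _ _ [set x | (x < 0)%R] [set t | (tsum t < 0)%R]) => //.
- exact: (measurable_tsum_preimage measurable_lt0).
- exact: measurable_lt0.
- exact: (measurable_tsum_preimage measurable_lt0).
- move=> y t; rewrite /= tsum_cons/=.
  by case: (ltP y 0%R) => y0; [left|right]; lra.
- exact: gammaP_lt0.
- by apply: IH => i; exact: a0.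
Qed.

(** Some coordinate with positive parameter is positive almost surely and the others are
    nonnegative. This is the null set off which one may divide by the total. *)
Lemma gprod_tsum_le0 n (a : nat -> R) : (forall i, 0 <= a i)%R ->
  (0 < \sum_(i < n) a i)%R -> gprod n a [set t | (tsum t <= 0)%R] = 0.
Proof.
elim: n a => [|n IH] a a0; first by rewrite big_ord0 ltxx.
rewrite big_ord_recl => s0.
have [a00|a00] := eqVneq (a 0%N) 0%R.
  apply: (@gprodS_null _ _ _ [set x | (x < 0)%R] [set t | (tsum t <= 0)%R]) => //.
  - exact: (measurable_tsum_preimage measurable_le0).
  - exact: measurable_lt0.
  - exact: (measurable_tsum_preimage measurable_le0).
  - move=> y t; rewrite /= tsum_cons/=.
    by case: (ltP y 0%R) => y0; [left|right]; lra.
  - exact: gammaP_lt0.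
  - apply: IH => [i|]; first exact: a0.
    by move: s0; rewrite a00 add0r.
apply: (@gprodS_null _ _ _ [set x | (x <= 0)%R] [set t | (tsum t < 0)%R]) => //.
- exact: (measurable_tsum_preimage measurable_le0).
- exact: measurable_le0.
- exact: (measurable_tsum_preimage measurable_lt0).
- move=> y t; rewrite /= tsum_cons/=.
  by case: (leP y 0%R) => y0; [left|right]; lra.
- by apply: gammaP_le0; rewrite lt_neqAle eq_sym a00 a0.
- by apply: gprod_tsum_lt0 => i; exact: a0.
Qed.

(** Taking a plain sequence makes it literally the vector that occurs in [dirichlet]. *)
Definition snorm n (y : seq R) : n.-tuple R :=
  [tuple (y`_i / \sum_(z <- y) z)%R | i < n].

Lemma measurable_snorm n : measurable_fun setT (fun t : n.-tuple R => snorm n t).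
Proof.
apply/measurable_fun_tnthP => i.
rewrite (_ : _ \o _ = fun t : n.-tuple R => (tnth t i * (tsum t)^-1)%R); last first.
  by apply/funext => t /=; rewrite tnth_mktuple (tnth_nth 0%R).
apply: measurable_funM; first exact: measurable_tnth.
exact: (measurableT_comp measurable_invr (@measurable_tsum _ n)).
Qed.

Lemma snorm_scale n (c : R) (t : n.-tuple R) : (c != 0)%R ->
  snorm n (tscale c t) = snorm n t.
Proof.
move=> c0; apply: eq_from_tnth => i; rewrite !tnth_mktuple.
rewrite -[X in (_ / X)%R]/(tsum (tscale c t)) tsum_scale.
rewrite (nth_map 0%R) ?size_tuple// -mulf_div divff// mul1r//.
Qed.

(* Lukacs: the total mass of independent gamma variables is independent of
   their proportions.  The proof inserts the factor
   1 = E_(u ~ Gamma(b)) [s^-b exp(u - u / s)] at s = S, rescales Y to u Y and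
   thus decouples S from u S. *)
Lemma gprod_lukacs n (a : nat -> R) (h : n.-tuple R * R -> \bar R) :
  (forall i, 0 <= a i)%R -> (0 < \sum_(i < n) a i)%R ->
  (forall x, 0 <= h x) -> measurable_fun setT h ->
  \int[gprod n a]_t h (snorm n t, tsum t) =
  \int[gprod n a]_t \int[gammaP (\sum_(i < n) a i)%R]_u h (snorm n t, u).
Proof.
move=> a0; set b := (\sum_(i < n) a i)%R => b0 h0 mh.
have e0 (x : R) : 0 <= (expR x)%:E by rewrite lee_fin expR_ge0.
pose w (s : R) : R := (s `^ (- b) * s `^ (- b) * expR (s - s^-1))%R.
have w0 s : 0 <= (w s)%:E by rewrite lee_fin !mulr_ge0 ?powR_ge0 ?expR_ge0.
have mS : measurable_fun setT (@tsum R n) by exact: measurable_tsum.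
have mN : measurable_fun setT (fun t : n.-tuple R => snorm n t).
  exact: measurable_snorm.
have mw : measurable_fun setT w.
  apply: measurable_funM.
    by apply: measurable_funM; exact: measurable_powR.
  apply: (measurableT_comp (@measurable_expR R)).
  by apply: measurable_funB => //; exact: measurable_invr.
pose H (h : n.-tuple R * R -> \bar R) d := \int[gammaP b]_u h (d, u).
have mH k : (forall x, 0 <= k x) -> measurable_fun setT k ->
    measurable_fun setT (H k).
  by move=> k0 mk; exact: measurable_fun_fubini_tonelli_F.
have H0 k d : (forall x, 0 <= k x) -> 0 <= H k d.
  by move=> k0; exact: integral_ge0.
(* The weight w collects what the two rescalings leave over. It disappears by using [key] twice, for
   h and for [H h], which ignores the total: both integrals get the same right-hand side. *)
suff key (k : n.-tuple R * R -> \bar R) :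
    (forall x, 0 <= k x) -> measurable_fun setT k ->
    \int[gprod n a]_t k (snorm n t, tsum t) =
    \int[gprod n a]_t ((w (tsum t))%:E * H k (snorm n t)).
  rewrite key//.
  rewrite -[RHS]/(\int[gprod n a]_t (H h \o fst) (snorm n t, tsum t)).
  rewrite [RHS]key//.
  - apply: eq_integral => t _; congr (_ * _).
    exact: (esym (integral_cst_probability (gammaP b) (H h (snorm n t)))).
  - by move=> x /=; exact: H0.
  - by apply: (measurableT_comp _ measurable_fst); exact: mH.
move=> k0 mk.
pose pos : set (n.-tuple R) := [set t | (tsum t <= 0)%R].
have mpos : measurable pos := measurable_tsum_preimage measurable_le0.
have pos0 : gprod n a pos = 0 by exact: gprod_tsum_le0.
pose q (s u : R) : R := (s `^ (- b) * expR (u - u / s))%R.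
have q0 s u : 0 <= (q s u)%:E by rewrite lee_fin mulr_ge0 ?powR_ge0 ?expR_ge0.
have mq d (T : measurableType d) (f g : T -> R) : measurable_fun setT f ->
    measurable_fun setT g -> measurable_fun setT (fun x => (q (f x) (g x))%:E).
  move=> mf mg; apply/measurable_EFinP; apply: measurable_funM.
    exact: (measurableT_comp (measurable_powR _) mf).
  apply: (measurableT_comp (@measurable_expR R)).
  apply: measurable_funB => //; apply: measurable_funM => //.
  exact: (measurableT_comp measurable_invr mf).
have q1 s : (0 < s)%R -> \int[gammaP b]_u (q s u)%:E = 1.
  move=> s0.
  have := @gammaP_scale R b s^-1%R (cst 1) (ltW b0).
  rewrite invr_gt0 => /(_ s0 (fun=> lee01) (measurable_cst _)).
  rewrite integral_cst_probability => ->.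
  under [X in _ = _ * X]eq_integral do rewrite mule1.
  rewrite -ge0_integralZl//=; last 2 first.
  - apply/measurable_EFinP; apply: (measurableT_comp (@measurable_expR R)).
    apply: (measurableT_comp (@oppr_measurable R setT)).
    exact: measurable_funM.
  - by rewrite lee_fin powR_ge0.
  apply: eq_integral => u _; rewrite -EFinM /q; congr (_ * expR _)%:E.
    by rewrite -(powR_inv1 (ltW s0)) -powRrM mulN1r.
  by field; rewrite gt_eqF.
pose F (p : n.-tuple R * R) := (q (tsum p.1) p.2)%:E * k (snorm n p.1, tsum p.1).
have mS1 : measurable_fun setT (fun p : n.-tuple R * R => tsum p.1).
  exact: (measurableT_comp mS measurable_fst).
have mN1 : measurable_fun setT (fun p : n.-tuple R * R => snorm n p.1).
  exact: (measurableT_comp mN measurable_fst).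
have mkNS : measurable_fun setT (fun t : n.-tuple R => k (snorm n t, tsum t)).
  by apply: (measurableT_comp mk); exact: measurable_fun_pair.
have mF : measurable_fun setT F.
  apply: emeasurable_funM; first exact: mq.
  exact: (measurableT_comp mkNS measurable_fst).
have F0 p : 0 <= F p by rewrite mule_ge0.
transitivity (\int[gprod n a]_t \int[gammaP b]_u F (t, u)).
  apply: (eq_integral_null mpos pos0) => //.
  - by move=> t; exact: integral_ge0.
  - exact: measurable_fun_fubini_tonelli_F.
  - move=> t /negP; rewrite -ltNge => S0.
    rewrite /F/= ge0_integralZr//; last exact: mq.
    by rewrite q1// mul1e.
transitivity (\int[gammaP b]_u \int[gprod n a]_t F (t, u)).
  exact: fubini_tonelli.
pose c (s : R) : R := (s `^ (- b) * expR (s - s^-1))%R.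
have c0 s : 0 <= (c s)%:E by rewrite lee_fin mulr_ge0 ?powR_ge0 ?expR_ge0.
have mc : measurable_fun setT (fun t : n.-tuple R => (c (tsum t))%:E).
  apply/measurable_EFinP; apply: measurable_funM.
    exact: (measurableT_comp (measurable_powR _) mS).
  apply: (measurableT_comp (@measurable_expR R)).
  by apply: measurable_funB => //; exact: (measurableT_comp measurable_invr mS).
pose G (p : n.-tuple R * R) := (c (tsum p.1))%:E *
  ((expR (- ((tsum p.1 - 1) * p.2)))%:E * k (snorm n p.1, tsum p.1 * p.2)%R).
have mG : measurable_fun setT G.
  apply: emeasurable_funM; first exact: (measurableT_comp mc measurable_fst).
  apply: emeasurable_funM.
    apply/measurable_EFinP; apply: (measurableT_comp (@measurable_expR R)).
    apply: (measurableT_comp (@oppr_measurable R setT)).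
    by apply: measurable_funM => //; exact: measurable_funB.
  apply: (measurableT_comp mk); apply: measurable_fun_pair => //.
  exact: measurable_funM.
have G0 p : 0 <= G p by rewrite !mule_ge0.
(* For fixed u > 0 the vector is rescaled by u, which sends its total S to S u. As -(u - 1) S + u =
   S - (S - 1) u, the exponential splits into a function of S and the very factor that a rescaling
   of u by S produces. *)
transitivity (\int[gammaP b]_u \int[gprod n a]_t G (t, u)).
  apply: (eq_integral_null measurable_le0 (gammaP_le0 b0)).
  - by move=> u; exact: integral_ge0.
  - exact: measurable_fun_fubini_tonelli_G.
  - by move=> u; exact: integral_ge0.
  - exact: measurable_fun_fubini_tonelli_G.
  - move=> u /negP; rewrite -ltNge => u0.
    have mFu : measurable_fun setT (fun t => F (t, u)).
      exact: (measurableT_comp mF (measurable_pair2 u)).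
    have mGu : measurable_fun setT (fun t => G (t, u)).
      exact: (measurableT_comp mG (measurable_pair2 u)).
    have mFs : measurable_fun setT (fun t =>
        (expR (- ((u - 1) * tsum t)))%:E * F (tscale u t, u)).
      apply: emeasurable_funM.
        apply/measurable_EFinP; apply: (measurableT_comp (@measurable_expR R)).
        apply: (measurableT_comp (@oppr_measurable R setT)).
        exact: measurable_funM.
      by apply: (measurableT_comp mFu); exact: measurable_tscale.
    have Fs0 t : 0 <= (expR (- ((u - 1) * tsum t)))%:E * F (tscale u t, u).
      by rewrite mule_ge0.
    rewrite (gprod_scale (n := n) a0 u0 (fun t => F0 (t, u)) mFu) -/b.
    rewrite -ge0_integralZl//; last by rewrite lee_fin powR_ge0.
    apply: (eq_integral_null mpos pos0) => //.
    + by move=> t; rewrite mule_ge0// lee_fin powR_ge0.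
    + exact: measurable_funeM.
    + move=> t /negP; rewrite -ltNge => S0.
      rewrite /F /G/= tsum_scale snorm_scale ?gt_eqF// (mulrC u).
      rewrite !muleA; congr (_ * _); rewrite -!EFinM; congr EFin.
      rewrite /q /c powRM ?ltW//.
      rewrite -[LHS]mulrA [X in (_ * X)%R = _]mulrA.
      have -> : (u / (tsum t * u) = (tsum t)^-1)%R by field; rewrite !gt_eqF.
      rewrite (_ : expR (- ((u - 1) * tsum t)) * _ * expR _ = tsum t `^ (- b) * u `^ (- b) *
        (expR (- ((u - 1) * tsum t)) * expR (u - (tsum t)^-1)))%R; last by ring.
      rewrite -expRD -[RHS]mulrA -expRD mulrA; congr (_ * expR _)%R; last by ring.
      rewrite mulrC -mulrA -powRD; last by apply/implyP => _; rewrite gt_eqF.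
      by rewrite addNr powRr0 mulr1.
transitivity (\int[gprod n a]_t \int[gammaP b]_u G (t, u)).
  exact/esym/fubini_tonelli.
apply: (eq_integral_null mpos pos0) => //.
- by move=> t; exact: integral_ge0.
- exact: measurable_fun_fubini_tonelli_F.
- by move=> t; rewrite mule_ge0//; exact: H0.
- apply: emeasurable_funM; first by apply/measurable_EFinP; exact: (measurableT_comp mw mS).
  exact: (measurableT_comp (mH _ k0 mk) mN).
- move=> t /negP; rewrite -ltNge => S0.
  have mkt : measurable_fun setT (fun u => k (snorm n t, u)).
    exact: (measurableT_comp mk (measurable_pair1 _)).
  (* Now t is fixed and u is rescaled by the total S, so that S u on one side matches u on the
     other. *)
  rewrite /H (gammaP_scale (ltW b0) S0 (fun u => k0 (snorm n t, u)) mkt).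
  rewrite /G/= ge0_integralZl//; last 2 first.
  + apply: emeasurable_funM; last first.
      by apply: (measurableT_comp mkt); exact: measurable_funM.
    apply/measurable_EFinP; apply: (measurableT_comp (@measurable_expR R)).
    apply: (measurableT_comp (@oppr_measurable R setT)).
    exact: measurable_funM.
  + by move=> u _; rewrite mule_ge0.
  rewrite muleA; congr (_ * _); rewrite -EFinM; congr EFin.
  have SbS : (tsum t `^ (- b) * tsum t `^ b = 1)%R.
    rewrite -powRD; last by apply/implyP => _; rewrite gt_eqF.
    by rewrite addNr powRr0.
  by rewrite /c /w -[LHS]mul1r -SbS; ring.
Qed.

End lukacs.

Section dirichlet_identities.
Context {R : realType}.
Local Open Scope ereal_scope.

(** [gprod_lukacs] for two variables and a function of the total alone: the outer integral on its
    right-hand side is then that of a constant. No convolution is computed. *)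
Lemma gammaP_add (a b : R) (g : R -> \bar R) : (0 <= a)%R -> (0 <= b)%R ->
  (0 < a + b)%R -> (forall x, 0 <= g x) -> measurable_fun setT g ->
  \int[gammaP a]_y \int[gammaP b]_z g (y + z)%R = \int[gammaP (a + b)]_x g x.
Proof.
move=> a0 b0 ab0 g0 mg.
pose ab i : R := if i is 0%N then a else b.
have ab_ge0 i : (0 <= ab i)%R by case: i.
have sab : (\sum_(i < 2) ab i = a + b)%R by rewrite !big_ord_recl big_ord0 addr0.
have := @gprod_lukacs R 2 ab (g \o snd) ab_ge0.
rewrite sab => /(_ ab0 (fun x => g0 x.2) (measurableT_comp mg measurable_snd)).
move=> luk; apply: esym; apply: etrans.
  exact: esym (integral_cst_probability (gprod 2 ab) (\int[gammaP (a + b)]_x g x)).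
apply: etrans (esym luk) _.
have mgS : measurable_fun setT (fun t : 2.-tuple R => g (tsum t)).
  exact: (measurableT_comp mg (@measurable_tsum R 2)).
apply: etrans (@integral_gprodS R 1 ab (fun t => g (tsum t)) (fun=> g0 _) mgS) _.
apply: eq_integral => y _.
have mgS1 : measurable_fun setT (fun t : 1.-tuple R => g (tsum (tcons (y, t)))).
  by apply: (measurableT_comp mgS); exact: measurable_tcons2.
apply: etrans (@integral_gprodS R 0 (ab \o S) (fun t => g (tsum (tcons (y, t))))
  (fun=> g0 _) mgS1) _.
apply: eq_integral => z _.
by rewrite integral_gprod0 !tsum_cons/= /tsum big_nil addr0.
Qed.

Definition incr_at (a : nat -> R) (j : nat) (i : nat) : R :=
  (a i + (i == j)%:R)%R.

Lemma incr_at_ge0 a j : (forall i, 0 <= a i)%R -> (forall i, 0 <= incr_at a j i)%R.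
Proof. by move=> a0 i; rewrite addr_ge0. Qed.

Lemma sum_incr_at n a j : (j < n)%N ->
  (\sum_(i < n) incr_at a j i = \sum_(i < n) a i + 1)%R.
Proof.
move=> jn; rewrite big_split/=; congr (_ + _)%R.
rewrite (bigD1 (Ordinal jn))//= eqxx big1 ?addr0// => i /negPf ij.
by rewrite -[(i == j :> nat)]/(i == Ordinal jn) ij.
Qed.

Definition add_at n (j : nat) (e : R) (t : n.-tuple R) : n.-tuple R :=
  [tuple (tnth t i + (i == j :> nat)%:R * e)%R | i < n].

Lemma measurable_add_at n j : measurable_fun setT
  (fun p : n.-tuple R * R => add_at j p.2 p.1).
Proof.
apply/measurable_fun_tnthP => i.
rewrite (_ : _ \o _ = fun p => (tnth p.1 i + (i == j :> nat)%:R * p.2)%R); last first.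
  by apply/funext => p /=; rewrite tnth_mktuple.
apply: measurable_funD; first exact: (measurableT_comp (measurable_tnth i) measurable_fst).
exact: measurable_funM.
Qed.

Lemma add_at_cons0 n e (y : R) (t : n.-tuple R) :
  add_at 0 e (tcons (y, t)) = tcons ((y + e)%R, t).
Proof.
apply: eq_from_tnth => i; rewrite tnth_mktuple.
have [->|[k ->]] : i = ord0 \/ exists k, i = lift ord0 k.
  by case: (unliftP ord0 i) => [k ->|->]; [right; exists k|left].
  by rewrite /tcons !tnth0 eqxx mul1r.
by rewrite /tcons !tnthS/= mul0r addr0.
Qed.

Lemma add_at_consS n j e (y : R) (t : n.-tuple R) :
  add_at j.+1 e (tcons (y, t)) = tcons (y, add_at j e t).
Proof.
apply: eq_from_tnth => i; rewrite tnth_mktuple.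
have [->|[k ->]] : i = ord0 \/ exists k, i = lift ord0 k.
  by case: (unliftP ord0 i) => [k ->|->]; [right; exists k|left].
  by rewrite /tcons !tnth0/= mul0r addr0.
by rewrite /tcons !tnthS/= tnth_mktuple.
Qed.

Lemma tsum_add_at n j e (t : n.-tuple R) : (j < n)%N ->
  tsum (add_at j e t) = (tsum t + e)%R.
Proof.
elim: n j t => // n IH j t.
rewrite (tuple_eta t) -[[tuple of _]]/(tcons (thead t, [tuple of behead t])).
case: j => [|j] jn.
  by rewrite add_at_cons0 !tsum_cons/= addrAC.
by rewrite add_at_consS !tsum_cons/= IH// addrA.
Qed.

Lemma gprod_incr0 n a : gprod n (incr_at a 0 \o S) = gprod n (a \o S).
Proof.
by congr gprod; apply/funext => i /=; rewrite /incr_at/= addr0.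
Qed.

(** Only coordinate j is affected, and there Gamma(a_j) and an independent Gamma(1) add up by
    [gammaP_add]. *)
Lemma gprod_add n a j (F : n.-tuple R -> \bar R) :
  (forall i, 0 <= a i)%R -> (j < n)%N ->
  (forall t, 0 <= F t) -> measurable_fun setT F ->
  \int[gprod n a]_t \int[gammaP 1]_e F (add_at j e t) =
  \int[gprod n (incr_at a j)]_t F t.
Proof.
elim: n a j F => [a j F _ jn|n IH a j F a0 jn F0 mF].
  by exfalso; move: jn; rewrite ltn0.
pose K (p : n.+1.-tuple R * R) := F (add_at j p.2 p.1).
have mK : measurable_fun setT K.
  exact: (measurableT_comp mF (measurable_add_at j)).
rewrite [LHS]integral_gprodS; last 2 first.
- by move=> t; exact: integral_ge0.
- by apply: (@measurable_fun_fubini_tonelli_F _ _ _ _ _ _ K) => // p; exact: F0.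
rewrite [RHS](integral_gprodS (incr_at a j) F0 mF).
case: j => [|j] in jn K mK *.
  pose phi z := \int[gprod n (a \o S)]_t F (tcons (z, t)).
  have mphi : measurable_fun setT phi.
    apply: (@measurable_integral_gprod _ _ _ _ _ (fun p => F (tcons p))) => //.
    exact: (measurableT_comp mF (@measurable_tcons R n)).
  have phi0 z : 0 <= phi z by exact: integral_ge0.
  transitivity (\int[gammaP (a 0%N)]_y \int[gammaP 1]_e phi (y + e)%R).
    apply: eq_integral => y _.
    under eq_integral do under eq_integral do rewrite add_at_cons0.
    rewrite /phi.
    apply: (@fubini_tonelli _ _ _ _ _ (gprod n (a \o S)) (gammaP 1)
      (fun p => F (tcons ((y + p.2)%R, p.1)))) => //.
    apply: (measurableT_comp mF); apply: measurable_tcons2 => //.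
    exact: measurable_funD.
  apply: etrans (gammaP_add (a0 0%N) ler01 (ltr_wpDl (a0 0%N) ltr01) phi0 mphi) _.
  rewrite {1}/incr_at eqxx.
  by apply: eq_integral => y _; rewrite /phi gprod_incr0.
rewrite {1}/incr_at/= addr0.
apply: eq_integral => y _.
under eq_integral do under eq_integral do rewrite add_at_consS.
rewrite -(IH (a \o S) j (fun t => F (tcons (y, t)))) => //.
- by move=> i; exact: a0.
- by apply: (measurableT_comp mF); exact: measurable_tcons2.
Qed.

Lemma gprod_shift n a j (jn : (j < n)%N) (F : n.-tuple R -> \bar R) :
  (forall i, 0 <= a i)%R ->
  (forall t, 0 <= F t) -> measurable_fun setT F ->
  \int[gprod n a]_t ((Num.max (tnth t (Ordinal jn)) 0%R)%:E * F t) =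
  (gamma_ratio (a j))%:E * \int[gprod n (incr_at a j)]_t F t.
Proof.
elim: n a j jn F => [a j jn|n IH a j jn F a0 F0 mF].
  by exfalso; move: jn; rewrite ltn0.
have mmax m (i : 'I_m) : measurable_fun setT
    (fun t : m.-tuple R => (Num.max (tnth t i) 0%R)%:E).
  apply/measurable_EFinP; apply: measurable_maxr => //.
  exact: measurable_tnth.
have max0 (x : R) : 0 <= (Num.max x 0%R)%:E by rewrite lee_fin le_max lexx orbT.
have mFc y : measurable_fun setT (fun t => F (tcons (y, t))).
  by apply: (measurableT_comp mF); exact: measurable_tcons2.
pose phi z := \int[gprod n (a \o S)]_t F (tcons (z, t)).
rewrite [LHS]integral_gprodS; last 2 first.
- by move=> t; exact: mule_ge0.
- by apply: emeasurable_funM => //; exact: mmax.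
rewrite (integral_gprodS (incr_at a j) F0 mF).
case: j => [|j] in jn *.
  have mphi : measurable_fun setT phi.
    apply: (@measurable_integral_gprod _ _ _ _ _ (fun p => F (tcons p))) => //.
    exact: (measurableT_comp mF (@measurable_tcons R n)).
  have phi0 z : 0 <= phi z by exact: integral_ge0.
  transitivity (\int[gammaP (a 0%N)]_y ((Num.max y 0%R)%:E * phi y)).
    apply: eq_integral => y _.
    rewrite (_ : Ordinal jn = ord0); last exact/val_inj.
    under eq_integral do rewrite /tcons tnth0/=.
    apply: (@ge0_integralZl _ _ _ (gprod n (a \o S)) _ measurableT
      (fun t => F (tcons (y, t)))) => //.
  apply: etrans (gammaP_shift (a0 0%N) phi0 mphi) _; congr (_ * _).
  rewrite {1}/incr_at eqxx.
  by apply: eq_integral => y _; rewrite /phi gprod_incr0.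
have jn' : (j < n)%N by [].
pose psi z := \int[gprod n (incr_at a j.+1 \o S)]_t F (tcons (z, t)).
have mpsi : measurable_fun setT psi.
  apply: (@measurable_integral_gprod _ _ _ _ _ (fun p => F (tcons p))) => //.
  exact: (measurableT_comp mF (@measurable_tcons R n)).
have psi0 z : 0 <= psi z by exact: integral_ge0.
have r0 : 0 <= (gamma_ratio (a j.+1))%:E.
  rewrite lee_fin /gamma_ratio; case: ifPn => // aj.
  by rewrite ltW// divr_gt0// Gamma_gt0// addr_gt0.
apply: etrans _ (@ge0_integralZl _ _ _ (gammaP (incr_at a j.+1 0)) _ measurableT
  psi mpsi _ (fun x _ => psi0 x) r0).
rewrite (_ : incr_at a j.+1 0 = a 0%N); last by rewrite /incr_at addr0.
apply: eq_integral => y _.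
apply: etrans _ (IH (a \o S) j jn' (fun t => F (tcons (y, t)))
  (fun i => a0 i.+1) (fun=> F0 _) (mFc y)).
apply: eq_integral => t _.
by rewrite (_ : Ordinal jn = lift ord0 (Ordinal jn')) ?tnthS//; exact/val_inj.
Qed.

End dirichlet_identities.

Section dirichlet_laws.
Context {R : realType}.
Local Open Scope ereal_scope.

Lemma gammaP_mean (a : R) : (0 <= a)%R ->
  \int[gammaP a]_x (Num.max x 0%R)%:E = (gamma_ratio a)%:E.
Proof.
move=> a0.
transitivity (\int[gammaP a]_x ((Num.max x 0%R)%:E * cst 1 x)).
  by apply: eq_integral => x _; rewrite mule1.
apply: etrans (gammaP_shift a0 (fun=> lee01) (measurable_cst _)) _.
by rewrite -[RHS]mule1; congr (_ * _); exact: integral_cst_probability.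
Qed.

Lemma measurable_max0 : measurable_fun setT (fun x : R => (Num.max x 0%R)%:E).
Proof. by apply/measurable_EFinP; exact: measurable_maxr. Qed.

Lemma max0_ge0 (x : R) : 0 <= (Num.max x 0%R)%:E.
Proof. by rewrite lee_fin le_max lexx orbT. Qed.

(** The mean of a sum of independent gamma variables. Positive parts add only where both variables
    are nonnegative, hence the two replacements off null sets. *)
Lemma gamma_ratioD (a b : R) : (0 <= a)%R -> (0 <= b)%R -> (0 < a + b)%R ->
  gamma_ratio (a + b) = (gamma_ratio a + gamma_ratio b)%R.
Proof.
move=> a0 b0 ab0; apply: EFin_inj.
rewrite EFinD -(gammaP_mean (addr_ge0 a0 b0)) -(gammaP_mean a0) -(gammaP_mean b0).
apply: etrans (esym (gammaP_add a0 b0 ab0 max0_ge0 measurable_max0)) _.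
have mA c : measurable_fun setT (fun y : R => (Num.max (c + y) 0%R)%:E).
  by apply/measurable_EFinP; apply: measurable_maxr => //; exact: measurable_funD.
have mM (c : R) : measurable_fun setT (fun y : R => (Num.max c 0%R)%:E + (Num.max y 0%R)%:E).
  exact: (emeasurable_funD (measurable_cst _) measurable_max0).
have inner y : \int[gammaP b]_z ((Num.max y 0%R)%:E + (Num.max z 0%R)%:E) =
    (Num.max y 0%R)%:E + \int[gammaP b]_z (Num.max z 0%R)%:E.
  apply: etrans (ge0_integralD _ measurableT (fun _ _ => max0_ge0 _) (measurable_cst _)
    (fun _ _ => max0_ge0 _) measurable_max0) _.
  by congr (_ + _); exact: integral_cst_probability.
transitivity (\int[gammaP a]_y ((Num.max y 0%R)%:E + \int[gammaP b]_z (Num.max z 0%R)%:E)).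
  apply: (eq_integral_null measurable_lt0 (gammaP_lt0 a0)).
  - by move=> y; apply: integral_ge0 => z _; exact: max0_ge0.
  - apply: (@measurable_fun_fubini_tonelli_F _ _ _ _ _ (gammaP b)
      (fun p : R * R => (Num.max (p.1 + p.2) 0%R)%:E)) => [|p]; last exact: max0_ge0.
    by apply/measurable_EFinP; apply: measurable_maxr => //; exact: measurable_funD.
  - by move=> y; rewrite adde_ge0 ?max0_ge0// integral_ge0// => z _; exact: max0_ge0.
  - exact: (emeasurable_funD measurable_max0 (measurable_cst _)).
  - move=> y /negP; rewrite -leNgt => y0; rewrite -inner.
    apply: (eq_integral_null measurable_lt0 (gammaP_lt0 b0)) => //.
    + by move=> z; exact: max0_ge0.
    + by move=> z; rewrite adde_ge0 ?max0_ge0.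
    + by move=> z /negP; rewrite -leNgt => z0; rewrite -EFinD !max_l// addr_ge0.
apply: etrans (ge0_integralD _ measurableT (fun _ _ => max0_ge0 _) measurable_max0
  _ (measurable_cst _)) _.
  by move=> x _; apply: integral_ge0 => z _; exact: max0_ge0.
exact: (congr1 (fun z => \int[gammaP a]_y (Num.max y 0%R)%:E + z)
  (integral_cst_probability (gammaP a) (\int[gammaP b]_z (Num.max z 0%R)%:E))).
Qed.

End dirichlet_laws.

Section additive_functions.
Context {R : realType}.

(** Cauchy's functional equation on the half-line, where nonnegativity makes f monotone. *)
Lemma ge0_additive_linear (f : R -> R) :
  (forall x, 0 <= x -> 0 <= f x) ->
  (forall x y, 0 <= x -> 0 <= y -> f (x + y) = f x + f y) ->
  forall a b, 0 <= a -> 0 < b -> f a * b = a * f b.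
Proof.
move=> f0 fD.
have fn n x : 0 <= x -> f (n%:R * x) = n%:R * f x.
  move=> x0; elim: n => [|n IH].
    by rewrite !mul0r; have := fD 0 0 (lexx _) (lexx _); rewrite addr0; lra.
  by rewrite -natr1 mulrDl mul1r fD ?IH ?mulr_ge0//; ring.
have fle x y : 0 <= x -> x <= y -> f x <= f y.
  move=> x0 xy; rewrite -(subrK x y) fD ?subr_ge0//.
  by have := f0 (y - x); rewrite subr_ge0 => /(_ xy); lra.
(* With m the integer part of N a / b, monotonicity squeezes N f(a) between m f(b) and (m + 1) f(b).
   The error b f(b) does not depend on N, so a nonzero difference is refuted by a large N. *)
have bnd a b N : 0 <= a -> 0 < b ->
    N%:R * (a * f b - b * f a) <= b * f b /\ N%:R * (b * f a - a * f b) <= b * f b.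
  move=> a0 b0; pose m := Num.trunc (N%:R * a / b).
  have [|m1 m2] := andP (@truncn_itv R (N%:R * a / b) _).
    by rewrite divr_ge0 ?mulr_ge0// ltW.
  have {}m1 : m%:R * b <= N%:R * a by rewrite -ler_pdivlMr.
  have {}m2 : N%:R * a <= m.+1%:R * b by rewrite -ler_pdivrMr// ltW.
  have := fle _ _ (mulr_ge0 (ler0n _ m) (ltW b0)) m1.
  have := fle _ _ (mulr_ge0 (ler0n _ N) a0) m2.
  rewrite !fn ?(ltW b0)// => h2 h1; move: m1 m2 h1 h2.
  rewrite -natr1; have := f0 _ (ltW b0); have := f0 _ a0.
  move: (m%:R) (N%:R) (f a) (f b) => {}m {}N A B; split; nra.
move=> a b a0 b0; apply/eqP; rewrite eq_le !leNgt; apply/andP; split; apply/negP => h.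
- pose d := f a * b - a * f b; have d0 : 0 < d by rewrite subr_gt0.
  have [_] := bnd a b (Num.trunc (b * f b / d)).+1 a0 b0.
  rewrite leNgt => /negP; apply.
  rewrite (_ : b * f a - a * f b = d); last by rewrite /d; ring.
  by rewrite -ltr_pdivrMr// truncnS_gt.
- pose d := a * f b - f a * b; have d0 : 0 < d by rewrite subr_gt0.
  have [+ _] := bnd a b (Num.trunc (b * f b / d)).+1 a0 b0.
  rewrite leNgt => /negP; apply.
  rewrite (_ : a * f b - b * f a = d); last by rewrite /d; ring.
  by rewrite -ltr_pdivrMr// truncnS_gt.
Qed.

Lemma gamma_ratio_linear (a b : R) : 0 <= a -> 0 < b ->
  gamma_ratio a * b = a * gamma_ratio b.
Proof.
apply: ge0_additive_linear.
  by move=> x x0; rewrite /gamma_ratio; case: ifPn => // xp;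
    rewrite divr_ge0 ?Gamma_ge0.
move=> x y x0 y0; have [xy0|] := ltP 0 (x + y); first exact: gamma_ratioD.
move=> xy; have [-> ->] : x = 0 /\ y = 0 by split; lra.
by rewrite addr0 /gamma_ratio ltxx addr0.
Qed.

End additive_functions.

Section dirichlet_updates.
Context {R : realType}.
Local Open Scope ereal_scope.

(* The value for r <= 0 is irrelevant: r will be a ratio of gamma variables, and
   posterior_base requires a positive weight. *)
Definition pos_or1 (r : R) : R := if (0 < r)%R then r else 1%R.

Lemma pos_or1_gt0 r : (0 < pos_or1 r)%R.
Proof. by rewrite /pos_or1; case: ifP. Qed.

Lemma measurable_pos_or1 : measurable_fun setT pos_or1.
Proof.
apply: measurable_fun_ifT => //.
by apply: measurable_fun_ltr => //; exact: measurable_cst.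
Qed.

(** The effect of one update on the masses of cells, when the new observation lies in cell j; see
    [evals_mix]. *)
Definition vertex_mix n (j : nat) (r : R) (d : n.-tuple R) : n.-tuple R :=
  [tuple ((r * tnth d i + (i == j :> nat)%:R) / (r + 1))%R | i < n].

Lemma measurable_vertex_mix n j : measurable_fun setT
  (fun p : R * n.-tuple R => vertex_mix j p.1 p.2).
Proof.
apply/measurable_fun_tnthP => i.
rewrite (_ : _ \o _ = fun p =>
  ((p.1 * tnth p.2 i + (i == j :> nat)%:R) * (p.1 + 1)^-1)%R); last first.
  by apply/funext => p /=; rewrite tnth_mktuple.
apply: measurable_funM.
  apply: measurable_funD => //; apply: measurable_funM => //.
  exact: (measurableT_comp (measurable_tnth i) measurable_snd).
by apply: (measurableT_comp measurable_invr); exact: measurable_funD.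
Qed.

(** Identity (1). Lukacs' theorem is read backwards: the independent s is replaced by the actual
    total of the gamma vector, and the mixture becomes the normalization of that vector with e added
    to coordinate j. *)
Lemma dirichlet_mix n (a : nat -> R) j (f : n.-tuple R -> \bar R) :
  (forall i, 0 <= a i)%R -> (0 < \sum_(i < n) a i)%R -> (j < n)%N ->
  (forall t, 0 <= f t) -> measurable_fun setT f ->
  \int[gprod n a]_t \int[gammaP (\sum_(i < n) a i)%R]_s \int[gammaP 1]_e
    f (vertex_mix j (pos_or1 (s / e)) (snorm n t)) =
  \int[gprod n (incr_at a j)]_t f (snorm n t).
Proof.
move=> a0 b0 jn f0 mf.
pose K (p : (n.-tuple R * R) * R) := f (vertex_mix j (pos_or1 (p.1.2 / p.2)) p.1.1).
have mK : measurable_fun setT K.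
  apply: (measurableT_comp mf).
  have mr : measurable_fun setT (fun p : (n.-tuple R * R) * R => pos_or1 (p.1.2 / p.2)).
    apply: (measurableT_comp measurable_pos_or1); apply: measurable_funM.
      exact: (measurableT_comp measurable_snd measurable_fst).
    exact: (measurableT_comp measurable_invr measurable_snd).
  exact: (measurableT_comp (@measurable_vertex_mix n j) (measurable_fun_pair mr
    (measurableT_comp measurable_fst measurable_fst))).
pose h (p : n.-tuple R * R) := \int[gammaP 1]_e K (p, e).
have h0 p : 0 <= h p by apply: integral_ge0 => e _; exact: f0.
have mh : measurable_fun setT h.
  by apply: (@measurable_fun_fubini_tonelli_F _ _ _ _ _ (gammaP 1) K) => // p; exact: f0.
apply: etrans (esym (gprod_lukacs a0 b0 h0 mh)) _.
have mfs : measurable_fun setT (fun t : n.-tuple R => f (snorm n t)).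
  exact: (measurableT_comp mf (@measurable_snorm R n)).
apply: etrans _ (gprod_add a0 jn (fun t => f0 (snorm n t)) mfs).
have mI : measurable_fun setT (fun p : n.-tuple R * R => f (snorm n (add_at j p.2 p.1))).
  exact: (measurableT_comp mfs (measurable_add_at j)).
have mSt : measurable_fun setT (fun t : n.-tuple R => (snorm n t, tsum t)).
  by apply: measurable_fun_pair; [exact: measurable_snorm|exact: measurable_tsum].
apply: (eq_integral_null (measurable_tsum_preimage measurable_le0) (gprod_tsum_le0 a0 b0)).
- by move=> t; exact: h0.
- exact: (measurableT_comp mh mSt).
- by move=> t; apply: integral_ge0 => e _; exact: f0.
- by apply: (@measurable_fun_fubini_tonelli_F _ _ _ _ _ (gammaP 1) _ mI) => p; exact: f0.
move=> t /negP; rewrite -ltNge => S0.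
apply: (eq_integral_null measurable_le0 (gammaP_le0 ltr01)).
- by move=> e; exact: f0.
- exact: (measurableT_comp mK (measurable_pair1 (snorm n t, tsum t))).
- by move=> e; exact: f0.
- exact: (measurableT_comp mI (measurable_pair1 t)).
move=> e /negP; rewrite -ltNge => e0.
rewrite /K/=; congr f; apply: eq_from_tnth => i; rewrite !tnth_mktuple.
rewrite -!tnth_nth -[X in _ = (_ / X)%R]/(tsum (add_at j e t)) tsum_add_at//.
rewrite -[X in _ = (X / _)%R]/((add_at j e t)`_i)%R -tnth_nth tnth_mktuple.
rewrite /pos_or1 divr_gt0// -[(\sum_(z <- t) z)%R]/(tsum t).
by field; rewrite !gt_eqF// addr_gt0.
Qed.

(** Identity (2). Write D_j as Y_j / S: size-biasing by Y_j raises a_j, and under the new law 1 / S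
    is independent of the proportions, so it factors out as a constant. *)
Lemma dirichlet_weight n (a : nat -> R) j (jn : (j < n)%N)
    (f : n.-tuple R -> \bar R) :
  (forall i, 0 <= a i)%R -> (0 < \sum_(i < n) a i)%R ->
  (forall t, 0 <= f t) -> measurable_fun setT f ->
  \int[gprod n a]_t ((Num.max (tnth (snorm n t) (Ordinal jn)) 0%R)%:E * f (snorm n t)) =
  (a j / \sum_(i < n) a i)%:E * \int[gprod n (incr_at a j)]_t f (snorm n t).
Proof.
move=> a0; set b := (\sum_(i < n) a i)%R => b0 f0 mf.
have b10 : (0 < b + 1)%R by rewrite addr_gt0.
have sb : (\sum_(i < n) incr_at a j i = b + 1)%R by exact: sum_incr_at.
(* The mean of 1 / S after size-biasing, when S ~ Gamma(b + 1). Size-biasing Gamma(b) shows that it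
   is the inverse of [gamma_ratio b]. *)
pose J := \int[gammaP (b + 1)]_u (Num.max (u^-1) 0%R)%:E.
have mJ : measurable_fun setT (fun u : R => (Num.max (u^-1) 0%R)%:E).
  exact: (measurableT_comp measurable_max0 measurable_invr).
have rJ : (gamma_ratio b)%:E * J = 1.
  apply: etrans (esym (gammaP_shift (ltW b0) (fun u => max0_ge0 u^-1) mJ)) _.
  apply: etrans _ (integral_cst_probability (gammaP b) 1).
  apply: (eq_integral_null measurable_le0 (gammaP_le0 b0)) => //.
  - by move=> u; rewrite mule_ge0 ?max0_ge0.
  - exact: (emeasurable_funM measurable_max0 mJ).
  - move=> u /negP; rewrite -ltNge => u0.
    by rewrite -EFinM !max_l ?invr_ge0 ?(ltW u0)// divff// gt_eqF.
pose F (t : n.-tuple R) := (Num.max (tsum t)^-1 0%R)%:E * f (snorm n t).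
have F0 t : 0 <= F t by rewrite mule_ge0 ?max0_ge0.
have mfs : measurable_fun setT (fun t : n.-tuple R => f (snorm n t)).
  exact: (measurableT_comp mf (@measurable_snorm R n)).
have mtn : measurable_fun setT (fun t : n.-tuple R => (Num.max (tnth t (Ordinal jn)) 0%R)%:E).
  exact: (measurableT_comp measurable_max0 (measurable_tnth _)).
have mF : measurable_fun setT F.
  by apply: emeasurable_funM => //; exact: (measurableT_comp mJ (@measurable_tsum R n)).
transitivity (\int[gprod n a]_t ((Num.max (tnth t (Ordinal jn)) 0%R)%:E * F t)).
  apply: (eq_integral_null (measurable_tsum_preimage measurable_le0) (gprod_tsum_le0 a0 b0)).
  - by move=> t; rewrite mule_ge0 ?max0_ge0.
  - apply: emeasurable_funM => //.
    exact: (measurableT_comp mtn (@measurable_snorm R n)).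
  - by move=> t; rewrite mule_ge0 ?max0_ge0.
  - exact: (emeasurable_funM mtn mF).
  - move=> t /negP; rewrite -ltNge => S0.
    rewrite /F muleA -EFinM; congr (_%:E * _).
    rewrite tnth_mktuple -[X in (_ / X)%R]/(tsum t) -tnth_nth.
    rewrite [in RHS](max_l (x := (tsum t)^-1)%R) ?invr_ge0 ?ltW//.
    by rewrite maxr_pMl ?invr_ge0 ?ltW// mul0r.
apply: etrans (gprod_shift jn a0 F0 mF) _.
pose h (p : n.-tuple R * R) := (Num.max p.2^-1 0%R)%:E * f p.1.
have h0 p : 0 <= h p by rewrite mule_ge0 ?max0_ge0.
have mh : measurable_fun setT h.
  apply: emeasurable_funM; first exact: (measurableT_comp mJ measurable_snd).
  exact: (measurableT_comp mf measurable_fst).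
have luk := gprod_lukacs (incr_at_ge0 j a0) _ h0 mh.
rewrite sb in luk; have {}luk := luk b10.
apply: etrans (congr1 (fun z => (gamma_ratio (a j))%:E * z) luk) _.
have J0 : 0 <= J by apply: integral_ge0 => u _; exact: max0_ge0.
have hJ : \int[gprod n (incr_at a j)]_t \int[gammaP (b + 1)]_u h (snorm n t, u) =
    J * \int[gprod n (incr_at a j)]_t f (snorm n t).
  apply: etrans _ (@ge0_integralZl _ _ _ (gprod n (incr_at a j)) _ measurableT
    (fun t => f (snorm n t)) mfs _ (fun t _ => f0 _) J0).
  apply: eq_integral => t _.
  exact: (@ge0_integralZr _ _ _ (gammaP (b + 1)) _ measurableT
    _ mJ _ (fun u _ => max0_ge0 _) (f0 _)).
apply: etrans (congr1 (fun z => (gamma_ratio (a j))%:E * z) hJ) _.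
rewrite muleA; congr (_ * _).
(* J is so far only an extended real; its product with the positive mean being 1 excludes an
   infinite value. *)
move: rJ J0; case: (J) => [r| |].
- move=> [rr] _; rewrite -EFinM; congr EFin.
  have rb : gamma_ratio b != 0%R by rewrite gt_eqF// gamma_ratio_gt0.
  have bn0 : b != 0%R by rewrite gt_eqF.
  apply: (mulIf (mulf_neq0 rb bn0)).
  have := gamma_ratio_linear (a0 j) b0; move: rr rb b0.
  move: (gamma_ratio b) (gamma_ratio (a j)) => rb' ra rr rb0 b0' lin.
  transitivity ((ra * b) * (rb' * r))%R; first by ring.
  by rewrite rr lin; field.
- by rewrite gt0_muley ?lte_fin ?gamma_ratio_gt0.
- by [].
Qed.

End dirichlet_updates.

(** * Rotations and orbits *)

Section rotation_group.
Context {R : realType}.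

Lemma rotationD (s t : R) : rotation (s + t) = rotation s *m rotation t.
Proof.
apply/matrixP => i j; rewrite mxE [in RHS]mxE !big_ord_recl big_ord0 !mxE.
by case: i => [[|[|//]] ?]; case: j => [[|[|//]] ?] /=; rewrite ?cosD ?sinD; ring.
Qed.

Lemma rotation0 : rotation 0 = 1%:M :> 'M[R]_2.
Proof.
apply/matrixP => i j; rewrite !mxE.
by case: i => [[|[|//]] ?]; case: j => [[|[|//]] ?] /=; rewrite ?cos0 ?sin0 ?oppr0.
Qed.

Lemma rotation_tr (t : R) : (rotation t)^T = rotation (- t).
Proof.
apply/matrixP => i j; rewrite !mxE.
by case: i => [[|[|//]] ?]; case: j => [[|[|//]] ?] /=; rewrite ?cosN ?sinN ?opprK.
Qed.

Lemma rotationN (t : R) : rotation t *m rotation (- t) = 1%:M.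
Proof. by rewrite -rotationD subrr rotation0. Qed.

Lemma rotation_2pi : rotation (2 * pi) = 1%:M :> 'M[R]_2.
Proof.
apply/matrixP => i j; rewrite !mxE mulr_natl.
by case: i => [[|[|//]] ?]; case: j => [[|[|//]] ?] /=; rewrite ?cos2pi ?sin2pi ?oppr0.
Qed.

Variables (k : nat) (k_gt0 : (0 < k)%N).

Definition rot (j : nat) : 'M[R]_2 := rotation (theta k j).

Lemma rot0 : rot 0 = 1%:M.
Proof. by rewrite /rot /theta mulr0 mul0r rotation0. Qed.

Lemma rotD i j : rot (i + j) = rot i *m rot j.
Proof. by rewrite /rot /theta natrD mulrDr mulrDl rotationD. Qed.

Lemma rotk : rot k = 1%:M.
Proof. by rewrite /rot /theta mulfK ?rotation_2pi// pnatr_eq0 -lt0n. Qed.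

Lemma rot_mod j : rot (j %% k)%N = rot j.
Proof.
rewrite {2}(divn_eq j k) rotD; elim: (j %/ k)%N => [|n IH].
  by rewrite mul0n rot0 mul1mx.
by rewrite mulSn rotD rotk mul1mx.
Qed.

(** The representative of -j modulo k in 1, ..., k, the index range of [rotation_group]; multiples
    of k give k, not 0. *)
Definition rot_inv (j : nat) : nat := (k - j %% k)%N.

Lemma rot_inv_bounds j : (1 <= rot_inv j <= k)%N.
Proof. by rewrite subn_gt0 ltn_pmod// leq_subr. Qed.

Lemma rot_invl j : rot (rot_inv j) *m rot j = 1%:M.
Proof.
by rewrite -(rot_mod j) -rotD /rot_inv subnK ?rotk// ltnW// ltn_pmod.
Qed.

Lemma rot_invr j : rot j *m rot (rot_inv j) = 1%:M.
Proof. exact/mulmx1C/rot_invl. Qed.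

Lemma rotation_groupP A : rotation_group k A <-> exists j, A = rot j.
Proof.
split=> [[j _ <-]|[j ->]]; first by exists j.
(* Inverting twice brings the index into 1, ..., k without changing the rotation. *)
exists (rot_inv (rot_inv j)); first exact: rot_inv_bounds.
rewrite -[LHS]/(rot _) -[LHS]mulmx1 -(rot_invl j) mulmxA.
by rewrite rot_invl mul1mx.
Qed.

Lemma finite_orthogonal_rotation_group :
  finite_orthogonal_group (@rotation_group R k).
Proof.
split.
- apply: finite_image.
  by apply: (sub_finite_set _ (finite_II k.+1)) => j /andP[_].
- by move=> _ [j _ <-]; rewrite rotation_tr rotationN.
- by apply/rotation_groupP; exists 0%N; rewrite rot0.
- move=> A B /rotation_groupP[i ->] /rotation_groupP[j ->].
  by apply/rotation_groupP; exists (i + j)%N; rewrite rotD.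
- move=> A /rotation_groupP[i ->].
  have /mulmx1_unit[u1 _] := rot_invr i; split => //.
  apply/rotation_groupP; exists (rot_inv i).
  by rewrite -[LHS]mulmx1 -(rot_invr i) mulmxA mulVmx// mul1mx.
Qed.

End rotation_group.

Lemma sum_periodic (V : nmodType) (k i : nat) (F : nat -> V) :
  (forall j, F (j + k)%N = F j) ->
  \sum_(j < k) F (i + j)%N = \sum_(j < k) F j.
Proof.
case: k => [|k] Fk; first by rewrite !big_ord0.
elim: i => // i <-; rewrite big_ord_recr [RHS]big_ord_recl/= addrC addn0.
congr (_ + _); first by rewrite addSnnS Fk.
by apply: eq_bigr => j _; rewrite /bump/= addSnnS.
Qed.

Section rotation_action.
Context {R : realType}.
Variables (k : nat) (k_gt0 : (0 < k)%N).

Definition turn (j : nat) (x : plane R) : plane R := (rot k j *m x : 'cV[R]_2).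

Lemma turnD i j x : turn (i + j) x = turn i (turn j x).
Proof. by rewrite /turn rotD mulmxA. Qed.

Lemma turn_period j x : turn (j + k) x = turn j x.
Proof. by rewrite turnD /turn rotk// mul1mx. Qed.

Lemma turn_invl j x : turn (rot_inv k j) (turn j x) = x.
Proof. by rewrite /turn mulmxA rot_invl// mul1mx. Qed.

Lemma turn_invr j x : turn j (turn (rot_inv k j) x) = x.
Proof. by rewrite /turn mulmxA rot_invr// mul1mx. Qed.

Lemma measurable_turn j : measurable_fun setT (turn j).
Proof.
pose c i (x : plane R) : R := (x : 'cV[R]_2) i ord0.
have mc i : measurable_fun setT (c i).
  apply: measurable_continuous_real; exact: coord_continuous.
apply: (@measurability _ _ (plane R) (plane R) _ _ (range rat_box)).
  exact: borel_plane_boxes.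
move=> _ [_ [p _ <-] <-]; rewrite setTI.
rewrite (_ : _ @^-1` _ = \bigcap_i ((fun x => \sum_l rot k j i l * c l x) @^-1`
    `](ratr (p i).1), (ratr (p i).2)[%classic)); last first.
  apply/seteqP; split => x /= h i.
    by move=> _; have := h i; rewrite !mxE /= in_itv.
  by have := h i I; rewrite !mxE /= in_itv.
apply: fin_bigcap_measurable => // i _.
rewrite -[X in measurable X]setTI; apply: measurable_sum => // l.
exact: measurable_funM.
Qed.

Lemma matrix_actionP (f : 'cV[R]_2 -> 'cV[R]_2) :
  matrix_action (rotation_group k) f <-> exists j, f = turn j.
Proof.
split=> [[A /(rotation_groupP k_gt0)[j ->] <-]|[j ->]]; first by exists j.
by exists (rot k j) => //; apply/(rotation_groupP k_gt0); exists j.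
Qed.

Lemma turn_image j (A : set (plane R)) : turn j @` A = turn (rot_inv k j) @^-1` A.
Proof.
apply/seteqP; split => [_ [x Ax <-]|x Ax] /=; first by rewrite turn_invl.
by exists (turn (rot_inv k j) x) => //; rewrite turn_invr.
Qed.

Lemma turn_preimage j (A : set (plane R)) : turn j @^-1` A = turn (rot_inv k j) @` A.
Proof.
apply/seteqP; split => [x Ax|_ [x Ax <-]] /=; last by rewrite turn_invr.
by exists (turn j x) => //; rewrite turn_invl.
Qed.

(** Images under a rotation are preimages under its inverse, and preimages are the form in which
    measurability and image measures are available. *)
Lemma invariant_measureP (nu : set (plane R) -> \bar R) :
  invariant_measure (matrix_action (rotation_group k)) nu <->
  forall j A, measurable A -> nu (turn j @^-1` A) = nu A.
Proof.
split=> inv.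
  move=> j A mA; rewrite turn_preimage.
  by apply: inv => //; apply/matrix_actionP; exists (rot_inv k j).
by move=> _ A /matrix_actionP[j ->] mA; rewrite turn_image; exact: inv.
Qed.

Lemma invariant_setP (A : set (plane R)) :
  (forall f, matrix_action (rotation_group k) f -> f @` A = A) <->
  forall j x, A (turn j x) <-> A x.
Proof.
split=> inv.
  move=> j x; rewrite -[A (turn j x)]/((turn j @^-1` A) x) turn_preimage inv//.
  by apply/matrix_actionP; exists (rot_inv k j).
move=> _ /matrix_actionP[j ->]; rewrite turn_image.
by apply/seteqP; split => x /= /(inv (rot_inv k j)).
Qed.

End rotation_action.

Section mixtures.
Local Open Scope ereal_scope.
Context d1 d2 (Y : measurableType d1) (Z : measurableType d2) (R : realType).
Variable k : Y -> probability Z R.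
Hypothesis mk : forall C, measurable C -> measurable_fun setT (k ^~ C).
Variables (mu : {measure set Y -> \bar R}) (f : Y -> R).
Hypothesis f0 : forall y, (0 <= f y)%R.
Hypothesis mf : measurable_fun setT f.

Let mixture (C : set Z) := \int[mu]_y ((f y)%:E * k y C).

Let mixture0 : mixture set0 = 0.
Proof. by rewrite /mixture integral0_eq// => y _; rewrite measure0 mule0. Qed.

Let mixture_ge0 C : 0 <= mixture C.
Proof. by apply: integral_ge0 => y _; rewrite mule_ge0// lee_fin. Qed.

Let mixture_sigma_additive : semi_sigma_additive mixture.
Proof.
move=> F mF tF mUF.
rewrite [X in _ --> X](_ : _ = \sum_(0 <= i <oo) mixture (F i)).
  by apply: is_cvg_nneseries => n _ _; exact: mixture_ge0.
rewrite /mixture -integral_nneseries//; last 2 first.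
- by move=> n; apply: emeasurable_funM; [exact/measurable_EFinP|exact: mk].
- by move=> n y _; rewrite mule_ge0// lee_fin.
apply: eq_integral => y _; rewrite nneseriesZl//; congr (_ * _).
by apply/esym/cvg_lim => //; exact: measure_semi_sigma_additive.
Qed.

HB.instance Definition _ := isMeasure.Build _ _ _ mixture
  mixture0 mixture_ge0 mixture_sigma_additive.

(** Makes the two sides of the Palm formula measures in C, so that uniqueness on cylinders applies.
    With Dirac kernels it also gives image measures with a density. *)
Lemma exists_mixture : exists nu : {measure set Z -> \bar R},
  forall C, nu C = \int[mu]_y ((f y)%:E * k y C).
Proof. by exists mixture. Qed.

End mixtures.

(** * Uniform laws on orbits *)

Section orbit_frequencies.
Context {R : realType}.
Variables (k : nat) (k_gt0 : (0 < k)%N).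
Local Notation turn := (@turn R k).
Local Notation invariant := (invariant_measure (matrix_action (rotation_group k))).

(** The mass o_x(U), the points of the orbit being counted with multiplicity. Summing over 0, ..., k
    - 1 instead of 1, ..., k makes no difference by periodicity. *)
Definition orbit_freq (x : plane R) (U : set (plane R)) : R :=
  k%:R^-1 * \sum_(j < k) \1_U (turn j x).

Lemma orbit_freq_ge0 x U : 0 <= orbit_freq x U.
Proof. by rewrite mulr_ge0 ?invr_ge0// sumr_ge0. Qed.

Lemma orbit_freqT x : orbit_freq x setT = 1.
Proof.
rewrite /orbit_freq; under eq_bigr do rewrite indicT.
by rewrite sumr_const card_ord mulVf// pnatr_eq0 -lt0n.
Qed.

Lemma measurable_orbit_freq U : measurable U ->
  measurable_fun setT (fun x => orbit_freq x U).
Proof.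
move=> mU; apply: measurable_funM => //; apply: measurable_sum => j.
exact: (measurableT_comp (measurable_indic mU) (@measurable_turn R k j)).
Qed.

Lemma orbit_freq_turn i x U : orbit_freq (turn i x) U = orbit_freq x U.
Proof.
congr (_ * _).
rewrite -(sum_periodic i (F := fun j => \1_U (turn j x))); last first.
  by move=> j; rewrite turn_period.
by apply: eq_bigr => j _; rewrite -turnD addnC.
Qed.

Lemma orbit_freq_preimage i x U : orbit_freq x (turn i @^-1` U) = orbit_freq x U.
Proof.
rewrite -[RHS](orbit_freq_turn i); congr (_ * _); apply: eq_bigr => j _.
by rewrite -turnD addnC turnD !indicE; congr (nat_of_bool _)%:R; apply/idP/idP; rewrite !inE.
Qed.

Lemma orbit_freq_setI x U B : (forall j x, B (turn j x) <-> B x) ->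
  orbit_freq x (U `&` B) = \1_B x * orbit_freq x U.
Proof.
move=> invB; rewrite mulrCA mulr_sumr; congr (_ * _); apply: eq_bigr => j _.
rewrite indicI/= mulrC !indicE; congr (_%:R * _).
by congr nat_of_bool; apply/idP/idP; rewrite !inE => /(invB j x).
Qed.

Lemma orbit_freq_invariant x B : (forall j x, B (turn j x) <-> B x) ->
  orbit_freq x B = \1_B x.
Proof.
by move=> invB; rewrite -[in LHS](setTI B) orbit_freq_setI// orbit_freqT mulr1.
Qed.

(** Average the k equal masses of the rotated copies of A and exchange sum and integral. *)
Lemma measure_orbit_freq (mu : probability (plane R) R) A : invariant mu ->
  measurable A -> (mu A = \int[mu]_x (orbit_freq x A)%:E)%E.
Proof.
move=> /(invariant_measureP k_gt0) inv mA.
have mt j : measurable (turn j @^-1` A).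
  by rewrite -[X in measurable X]setTI; exact: measurable_turn.
transitivity ((k%:R^-1)%:E * \sum_(j < k) mu (turn j @^-1` A))%E.
  under eq_bigr do rewrite inv//.
  have -> : mu A = (fine (mu A))%:E by rewrite fineK// fin_num_measure.
  rewrite sumEFin sumr_const card_ord -EFinM -[fine _ *+ k]mulr_natl mulrA mulVf ?mul1r//.
  by rewrite pnatr_eq0 -lt0n.
transitivity ((k%:R^-1)%:E * \int[mu]_x (\sum_(j < k) (\1_(turn j @^-1` A) x)%:E))%E.
  congr (_ * _)%E; rewrite ge0_integral_sum//.
  - apply: eq_bigr => j _; rewrite integral_indic ?setIT//.
  - by move=> j; apply/measurable_EFinP; exact: measurable_indic.
rewrite -ge0_integralZl//; last 2 first.
- apply: (@emeasurable_sum _ _ R _ 'I_k _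
    (fun j x => (\1_(turn j @^-1` A) x)%:E)) => j.
  by apply/measurable_EFinP; exact: measurable_indic.
- by move=> x _; apply: sume_ge0.
by apply: eq_integral => x _; rewrite sumEFin -EFinM.
Qed.

Lemma posterior_base_orbit (alpha : {posnum R}) (H : probability (plane R) R) m
    (x : m.-tuple (plane R)) U :
  posterior_base k_gt0 alpha H x U = (((alpha%:num + m%:R)^-1)%:E *
    (alpha%:num%:E * H U + (\sum_(y <- x) orbit_freq y U)%:E))%E.
Proof.
congr (_ * (_ + _))%E.
rewrite -mulr_sumr EFinM; congr (_ * _)%E.
rewrite exchange_big/= big_tuple -sumEFin; apply: eq_bigr => i _.
rewrite big_add1 big_mkord/= -(sum_periodic 1 (F := fun j => \1_U (turn j (tnth x i)))); last first.
  by move=> j; rewrite turn_period.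
by rewrite -sumEFin; apply: eq_bigr => j _; rewrite diracE indicE.
Qed.

End orbit_frequencies.

(** * Updating a Dirichlet invariant process *)

Section posterior_updates.
Context {R : realType}.
Variables (k : nat) (k_gt0 : (0 < k)%N).
Local Notation plane := (plane R).
Local Notation S := (random_prob 'cV[R]_2 R).
Local Open Scope ereal_scope.

(** Dividing (s mu + e o_x) / (s + e) through by e leaves r = s / e as the only weight. The result
    is a posterior base for one observation, hence already known to be a probability. *)
Definition mix (mu : S) (r : R) (x : plane) : S :=
  posterior_base k_gt0 (PosNum (pos_or1_gt0 r)) (mu : probability plane R) [tuple x].

Lemma mixE mu r x U : (mix mu r x : probability plane R) U =
  ((pos_or1 r + 1)^-1)%:E *
  ((pos_or1 r)%:E * (mu : probability plane R) U + (orbit_freq k x U)%:E).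
Proof.
apply: etrans (posterior_base_orbit k_gt0 _ _ _ U) _.
by rewrite big_seq1.
Qed.

Lemma measurable_mix : measurable_fun setT
  (fun p : S * R * plane => mix p.1.1 p.1.2 p.2).
Proof.
apply: measurable_random_prob => A mA.
apply: (eq_measurable_fun (fun p : S * R * plane => ((pos_or1 p.1.2 + 1)^-1)%:E *
  ((pos_or1 p.1.2)%:E * (p.1.1 : probability plane R) A + (orbit_freq k p.2 A)%:E))).
  by move=> p _; rewrite mixE.
have mr : measurable_fun setT (fun p : S * R * plane => pos_or1 p.1.2).
  apply: (measurableT_comp measurable_pos_or1).
  exact: (measurableT_comp measurable_snd measurable_fst).
apply: emeasurable_funM.
  apply/measurable_EFinP; apply: (measurableT_comp measurable_invr).
  exact: measurable_funD.
apply: emeasurable_funD.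
  apply: emeasurable_funM; first exact/measurable_EFinP.
  exact: (measurableT_comp (measurable_evaluation mA)
    (measurableT_comp measurable_fst measurable_fst)).
apply/measurable_EFinP.
exact: (measurableT_comp (measurable_orbit_freq k mA) measurable_snd).
Qed.

Definition step_map (x : plane) (p : S * R * R) : S := mix p.1.1 (p.1.2 / p.2) x.

Lemma measurable_step_map2 : measurable_fun setT
  (fun q : plane * (S * R * R) => step_map q.1 q.2).
Proof.
have mmu : measurable_fun setT (fun q : plane * (S * R * R) => q.2.1.1).
  exact: (measurableT_comp measurable_fst (measurableT_comp measurable_fst measurable_snd)).
have mr : measurable_fun setT (fun q : plane * (S * R * R) => (q.2.1.2 / q.2.2)%R).
  apply: measurable_funM.
    exact: (measurableT_comp measurable_snd (measurableT_comp measurable_fst measurable_snd)).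
  exact: (measurableT_comp measurable_invr (measurableT_comp measurable_snd measurable_snd)).
exact: (measurableT_comp measurable_mix
  (measurable_fun_pair (measurable_fun_pair mmu mr) measurable_fst)).
Qed.

Lemma measurable_step_map x : measurable_fun setT (step_map x).
Proof. exact: (measurableT_comp measurable_step_map2 (measurable_pair1 x)). Qed.

HB.instance Definition _ x :=
  isMeasurableFun.Build _ _ _ _ (step_map x) (measurable_step_map x).

Lemma probability_integral_indic d (T : measurableType d) (P : probability T R) C :
  measurable C -> P C = \int[P]_x (\1_C x)%:E.
Proof. by move=> mC; rewrite integral_indic// setIT. Qed.

Definition with_gamma d (T : measurableType d) (Q : probability T R) (a : R) :
  probability (T * R)%type R := Q \x gammaP a.

Lemma integral_with_gamma d (T : measurableType d) (Q : probability T R) (a : R)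
    (f : T * R -> \bar R) : (forall p, 0 <= f p) -> measurable_fun setT f ->
  \int[with_gamma Q a]_p f p = \int[Q]_x \int[gammaP a]_s f (x, s).
Proof. by move=> f0 mf; exact: (@fubini_tonelli1 _ _ _ _ _ Q (gammaP a) f mf f0). Qed.

Lemma measurable_gamma_integral2 d (T : measurableType d) (a : R)
    (F : T * R * R -> \bar R) : (forall p, 0 <= F p) -> measurable_fun setT F ->
  measurable_fun setT (fun t => \int[gammaP a]_s \int[gammaP 1]_e F (t, s, e)).
Proof.
move=> F0 mF; apply: (@measurable_fun_fubini_tonelli_F _ _ _ _ _ (gammaP a)
    (fun p => \int[gammaP 1]_e F (p, e))).
- by apply: measurable_fun_fubini_tonelli_F.
- by move=> p; exact: integral_ge0.
Qed.

(** The law Q_x of the overview, as the image of the product of Q, Gamma(a) and Gamma(1). *)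
Definition step (a : R) (Q : probability S R) (x : plane) : probability S R :=
  distribution (with_gamma (with_gamma Q a) 1) (step_map x).

Lemma integral_step a Q x (f : S -> \bar R) : (forall mu, 0 <= f mu) ->
  measurable_fun setT f ->
  \int[step a Q x]_mu f mu =
  \int[Q]_mu \int[gammaP a]_s \int[gammaP 1]_e f (mix mu (s / e) x).
Proof.
move=> f0 mf.
apply: etrans (ge0_integral_distribution _ mf f0) _.
pose F (p : S * R * R) := f (step_map x p).
have mF : measurable_fun setT F by exact: (measurableT_comp mf (measurable_step_map x)).
have F0 p : 0 <= F p by exact: f0.
apply: etrans (integral_with_gamma _ _ F0 mF) _.
apply: (integral_with_gamma Q a (f := fun p => \int[gammaP 1]_e F (p, e))).
- by move=> p; exact: integral_ge0.
- exact: measurable_fun_fubini_tonelli_F.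
Qed.

(* The head of the list is the observation processed last. *)
Fixpoint post (a : R) (Q : probability S R) (s : seq plane) : probability S R :=
  if s is x :: s' then step (a + (size s')%:R) (post a Q s') x else Q.

Lemma post_cons a Q m x (t : m.-tuple plane) :
  post a Q [tuple of x :: t] = step (a + m%:R) (post a Q t) x.
Proof. by rewrite -[LHS]/(step (a + (size t)%:R) (post a Q t) x) size_tuple. Qed.

(** In the recursion of [post] the law being updated varies together with the observation. By
    [integral_step], the mass of C is an integral against [q y] of a jointly measurable function. *)
Lemma measurable_step_kernel d (Y : measurableType d) a (q : Y -> probability S R)
    (x : Y -> plane) :
  (forall C, measurable C -> measurable_fun setT (fun y => q y C)) ->
  measurable_fun setT x ->
  forall C, measurable C -> measurable_fun setT (fun y => step a (q y) (x y) C).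
Proof.
move=> mq mx C mC.
pose F (p : Y * S * R * R) : \bar R := (\1_C (mix p.1.1.2 (p.1.2 / p.2) (x p.1.1.1)))%:E.
have mF : measurable_fun setT F.
  apply/measurable_EFinP; apply: (measurableT_comp (measurable_indic mC)).
  have m1 : measurable_fun setT (fun p : Y * S * R * R => x p.1.1.1).
    apply: (measurableT_comp mx).
    exact: (measurableT_comp measurable_fst (measurableT_comp measurable_fst measurable_fst)).
  have m2 : measurable_fun setT (fun p : Y * S * R * R => ((p.1.1.2, p.1.2), p.2)).
    apply: measurable_fun_pair => //; apply: measurable_fun_pair.
      exact: (measurableT_comp measurable_snd (measurableT_comp measurable_fst measurable_fst)).
    exact: (measurableT_comp measurable_snd measurable_fst).
  exact: (measurableT_comp measurable_step_map2 (measurable_fun_pair m1 m2)).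
have F0 p : 0 <= F p by rewrite lee_fin.
pose G (p : Y * S) : \bar R := \int[gammaP a]_s \int[gammaP 1]_e F (p, s, e).
have mG : measurable_fun setT G by exact: measurable_gamma_integral2.
have G0 p : 0 <= G p by apply: integral_ge0 => s _; exact: integral_ge0.
apply: (eq_measurable_fun (fun y => \int[q y]_mu G (y, mu))).
  move=> y _; apply/esym.
  apply: etrans (probability_integral_indic (step a (q y) (x y)) mC) _.
  by apply: integral_step => //; exact/measurable_EFinP/measurable_indic.
exact: (measurable_fun_integral_probability mq G0 mG).
Qed.

Lemma measurable_post a Q m C : measurable C ->
  measurable_fun setT (fun t : m.-tuple plane => post a Q t C).
Proof.
elim: m C => [|m IH] C mC.
  apply: (eq_measurable_fun (cst (Q C))); last exact: measurable_cst.
  by move=> t _; rewrite (tuple0 t).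
apply: (eq_measurable_fun (fun t : m.+1.-tuple plane =>
  step (a + m%:R) (post a Q [tuple of behead t]) (thead t) C)).
  by move=> t _; rewrite [in RHS](tuple_eta t)/= size_tuple.
apply: (@measurable_step_kernel _ _ _
  (fun t : m.+1.-tuple plane => post a Q [tuple of behead t])) => //.
- move=> {}C {}mC; exact: (measurableT_comp (IH C mC) (@measurable_behead _ _ _)).
- exact: measurable_tnth.
Qed.

End posterior_updates.

(** * Dirichlet invariant laws *)

Section dip_updates.
Context {R : realType}.
Variables (k : nat) (k_gt0 : (0 < k)%N).
Local Notation plane := (plane R).
Local Notation S := (random_prob 'cV[R]_2 R).
Local Notation G := (matrix_action (@rotation_group R k)).
Local Open Scope ereal_scope.

Definition invariant_laws : set S :=
  [set mu | invariant_measure G (mu : probability plane R)].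

(** Rational boxes are a countable pi-system generating the Borel sets, so invariance amounts to
    countably many equations between evaluations. *)
Lemma measurable_invariant_laws : measurable invariant_laws.
Proof.
have mt j p : measurable (turn k j @^-1` (@rat_box R p)).
  by rewrite -[X in measurable X]setTI; apply: measurable_turn => //; exact: measurable_box.
pose E j p := [set mu : S | (mu : probability plane R) (turn k j @^-1` (@rat_box R p)) =
  (mu : probability plane R) (@rat_box R p)].
have -> : invariant_laws = \bigcap_j \bigcap_p E j p.
  apply/seteqP; split => [mu /(invariant_measureP k_gt0) inv j _ p _|mu h].
    by apply: inv; exact: measurable_box.
  apply/(invariant_measureP k_gt0) => j A mA.
  have [nu [nuE _]] := exists_pushforward (mu : probability plane R) (@measurable_turn R k j).
  rewrite -nuE.
  apply: (finite_measure_eq borel_plane_boxes setI_closed_rat_box _ _ _ mA).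
  - by rewrite nuE preimage_setT.
  - rewrite nuE preimage_setT.
    exact: (le_lt_trans (probability_le1 _ measurableT) (ltry _)).
  - by move=> _ [p _ <-]; rewrite nuE; exact: h.
apply: bigcapT_measurable => j; rewrite -[X in measurable X]setCK setC_bigcap.
apply/measurableC/countable_bigcupT_measurable => // p; apply: measurableC.
rewrite -[X in measurable X]setTI; apply: measurable_eqe => //.
  exact: measurable_evaluation.
by apply: measurable_evaluation; exact: measurable_box.
Qed.

Definition evals n (B : 'I_n -> set plane) (mu : S) : n.-tuple R :=
  [tuple fine ((mu : probability plane R) (B i)) | i < n].

Lemma measurable_evals n (B : 'I_n -> set plane) : (forall i, measurable (B i)) ->
  measurable_fun setT (evals B).
Proof.
move=> mB; apply/measurable_fun_tnthP => i.
rewrite (_ : _ \o _ = fun mu : S => fine ((mu : probability plane R) (B i))).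
  by apply: measurableT_comp => //; exact: measurable_evaluation.
by apply/funext => mu /=; rewrite tnth_mktuple.
Qed.

(** The sequence that [gprod] expects; its value 0 beyond n keeps every parameter nonnegative. *)
Definition params (b : set plane -> R) n (B : 'I_n -> set plane) : nat -> R :=
  nth 0%R [tuple b (B i) | i < n].

Lemma params_nth b n (B : 'I_n -> set plane) (i : 'I_n) : params b B i = b (B i).
Proof. by rewrite /params -tnth_nth tnth_mktuple. Qed.

(* is_DIP for the unnormalized parameter measure b = alpha H, with the Dirichlet
   laws tested against functions instead of sets. *)
Definition dip_law (b : set plane -> R) (Q : probability S R) :=
  Q (~` invariant_laws) = 0 /\
  forall n (B : 'I_n -> set plane), invariant_partition G B ->
  forall f : n.-tuple R -> \bar R, (forall t, 0 <= f t) -> measurable_fun setT f ->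
    \int[Q]_mu f (evals B mu) = \int[gprod n (params b B)]_t f (snorm n t).

Lemma dirichletE n (a : n.-tuple R) C : measurable C ->
  dirichlet a C = \int[gprod n (nth 0%R a)]_t (\1_C (snorm n t))%:E.
Proof.
move=> mC.
apply: (gamma_expectationE (F := fun y => (\1_C (snorm n y))%:E)).
- exact: size_tuple.
- by move=> y; rewrite lee_fin.
- apply/measurable_EFinP; apply: (measurableT_comp (measurable_indic mC)).
  exact: measurable_snorm.
Qed.

(** Dirichlet probabilities agreeing on all sets means that two image measures are equal, and so are
    their integrals. *)
Lemma is_DIP_dip_law (alpha : {posnum R}) (H : probability plane R) (Q : probability S R) b :
  (forall U, measurable U -> b U = alpha%:num * fine (H U))%R ->
  is_DIP G alpha H Q -> dip_law b Q.
Proof.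
move=> bE [invH [N [mN N0 invN]] D]; split.
  by apply: (subset_measure0 _ mN _ N0) => //; exact: (measurableC measurable_invariant_laws).
move=> n B pB f f0 mf.
have [mB _ _ _] := pB.
have [nu [nuE nuI]] := exists_pushforward Q (measurable_evals mB).
have [nu' [nuE' nuI']] := exists_pushforward (gprod n (params b B)) (@measurable_snorm R n).
rewrite -nuI// -nuI'//; apply: eq_measure_integral => C mC _.
rewrite nuE nuE'.
apply: etrans (D n B pB C mC) _.
rewrite dirichletE//.
have -> : [tuple (alpha%:num * fine (H (B i)))%R | i < n] = [tuple b (B i) | i < n].
  by apply: eq_from_tnth => i; rewrite !tnth_mktuple bE.
have mSC : measurable ((fun t : n.-tuple R => snorm n t) @^-1` C).
  by rewrite -[X in measurable X]setTI; exact: measurable_snorm.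
exact: (esym (probability_integral_indic (gprod n (params b B)) mSC)).
Qed.

Lemma dip_law_is_DIP (alpha : {posnum R}) (H : probability plane R) (Q : probability S R) b :
  (forall U, measurable U -> b U = alpha%:num * fine (H U))%R ->
  invariant_measure G H -> dip_law b Q -> is_DIP G alpha H Q.
Proof.
move=> bE invH [inv D]; split => //.
  exists (~` invariant_laws); split => //.
  exact: (measurableC measurable_invariant_laws).
move=> n B pB C mC; have [mB _ _ _] := pB.
rewrite dirichletE//.
have -> : [tuple (alpha%:num * fine (H (B i)))%R | i < n] = [tuple b (B i) | i < n].
  by apply: eq_from_tnth => i; rewrite !tnth_mktuple bE.
rewrite -/(params b B).
rewrite -(D n B pB (fun t => (\1_C t)%:E))//; last exact/measurable_EFinP/measurable_indic.
have mEC : measurable (evals B @^-1` C).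
  by rewrite -[X in measurable X]setTI; exact: (measurable_evals mB).
exact: (probability_integral_indic Q mEC).
Qed.

Definition add_orbit (b : set plane -> R) (x : plane) : set plane -> R :=
  fun U => (b U + orbit_freq k x U)%R.

(** An orbit stays inside one invariant cell, so on a partition o_x reduces to the vertex e_j. *)
Lemma partition_block n (B : 'I_n -> set plane) (x : plane) :
  invariant_partition G B ->
  exists j : 'I_n, B j x /\ forall i, orbit_freq k x (B i) = (i == j)%:R.
Proof.
move=> [mB tB cB iB].
have [j _ Bj] : (\bigcup_i B i) x by rewrite cB.
exists j; split => // i.
rewrite (orbit_freq_invariant k_gt0); last first.
  by apply/(invariant_setP k_gt0) => g Gg; exact: iB.
rewrite indicE; have [->|ij] := eqVneq i j; first by rewrite mem_set.
rewrite memNset// => Bi.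
by move/eqP: ij; apply; apply: (tB i j I I); exists x.
Qed.

Lemma params_add_orbit b n (B : 'I_n -> set plane) x (j : 'I_n) :
  (forall i, orbit_freq k x (B i) = (i == j)%:R) ->
  params (add_orbit b x) B = incr_at (params b B) j.
Proof.
move=> fx; apply/funext => i; rewrite /incr_at.
have [ni|ni] := leqP n i.
  rewrite /params !nth_default ?size_tuple//.
  by rewrite gtn_eqF ?addr0// (leq_trans (ltn_ord j)).
by rewrite -[i]/(val (Ordinal ni)) !params_nth /add_orbit fx.
Qed.

Lemma evals_mix n (B : 'I_n -> set plane) mu r x (j : 'I_n) :
  (forall i, measurable (B i)) ->
  (forall i, orbit_freq k x (B i) = (i == j)%:R) ->
  evals B (mix k_gt0 mu r x) = vertex_mix j (pos_or1 r) (evals B mu).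
Proof.
move=> mB fx; apply: eq_from_tnth => i; rewrite !tnth_mktuple mixE fx.
rewrite -[X in _ * (_ * X + _)](@fineK _ ((mu : probability plane R) (B i))).
  by rewrite /= mulrC.
exact: fin_num_measure.
Qed.

Lemma mix_invariant mu r x : invariant_laws mu -> invariant_laws (mix k_gt0 mu r x).
Proof.
move=> /(invariant_measureP k_gt0) inv; apply/(invariant_measureP k_gt0) => j A mA.
apply: etrans (mixE _ _ _ _ _) _; apply: etrans _ (esym (mixE _ _ _ _ _)).
by rewrite inv// orbit_freq_preimage.
Qed.

(** What [step_dip_law] uses of b being a measure of total mass a; the parameter can then remain a
    bare set function. *)
Definition mass_on_partitions (b : set plane -> R) (a : R) :=
  (forall U, measurable U -> 0 <= b U)%R /\
  forall n (B : 'I_n -> set plane), invariant_partition G B ->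
    (\sum_(i < n) b (B i) = a)%R.

Lemma params_ge0 b a n (B : 'I_n -> set plane) : mass_on_partitions b a ->
  (forall i, measurable (B i)) -> forall i, (0 <= params b B i)%R.
Proof.
move=> [b0 _] mB i; have [ni|ni] := leqP n i.
  by rewrite /params nth_default ?size_tuple.
by rewrite -[i]/(val (Ordinal ni)) params_nth b0.
Qed.

Lemma sum_params b a n (B : 'I_n -> set plane) : mass_on_partitions b a ->
  invariant_partition G B -> (\sum_(i < n) params b B i = a)%R.
Proof.
by move=> [_ ba] pB; rewrite -(ba n B pB); apply: eq_bigr => i _; rewrite params_nth.
Qed.

(** Identity (1) on each invariant partition. Almost sure invariance passes to the new law because
    mixing with an orbit preserves it. *)
Lemma step_dip_law a b Q x : (0 < a)%R -> mass_on_partitions b a -> dip_law b Q ->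
  dip_law (add_orbit b x) (step k_gt0 a Q x).
Proof.
move=> a0 ba [inv D]; have mI := measurable_invariant_laws; split.
  rewrite (probability_integral_indic (step k_gt0 a Q x)); last exact: measurableC.
  pose h (mu : S) := (\1_(~` invariant_laws) mu)%:E : \bar R.
  have mh : measurable_fun setT h by exact/measurable_EFinP/measurable_indic/measurableC.
  have h0 mu : 0 <= h mu by rewrite lee_fin.
  apply: etrans (integral_step k_gt0 a Q x h0 mh) _.
  apply: etrans _ (integral_cst_probability Q 0).
  apply: (eq_integral_null (measurableC mI) inv).
  - by move=> mu; apply: integral_ge0 => s _; exact: integral_ge0.
  - apply: (measurable_gamma_integral2 a (F := fun p => h (step_map k_gt0 x p))) => //.
    exact: (measurableT_comp mh (measurable_step_map k_gt0 x)).
  - by [].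
  - exact: measurable_cst.
  - move=> mu /contrapT Imu; rewrite integral0_eq// => s _.
    rewrite integral0_eq// => e _; rewrite /h indicE memNset//= => /(_ (mix_invariant _ _ Imu)).
    by [].
move=> n B pB f f0 mf; have [mB _ _ _] := pB.
have [j [_ fx]] := partition_block x pB.
have mfe : measurable_fun setT (fun mu : S => f (evals B mu)).
  exact: (measurableT_comp mf (measurable_evals mB)).
apply: etrans (integral_step k_gt0 a Q x (fun mu => f0 (evals B mu)) mfe) _.
rewrite (params_add_orbit b fx).
have p0 := params_ge0 ba mB.
have sa := sum_params ba pB.
have := @dirichlet_mix R n (params b B) j f p0.
rewrite sa => /(_ a0 (ltn_ord j) f0 mf) <-.
pose h (t : n.-tuple R) := \int[gammaP a]_s \int[gammaP 1]_e f (vertex_mix j (pos_or1 (s / e)) t).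
have h0 t : 0 <= h t by apply: integral_ge0 => s _; exact: integral_ge0.
have mh : measurable_fun setT h.
  apply: (measurable_gamma_integral2 a (F := fun p : n.-tuple R * R * R =>
    f (vertex_mix j (pos_or1 (p.1.2 / p.2)) p.1.1))) => //.
  have mr : measurable_fun setT (fun p : n.-tuple R * R * R => pos_or1 (p.1.2 / p.2)).
    apply: (measurableT_comp measurable_pos_or1); apply: measurable_funM.
      exact: (measurableT_comp measurable_snd measurable_fst).
    exact: (measurableT_comp measurable_invr measurable_snd).
  apply: (measurableT_comp mf).
  exact: (measurableT_comp (@measurable_vertex_mix R n j) (measurable_fun_pair mr
    (measurableT_comp measurable_fst measurable_fst))).
apply: etrans _ (D n B pB h h0 mh).
apply: eq_integral => mu _; apply: eq_integral => s _; apply: eq_integral => e _.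
by rewrite (evals_mix _ _ mB fx).
Qed.

End dip_updates.

(** * Palm formula *)

Section mecke.
Context {R : realType}.
Variables (k : nat) (k_gt0 : (0 < k)%N).
Local Notation plane := (plane R).
Local Notation S := (random_prob 'cV[R]_2 R).
Local Notation G := (matrix_action (@rotation_group R k)).
Local Open Scope ereal_scope.

(* The number of points of the orbit of x in A l is an invariant function of x
   with values in {0, ..., k}; the cells are its joint level sets. *)
Lemma exists_cells n (A : nat -> set plane) : (forall l, measurable (A l)) ->
  exists N (B : 'I_N -> set plane) (w : nat -> 'I_N -> R),
    [/\ invariant_partition G B, forall l i, (0 <= w l i)%R &
      forall l i x, (l < n)%N -> B i x -> orbit_freq k x (A l) = w l i].
Proof.
move=> mA; pose F := {ffun 'I_n -> 'I_k.+1}.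
pose B (i : 'I_#|F|) : set plane :=
  [set x | forall l : 'I_n, orbit_freq k x (A l) = (k%:R^-1 * (enum_val i l)%:R)%R].
pose w l (i : 'I_#|F|) : R := if insub l is Some l' then
  (k%:R^-1 * (enum_val i l')%:R)%R else 0%R.
exists #|F|, B, w; split; last 2 first.
- by move=> l i; rewrite /w; case: insub => // l'; rewrite mulr_ge0 ?invr_ge0.
- by move=> l i x ln Bx; rewrite /w insubT; exact: (Bx (Ordinal ln)).
split.
- move=> i.
  rewrite (_ : B i = \bigcap_(l : 'I_n) [set x | orbit_freq k x (A l) =
    (k%:R^-1 * (enum_val i l)%:R)%R]); last first.
    by apply/seteqP; split => [x Bx l _|x Bx l]; apply: Bx.
  apply: fin_bigcap_measurable => // l _.
  rewrite -[X in measurable X]setTI.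
  exact: (measurable_orbit_freq k (mA l) measurableT (measurable_set1 _)).
- apply/trivIsetP => i j _ _ /eqP ij; apply/seteqP; split => // x [/= Bi Bj].
  apply: ij; apply: enum_val_inj; apply/ffunP => l; apply: val_inj => /=.
  have := etrans (esym (Bi l)) (Bj l).
  have kn0 : (k%:R^-1 != 0 :> R)%R by rewrite invr_eq0 pnatr_eq0 -lt0n.
  by move/(mulfI kn0)/eqP; rewrite eqr_nat => /eqP.
- apply/seteqP; split => // x _.
  pose cnt (l : 'I_n) := (\sum_(j < k) (turn k j x \in A l))%N.
  have cntk l : (cnt l < k.+1)%N.
    rewrite ltnS -[leqRHS]card_ord -sum1_card; apply: leq_sum => j _.
    by case: (_ \in _).
  exists (enum_rank [ffun l => Ordinal (cntk l)]) => // l.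
  rewrite enum_rankK ffunE/= /orbit_freq natr_sum; congr (_ * _)%R.
- move=> i; apply/(invariant_setP k_gt0) => j x.
  by split=> Bx l; have := Bx l; rewrite orbit_freq_turn.
Qed.

Variables (N : nat) (B : 'I_N -> set plane).
Hypothesis pB : invariant_partition G B.

Let mB i : measurable (B i). Proof. by have [] := pB. Qed.

Lemma partition_sum (f : 'I_N -> R) (x : plane) (j : 'I_N) : B j x ->
  (\sum_(i < N) f i * \1_(B i) x = f j)%R.
Proof.
move=> Bj; rewrite (bigD1 j)//= indicE mem_set// mulr1 big1 ?addr0// => i ij.
rewrite indicE memNset ?mulr0// => Bi; have [_ tB _ _] := pB.
by move/eqP: ij; apply; apply: (tB i j I I); exists x.
Qed.

Lemma partition_cover x : exists j, B j x.
Proof.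
by have [_ _ cB _] := pB; have : setT x by []; rewrite -cB => -[j _]; exists j.
Qed.

Lemma integral_partition (mu : probability plane R) (f : 'I_N -> R) A :
  measurable A -> (forall i, 0 <= f i)%R ->
  \int[mu]_x (\1_A x * \sum_(i < N) f i * \1_(B i) x)%:E =
  \sum_(i < N) (f i)%:E * mu (A `&` B i).
Proof.
move=> mA f0.
have mAB i : measurable (A `&` B i) by exact: measurableI.
transitivity (\int[mu]_x \sum_(i < N) ((f i)%:E * (\1_(A `&` B i) x)%:E)).
  apply: eq_integral => x _; rewrite mulr_sumr -sumEFin; apply: eq_bigr => i _.
  by rewrite -EFinM indicI/= mulrCA.
rewrite ge0_integral_sum//; last 2 first.
- move=> i; apply: measurable_funeM; apply/measurable_EFinP; exact: measurable_indic.
- by move=> i x _; rewrite -EFinM lee_fin mulr_ge0.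
apply: eq_bigr => i _; rewrite ge0_integralZl//.
- by congr (_ * _); rewrite integral_indic// setIT.
- by apply/measurable_EFinP; exact: measurable_indic.
- by rewrite lee_fin.
Qed.

(** The orbit frequency of A is constant on a cell, so an invariant mu gives A the fraction w i of
    the mass of cell i. The masses of cells thus determine that of A. *)
Lemma measure_cells (mu : probability plane R) A (w : 'I_N -> R) :
  invariant_measure G mu -> measurable A -> (forall i, 0 <= w i)%R ->
  (forall i x, B i x -> orbit_freq k x A = w i) ->
  mu A = \sum_(i < N) (w i)%:E * mu (B i) /\
  forall i, mu (A `&` B i) = (w i)%:E * mu (B i).
Proof.
move=> inv mA w0 wE; split.
  apply: etrans (measure_orbit_freq k_gt0 inv mA) _.
  transitivity (\int[mu]_x (\1_setT x * \sum_(i < N) w i * \1_(B i) x)%:E).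
    apply: eq_integral => x _; have [j Bj] := partition_cover x.
    by rewrite (partition_sum _ Bj) indicT mul1r (wE j).
  rewrite integral_partition//.
  by apply: eq_bigr => i _; rewrite setTI.
move=> i; have mAB : measurable (A `&` B i) by exact: measurableI.
apply: etrans (measure_orbit_freq k_gt0 inv mAB) _.
have [_ _ _ iB] := pB.
transitivity (\int[mu]_x ((w i)%:E * (\1_(B i) x)%:E)).
  apply: eq_integral => x _; rewrite orbit_freq_setI; last first.
    by apply/(invariant_setP k_gt0) => g; exact: iB.
  rewrite -EFinM mulrC indicE; case: (boolP (x \in B i)) => [|_].
    by rewrite inE => /wE ->.
  by rewrite !mulr0.
rewrite ge0_integralZl//.
- by congr (_ * _); rewrite integral_indic// setIT.
- by apply/measurable_EFinP; exact: measurable_indic.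
- by rewrite lee_fin.
Qed.

End mecke.

Section mecke_identity.
Context {R : realType}.
Variables (k : nat) (k_gt0 : (0 < k)%N).
Local Notation plane := (plane R).
Local Notation S := (random_prob 'cV[R]_2 R).
Local Notation G := (matrix_action (@rotation_group R k)).
Local Open Scope ereal_scope.

Lemma dip_law_ae_set b (Q : probability S R) n (B : 'I_n -> set plane) C
    (C' : set (n.-tuple R)) :
  dip_law k b Q -> invariant_partition G B -> measurable C -> measurable C' ->
  (forall mu, invariant_laws k mu -> C mu <-> C' (evals B mu)) ->
  Q C = \int[gprod n (params b B)]_t (\1_C' (snorm n t))%:E.
Proof.
move=> [inv D] pB mC mC' CC'; have [mB _ _ _] := pB.
apply: etrans (probability_integral_indic Q mC) _.
have mf : measurable_fun setT (fun t => (\1_C' t)%:E : \bar R).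
  exact/measurable_EFinP/measurable_indic.
have f0 (t : n.-tuple R) : 0 <= (\1_C' t)%:E :> \bar R by rewrite lee_fin.
apply: etrans _ (D n B pB _ f0 mf).
apply: (eq_integral_null (measurableC (measurable_invariant_laws k_gt0)) inv).
- by move=> mu; rewrite lee_fin.
- exact/measurable_EFinP/measurable_indic.
- by move=> mu; rewrite lee_fin.
- exact: (measurableT_comp mf (measurable_evals mB)).
- move=> mu /contrapT /CC' CE; rewrite !indicE; congr (nat_of_bool _)%:R%:E.
  by apply/idP/idP; rewrite !inE => /CE.
Qed.

Variables (b : set plane -> R) (a : R) (Q : probability S R) (H : probability plane R).
Hypothesis a_gt0 : (0 < a)%R.
Hypothesis ba : mass_on_partitions k b a.
Hypothesis DQ : dip_law k b Q.
Hypothesis invH : invariant_measure G H.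
Hypothesis bH : forall U, measurable U -> b U = (a * fine (H U))%R.

(** The first n sets define the cylinder and [A n] is the set whose mass is taken. Over common cells
    the updated probability of C depends only on the cell of x, and (2) matches the two sides cell
    by cell. *)
Lemma mecke_cylinder n (A : nat -> set plane) (q : nat -> R) :
  (forall l, measurable (A l)) ->
  let C := [set mu : S | forall l, (l < n)%N ->
              (q l)%:E < (mu : probability plane R) (A l)] in
  \int[Q]_mu ((\1_C mu)%:E * (mu : probability plane R) (A n)) =
  \int[H]_x ((\1_(A n) x)%:E * step k_gt0 a Q x C).
Proof.
move=> mA C.
(* The cells must resolve [A n] together with the sets of the cylinder, hence n + 1 sets. *)
have [N [B [w [pB w0 wE]]]] := exists_cells k_gt0 n.+1 mA.
have [mB _ _ _] := pB.
have mC : measurable C.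
  by rewrite random_prob_generated; apply: sub_sigma_algebra; exists n, A, q.
have cells mu l : invariant_laws k mu -> (l < n.+1)%N ->
    (mu : probability plane R) (A l) = (\sum_(i < N) w l i * tnth (evals B mu) i)%:E.
  move=> inv ln.
  have [-> _] := measure_cells k_gt0 pB inv (mA l) (w0 l) (fun i x => wE l i x ln).
  rewrite -sumEFin; apply: eq_bigr => i _; rewrite tnth_mktuple EFinM; congr (_ * _).
  by rewrite fineK// fin_num_measure.
pose C' := [set d : N.-tuple R | forall l, (l < n)%N -> (q l < \sum_(i < N) w l i * tnth d i)%R].
have mC' : measurable C'.
  rewrite (_ : C' = \bigcap_(l in `I_n) [set d | (q l < \sum_(i < N) w l i * tnth d i)%R])//.
  apply: bigcap_measurableType => l _; rewrite -[X in measurable X]setTI.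
  apply: measurable_fun_ltr => //; apply: measurable_sum => i.
  by apply: measurable_funM => //; exact: measurable_tnth.
have CC' mu : invariant_laws k mu -> C mu <-> C' (evals B mu).
  move=> inv; split=> h l ln; have := h l ln; rewrite cells ?lte_fin// ltnS ltnW//.
(* The probability of C after an observation in cell i. *)
pose s (i : 'I_N) := \int[gprod N (incr_at (params b B) i)]_t (\1_C' (snorm N t))%:E.
have s0 i : 0 <= s i by apply: integral_ge0 => t _; rewrite lee_fin.
pose s' i := fine (s i).
have sE i : s i = (s' i)%:E.
  rewrite fineK// ge0_fin_numE//; apply: (@le_lt_trans _ _ 1); last exact: ltry.
  apply: le_trans _ (_ : \int[gprod N (incr_at (params b B) i)]_t (cst 1 t) <= 1).
    apply: ge0_le_integral => //.
    - apply/measurable_EFinP; apply: (measurableT_comp (measurable_indic mC')).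
      exact: measurable_snorm.
    - by move=> t _; rewrite lee_fin indicE; case: (_ \in _).
  have -> // : \int[gprod N (incr_at (params b B) i)]_t (cst 1 t) = 1.
  exact: integral_cst_probability.
have s'0 i : (0 <= s' i)%R by exact: fine_ge0.
have stepE i x : B i x -> step k_gt0 a Q x C = (s' i)%:E.
  move=> Bx; rewrite -sE.
  apply: etrans (dip_law_ae_set (step_dip_law k_gt0 x a_gt0 ba DQ) pB mC mC' CC') _.
  have [j [Bj fx]] := partition_block k_gt0 x pB.
  rewrite (params_add_orbit b fx).
  suff -> : j = i by [].
  have [_ tB _ _] := pB.
  by apply: (tB j i I I); exists x.
have p0 := params_ge0 ba mB.
have sa := sum_params ba pB.
have mf : measurable_fun setT (fun t => (\1_C' t)%:E : \bar R).
  exact/measurable_EFinP/measurable_indic.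
have f0 (t : N.-tuple R) : 0 <= (\1_C' t)%:E :> \bar R by rewrite lee_fin.
pose g i (t : N.-tuple R) := (Num.max (tnth t i) 0%R)%:E * (\1_C' t)%:E : \bar R.
have g0 i t : 0 <= g i t by rewrite mule_ge0 ?max0_ge0.
have mg i : measurable_fun setT (g i).
  apply: emeasurable_funM => //.
  exact: (measurableT_comp measurable_max0 (measurable_tnth i)).
have gE i : \int[Q]_mu g i (evals B mu) = H (B i) * (s' i)%:E.
  have [_ D] := DQ.
  apply: etrans (D N B pB (g i) (g0 i) (mg i)) _.
  have := @dirichlet_weight R N (params b B) i (ltn_ord i) (fun t => (\1_C' t)%:E) p0.
  rewrite sa => /(_ a_gt0 f0 mf).
  rewrite (_ : Ordinal _ = i); last exact: val_inj.
  move=> ->; rewrite -/(s i) sE; congr (_ * _).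
  rewrite params_nth bH// mulrAC divff ?gt_eqF// mul1r fineK// fin_num_measure//.
transitivity (\sum_(i < N) (w n i)%:E * \int[Q]_mu g i (evals B mu)).
  have mge i : measurable_fun setT (fun mu : S => g i (evals B mu)).
    exact: (measurableT_comp (mg i) (measurable_evals mB)).
  transitivity (\int[Q]_mu \sum_(i < N) ((w n i)%:E * g i (evals B mu))).
    have [inv _] := DQ.
    apply: (eq_integral_null (measurableC (measurable_invariant_laws k_gt0)) inv).
    - by move=> mu; rewrite mule_ge0// lee_fin.
    - apply: emeasurable_funM; first exact/measurable_EFinP/measurable_indic.
      exact: measurable_evaluation.
    - by move=> mu; apply: sume_ge0 => i _; rewrite mule_ge0// lee_fin.
    - by apply: emeasurable_sum => i; exact: measurable_funeM.
    - move=> mu /contrapT invmu.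
      rewrite (cells mu n invmu (ltnSn _)).
      have -> : \1_C mu = \1_C' (evals B mu) :> R.
        rewrite !indicE; congr (nat_of_bool _)%:R.
        by apply/idP/idP; rewrite !inE => /(CC' _ invmu).
      rewrite -EFinM mulr_sumr -sumEFin; apply: eq_bigr => i _; rewrite /g.
      have ei : (0 <= tnth (evals B mu) i)%R by rewrite tnth_mktuple fine_ge0.
      move: (\1_C' _) (tnth _ i) ei => c t t0.
      by rewrite max_l// -!EFinM mulrC -mulrA.
  rewrite ge0_integral_sum//; last 2 first.
  - by move=> i; exact: measurable_funeM.
  - by move=> i mu _; rewrite mule_ge0// lee_fin.
  by apply: eq_bigr => i _; rewrite ge0_integralZl// lee_fin.
transitivity (\int[H]_x (\1_(A n) x * \sum_(i < N) s' i * \1_(B i) x)%:E); last first.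
  apply: eq_integral => x _; have [j Bj] := partition_cover pB x.
  by rewrite (partition_sum pB _ Bj) EFinM (stepE j).
rewrite (integral_partition pB)//; apply: eq_bigr => i _.
have [_ ->] := measure_cells k_gt0 pB invH (mA n) (w0 n) (fun i x => wE n i x (ltnSn _)).
by rewrite gE muleA muleC.
Qed.

(** For fixed A both sides are finite measures in C, and they agree on the cylinders. *)
Lemma mecke A C : measurable A -> measurable C ->
  \int[Q]_mu ((\1_C mu)%:E * (mu : probability plane R) A) =
  \int[H]_x ((\1_A x)%:E * step k_gt0 a Q x C).
Proof.
move=> mA mC.
have md (D : set S) : measurable D ->
    measurable_fun setT (fun mu : S => (\d_mu : probability S R) D).
  move=> mD; apply: (eq_measurable_fun (fun mu => (\1_D mu)%:E)).
    by move=> mu _; exact/esym/diracE.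
  exact/measurable_EFinP/measurable_indic.
have me : measurable_fun setT (fun mu : S => fine ((mu : probability plane R) A)).
  by apply: measurableT_comp => //; exact: measurable_evaluation.
have e0 (mu : S) : (0 <= fine ((mu : probability plane R) A))%R by exact: fine_ge0.
have [m1 m1E] := exists_mixture md Q e0 me.
have ms D : measurable D -> measurable_fun setT (fun x => step k_gt0 a Q x D).
  by move=> mD; apply: measurable_step_kernel.
have i0 x : (0 <= \1_A x :> R)%R by [].
have [m2 m2E] := exists_mixture ms H i0 (measurable_indic mA).
have {}m1E D : m1 D = \int[Q]_mu ((\1_D mu)%:E * (mu : probability plane R) A).
  rewrite m1E; apply: eq_integral => mu _; rewrite muleC; congr (_ * _).
  by rewrite fineK// fin_num_measure.
have cyl D : evaluation_cylinders D -> m1 D = m2 D.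
  move=> [n [A' [q [mA' ->]]]]; rewrite m1E m2E.
  have := @mecke_cylinder n (fun l => if (l < n)%N then A' l else A) q.
  rewrite ltnn; have -> : [set mu : S | forall l, (l < n)%N ->
      (q l)%:E < (mu : probability plane R) (if (l < n)%N then A' l else A)] =
      [set mu : S | forall l, (l < n)%N -> (q l)%:E < (mu : probability plane R) (A' l)].
    by apply/seteqP; split => mu h l ln; have := h l ln; rewrite ln.
  by apply => l; case: ifP.
rewrite -m1E -m2E.
have m12T : m1 setT = m2 setT.
  by apply: cyl; exists 0%N, (fun=> A), (fun=> 0%R); split => //; apply/seteqP; split.
apply: (finite_measure_eq random_prob_generated setI_closed_evaluation_cylinders m12T _ cyl mC).
rewrite m12T m2E; apply: (@le_lt_trans _ _ (\int[H]_x (cst 1 x))); last first.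
  have -> : \int[H]_x (cst 1 x) = 1 by exact: integral_cst_probability.
  exact: ltry.
apply: ge0_le_integral => //.
- by move=> x _; rewrite mule_ge0.
- by apply: emeasurable_funM; [exact/measurable_EFinP/measurable_indic|exact: ms].
- move=> x _; apply: le_trans (_ : 1 * 1 <= 1); last by rewrite mule1.
  apply: lee_pmul => //; last exact: probability_le1.
  by rewrite lee_fin indicE; case: (_ \in _).
Qed.

End mecke_identity.

(** * Bayes formula *)

Section posterior_dip.
Context {R : realType}.
Variables (k : nat) (k_gt0 : (0 < k)%N).
Local Notation plane := (plane R).
Local Notation S := (random_prob 'cV[R]_2 R).
Local Notation G := (matrix_action (@rotation_group R k)).
Local Open Scope ereal_scope.

Variables (alpha : {posnum R}) (H : probability plane R).
Hypothesis invH : invariant_measure G H.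

Definition base (s : seq plane) (U : set plane) : R :=
  (alpha%:num * fine (H U) + \sum_(y <- s) orbit_freq k y U)%R.

Lemma base_cons x s : base (x :: s) = add_orbit k (base s) x.
Proof. by apply/funext => U; rewrite /base big_cons addrCA addrC. Qed.

Lemma mass_base s : mass_on_partitions k (base s) (alpha%:num + (size s)%:R).
Proof.
split=> [U mU|n B pB].
  by rewrite addr_ge0 ?mulr_ge0 ?fine_ge0// sumr_ge0// => y _; exact: orbit_freq_ge0.
have [mB _ _ _] := pB.
rewrite big_split/= -mulr_sumr; congr (_ + _)%R.
  suff -> : (\sum_(i < n) fine (H (B i)) = 1)%R by rewrite mulr1.
  apply: EFin_inj; rewrite -sumEFin.
  transitivity (\sum_(i < n) 1%:E * H (setT `&` B i)).
    by apply: eq_bigr => i _; rewrite setTI mul1e fineK// fin_num_measure.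
  rewrite -(integral_partition pB H measurableT (fun=> ler01)).
  transitivity (\int[H]_x 1); last exact: integral_cst_probability.
  apply: eq_integral => x _; have [j Bj] := partition_cover pB x.
  by rewrite (partition_sum pB (fun=> 1%R) Bj) indicT mul1r.
rewrite exchange_big/= -sum1_size natr_sum; apply: eq_bigr => y _.
have [j [_ fx]] := partition_block k_gt0 y pB.
by rewrite (eq_bigr _ (fun i _ => fx i)) (bigD1 j)//= eqxx big1 ?addr0// => i /negPf ->.
Qed.

Lemma base_posterior m (x : m.-tuple plane) U : measurable U ->
  (base x U = (alpha%:num + m%:R) * fine (posterior_base k_gt0 alpha H x U))%R.
Proof.
move=> mU; rewrite (posterior_base_orbit k_gt0).
have -> : H U = (fine (H U))%:E by rewrite fineK// fin_num_measure.
by rewrite /= mulVKf.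
Qed.

Lemma posterior_base_invariant m (x : m.-tuple plane) :
  invariant_measure G (posterior_base k_gt0 alpha H x).
Proof.
apply/(invariant_measureP k_gt0) => j A mA; rewrite !(posterior_base_orbit k_gt0).
have /(invariant_measureP k_gt0) -> // := invH.
by under eq_bigr do rewrite orbit_freq_preimage//.
Qed.

Lemma post_dip_law Q s : dip_law k (base [::]) Q ->
  dip_law k (base s) (post k_gt0 alpha%:num Q s).
Proof.
move=> DQ; elim: s => // x s IH; rewrite base_cons.
by apply: step_dip_law => //; exact: mass_base.
Qed.

(** After m observations the law is again a Dirichlet invariant one, so the Palm formula applies
    anew. Its base measure doubles as the predictive law of the next observation. *)
Lemma mecke_post Q m (s : m.-tuple plane) A C : dip_law k (base [::]) Q ->
  measurable A -> measurable C ->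
  \int[post k_gt0 alpha%:num Q s]_mu ((\1_C mu)%:E * (mu : probability plane R) A) =
  \int[posterior_base k_gt0 alpha H s]_x
    ((\1_A x)%:E * step k_gt0 (alpha%:num + m%:R) (post k_gt0 alpha%:num Q s) x C).
Proof.
move=> DQ mA mC; apply: (@mecke _ _ k_gt0 (base s)) => //.
- by have := mass_base s; rewrite size_tuple.
- exact: post_dip_law.
- exact: posterior_base_invariant.
- exact: base_posterior.
Qed.

End posterior_dip.

(** * Events of the sample and rectangles *)

Section tuple_rectangles.
Context d (T : measurableType d) (R : realType).
Local Open Scope ereal_scope.

Definition tuple_rect m (A : 'I_m -> set T) : set (m.-tuple T) :=
  [set t | forall i, A i (tnth t i)].

Definition tuple_rects m : set (set (m.-tuple T)) :=
  [set D | exists2 A, (forall i, measurable (A i)) & D = tuple_rect A].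

Lemma measurable_tuple_rect m (A : 'I_m -> set T) :
  (forall i, measurable (A i)) -> measurable (tuple_rect A).
Proof.
move=> mA; rewrite (_ : tuple_rect A = \bigcap_(i : 'I_m) ((tnth (T := T))^~ i @^-1` A i)).
  apply: fin_bigcap_measurable => // i _.
  by rewrite -[X in measurable X]setTI; exact: measurable_tnth.
by apply/seteqP; split => [t At i _|t At i]; exact: At.
Qed.

Lemma tuple_rects_generate m : @measurable _ (m.-tuple T) = <<s @tuple_rects m >>.
Proof.
rewrite eqEsubset; split; last first.
  apply: smallest_sub; first exact: sigma_algebra_measurable.
  by move=> _ [A mA ->]; exact: measurable_tuple_rect.
move=> D mD.
have : measurable_fun setT (id : g_sigma_algebraType (@tuple_rects m) -> m.-tuple T).
  apply/measurable_fun_tnthP => i _ Y mY; rewrite setTI.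
  apply: sub_sigma_algebra.
  exists (fun j => if j == i then Y else setT); first by move=> j; case: ifP.
  apply/seteqP; split => t /=; last by move/(_ i); rewrite eqxx.
  by move=> Yt j; case: eqP => // ->.
by move=> /(_ measurableT _ mD); rewrite setTI.
Qed.

Lemma setI_closed_tuple_rects m : setI_closed (@tuple_rects m).
Proof.
move=> _ _ [A mA ->] [B mB ->]; exists (fun i => A i `&` B i).
  by move=> i; exact: measurableI.
by apply/seteqP; split => [t [At Bt] i|t ABt]; split => // i; have [] := ABt i.
Qed.

Lemma integral_indicM d' (Y : measurableType d') (mu : {measure set Y -> \bar R})
    (D : set Y) (f : Y -> \bar R) :
  \int[mu]_(x in D) f x = \int[mu]_x ((\1_D x)%:E * f x).
Proof.
rewrite integral_mkcond; apply: eq_integral => x _; rewrite patchE indicE.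
by case: (x \in D); rewrite ?mul1e ?mul0e.
Qed.

(** Both sides are finite measures in E, the right one being a mixture of Dirac masses at [V y] with
    density f. *)
Lemma tuple_rect_extension d' (Y : measurableType d') (mu : probability Y R) m
    (V : Y -> m.-tuple T) (D : set Y) (f : Y -> R) :
  measurable_fun setT V -> measurable D ->
  (forall y, 0 <= f y)%R -> measurable_fun setT f ->
  (forall A, (forall i, measurable (A i)) ->
    mu (V @^-1` tuple_rect A `&` D) = \int[mu]_(y in V @^-1` tuple_rect A) (f y)%:E) ->
  forall E, measurable E ->
    mu (V @^-1` E `&` D) = \int[mu]_(y in V @^-1` E) (f y)%:E.
Proof.
move=> mV mD f0 mf rectE E mE.
have [m1 [m1E _]] := exists_pushforward (mrestr mu mD) mV.
have md (B : set (m.-tuple T)) : measurable B ->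
    measurable_fun setT (fun y => (\d_(V y) : probability (m.-tuple T) R) B).
  move=> mB; apply: (eq_measurable_fun (fun y => (\1_B (V y))%:E)).
    by move=> y _; exact/esym/diracE.
  exact/measurable_EFinP/(measurableT_comp (measurable_indic mB) mV).
have [m2 m2E] := exists_mixture md mu f0 mf.
have {}m2E B : m2 B = \int[mu]_(y in V @^-1` B) (f y)%:E.
  rewrite m2E [RHS]integral_indicM; apply: eq_integral => y _; rewrite muleC.
  by congr (_ * _); rewrite [LHS]diracE.
have {}m1E B : m1 B = mu (V @^-1` B `&` D) by rewrite m1E.
have m12 B : tuple_rects B -> m1 B = m2 B.
  by move=> [A mA ->]; rewrite m1E m2E rectE.
rewrite -m1E -m2E.
apply: (finite_measure_eq (tuple_rects_generate m) (@setI_closed_tuple_rects m) _ _ m12 mE).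
  apply: m12; exists (fun=> setT) => //.
  by apply/seteqP; split.
rewrite m1E preimage_setT setTI.
exact: (le_lt_trans (probability_le1 mu mD) (ltry _)).
Qed.

End tuple_rectangles.

Section samples.
Context d (Omega : measurableType d) (R : realType) (Pr : probability Omega R).
Local Open Scope ereal_scope.
Local Notation plane := (plane R).
Local Notation S := (random_prob 'cV[R]_2 R).
Variable P : {RV Pr >-> S}.

Lemma measurable_sample_tuple m (X : 'I_m -> {RV Pr >-> plane}) :
  measurable_fun setT (sample_tuple X).
Proof.
apply/measurable_fun_tnthP => i.
rewrite (_ : _ \o _ = X i); first exact: measurable_funPT.
by apply/funext => w /=; rewrite tnth_mktuple.
Qed.

Lemma preimage_tuple_rect m (X : 'I_m -> {RV Pr >-> plane}) A :
  sample_tuple X @^-1` tuple_rect A = \bigcap_i (X i @^-1` A i).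
Proof.
apply/seteqP; split => [w h i _|w h i]; have := h i.
  by rewrite tnth_mktuple.
by rewrite tnth_mktuple; apply.
Qed.

(** [is_sample] says that the law of P restricted to a rectangle event has density the product of
    the P(A_i); integrating g against it passes from sets C to functions. *)
Lemma sample_rect_integral m (X : 'I_m -> {RV Pr >-> plane}) (A : 'I_m -> set plane)
    (g : S -> \bar R) :
  is_sample P X -> (forall i, measurable (A i)) ->
  (forall mu, 0 <= g mu) -> measurable_fun setT g ->
  \int[Pr]_w ((\1_(tuple_rect A) (sample_tuple X w))%:E * g (P w)) =
  \int[Pr]_w ((\prod_(i < m) (P w : probability plane R) (A i)) * g (P w)).
Proof.
move=> sX mA g0 mg.
have mP : measurable_fun setT P by exact: measurable_funPT.
pose D := sample_tuple X @^-1` tuple_rect A.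
have mD : measurable D.
  rewrite -[X in measurable X]setTI; apply: measurable_sample_tuple => //.
  exact: measurable_tuple_rect.
have [nu [nuE nuI]] := exists_pushforward (mrestr Pr mD) mP.
pose p (mu : S) : R := (\prod_(i < m) fine ((mu : probability plane R) (A i)))%R.
have pE (mu : S) : (p mu)%:E = \prod_(i < m) (mu : probability plane R) (A i).
  rewrite /p -prodEFin; apply: eq_bigr => i _; apply: fineK.
  exact: fin_num_measure.
have p0 mu : (0 <= p mu)%R by apply: prodr_ge0 => i _; exact: fine_ge0.
have mp : measurable_fun setT p.
  apply: measurable_prod => i _; apply: measurableT_comp => //; exact: measurable_evaluation.
have mgP : measurable_fun setT (fun w => g (P w)) by exact: (measurableT_comp mg mP).
transitivity (\int[nu]_mu g mu).
  rewrite nuI//; apply/esym.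
  apply: (@ge0_integral_density _ _ _ Pr (mrestr Pr mD) (\1_D) (fun w => g (P w))) => //.
  by move=> B mB; rewrite integral_indic//; exact: congr1 (setIC _ _).
transitivity (\int[distribution Pr P]_mu ((p mu)%:E * g mu)).
  apply: ge0_integral_density => // C mC.
  rewrite nuE -[LHS]/(Pr (P @^-1` C `&` D)) /D preimage_tuple_rect sX//.
  rewrite [RHS]integral_indicM ge0_integral_distribution//.
  - rewrite integral_indicM; apply: eq_integral => w _ /=.
    by rewrite pE.
  - apply: emeasurable_funM; last exact/measurable_EFinP.
    exact/measurable_EFinP/measurable_indic.
  - by move=> mu; rewrite mule_ge0// lee_fin.
rewrite ge0_integral_distribution//.
- by apply: eq_integral => w _ /=; rewrite pE.
- by apply: emeasurable_funM => //; exact/measurable_EFinP.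
- by move=> mu; rewrite mule_ge0// lee_fin.
Qed.

End samples.

(** * Induction on the number of observations *)

Section bayes_induction.
Context d (Omega : measurableType d) (R : realType) (Pr : probability Omega R).
Variables (k : nat) (k_gt0 : (0 < k)%N).
Local Notation plane := (plane R).
Local Notation S := (random_prob 'cV[R]_2 R).
Local Notation G := (matrix_action (@rotation_group R k)).
Local Open Scope ereal_scope.

Variables (P : {RV Pr >-> S}) (alpha : {posnum R}) (H : probability plane R).
Hypothesis invH : invariant_measure G H.
Local Notation Q := (distribution Pr P).
Hypothesis DQ : dip_law k (base k alpha H [::]) Q.
Local Notation posterior := (post k_gt0 alpha%:num Q).
Local Notation predictive := (posterior_base k_gt0 alpha H).

Lemma measurable_predictive m A : measurable A ->
  measurable_fun setT (fun t : m.-tuple plane => predictive t A).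
Proof.
move=> mA; apply: (eq_measurable_fun (fun t : m.-tuple plane =>
  ((alpha%:num + m%:R)^-1)%:E *
  (alpha%:num%:E * H A + (\sum_(i < m) orbit_freq k (tnth t i) A)%:E))).
  by move=> t _; rewrite posterior_base_orbit big_tuple.
apply: measurable_funeM; apply: emeasurable_funD; first exact: measurable_cst.
apply/measurable_EFinP; apply: measurable_sum => i.
exact: (measurableT_comp (measurable_orbit_freq k mA) (measurable_tnth i)).
Qed.

Lemma measurable_preimageT d1 d2 (T1 : measurableType d1) (T2 : measurableType d2)
  (f : T1 -> T2) A : measurable_fun setT f -> measurable A -> measurable (f @^-1` A).
Proof. by move=> mf mA; rewrite -[X in measurable X]setTI; exact: mf. Qed.

Lemma is_sample_tail m (X : 'I_m.+1 -> {RV Pr >-> plane}) :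
  is_sample P X -> is_sample P (fun i => X (lift ord0 i)).
Proof.
move=> sX C A mC mA.
have mA' (i : 'I_m.+1) : measurable (if unlift ord0 i is Some j then A j else setT).
  by case: unlift.
have sXC := sX C _ mC mA'; have -> : \bigcap_i (X (lift ord0 i) @^-1` A i) =
   \bigcap_i (X i @^-1` (if unlift ord0 i is Some j then A j else setT)).
  apply/seteqP; split => [w h i _ /=|w h i _ /=].
    by case: unliftP => [j ->|//]; exact: h.
  by have := h (lift ord0 i) I; rewrite /= liftK.
rewrite sXC; apply: eq_integral => w _.
rewrite big_ord_recl unlift_none probability_setT mul1e.
by apply: eq_bigr => i _; rewrite liftK.
Qed.

Lemma sample_tupleS m (X : 'I_m.+1 -> {RV Pr >-> plane}) w :
  sample_tuple X w =
  [tuple of X ord0 w :: sample_tuple (fun i => X (lift ord0 i)) w].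
Proof.
apply: eq_from_tnth => i; rewrite tnth_mktuple.
case: (unliftP ord0 i) => [j ->|->]; last by rewrite tnth0.
by rewrite tnthS tnth_mktuple.
Qed.

Lemma post_sampleS m (X : 'I_m.+1 -> {RV Pr >-> plane}) w :
  posterior (sample_tuple X w) =
  step k_gt0 (alpha%:num + m%:R)
    (posterior (sample_tuple (fun i => X (lift ord0 i)) w)) (X ord0 w).
Proof. by rewrite sample_tupleS post_cons. Qed.

(** The tail U of the sample is covered by the induction hypothesis and the head X0 is processed
    last. Given U, the factor P(A0) produced by X0 is averaged under the posterior, and the Palm
    formula trades it for a predictive draw x followed by an update at x. That draw is finally
    recognized as X0 itself. *)
Lemma post_sample m (X : 'I_m -> {RV Pr >-> plane}) : is_sample P X ->
  forall E C, measurable E -> measurable C ->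
    Pr (sample_tuple X @^-1` E `&` P @^-1` C) =
    \int[Pr]_(w in sample_tuple X @^-1` E) posterior (sample_tuple X w) C.
Proof.
have mP : measurable_fun setT P by exact: measurable_funPT.
have Pr1 : Pr setT < +oo by exact: (le_lt_trans (probability_le1 Pr measurableT) (ltry _)).
have mpost n C : measurable C ->
    measurable_fun setT (fun t : n.-tuple plane => posterior t C).
  by move=> mC; exact: measurable_post.
elim: m X => [|m IH] X sX E C mE mC.
  have -> : \int[Pr]_(w in sample_tuple X @^-1` E) posterior (sample_tuple X w) C =
      \int[Pr]_w ((\1_(sample_tuple X @^-1` E) w)%:E * Q C).
    rewrite integral_indicM; apply: eq_integral => w _.
    by rewrite (tuple0 (sample_tuple X w)).
  have mE' : measurable (sample_tuple X @^-1` E).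
    exact: (measurable_preimageT (measurable_sample_tuple X) mE).
  have [Et|Et] := pselect (E [tuple]).
    have -> : sample_tuple X @^-1` E = setT.
      by apply/seteqP; split => // w _ /=; rewrite (tuple0 (sample_tuple X w)).
    rewrite setTI; apply/esym; transitivity (\int[Pr]_w (Q C)).
      by apply: eq_integral => w _; rewrite indicT mul1e.
    exact: integral_cst_probability.
  have -> : sample_tuple X @^-1` E = set0.
    by apply/seteqP; split => // w /=; rewrite (tuple0 (sample_tuple X w)).
  rewrite set0I measure0 integral0_eq// => w _.
  by rewrite indic0 mul0e.
set X' := fun i => X (lift ord0 i).
have sX' : is_sample P X' := is_sample_tail sX.
set U := sample_tuple X'; set X0 : Omega -> plane := X ord0.
have mU : measurable_fun setT U := measurable_sample_tuple X'.
have mX0 : measurable_fun setT X0 by exact: measurable_funPT.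
(* Replaces P by its posterior given U in joint integrals of (U, P). *)
have D1 := integral_disintegration (mpost m) mU mP Pr1 (IH X' sX').
pose update (t : m.-tuple plane) x := step k_gt0 (alpha%:num + m%:R) (posterior t) x.
have mupdate D : measurable D ->
    measurable_fun setT (fun p : m.-tuple plane * plane => update p.1 p.2 D).
  move=> mD.
  have mq B : measurable B ->
      measurable_fun setT (fun p : m.-tuple plane * plane => posterior p.1 B).
    by move=> mB; exact: (measurableT_comp (mpost m B mB) measurable_fst).
  exact: (@measurable_step_kernel _ _ k_gt0 _ _ _ _ snd mq measurable_snd D mD).
have main (A : 'I_m -> set plane) (A0 : set plane) (D : set S) :
    (forall i, measurable (A i)) -> measurable A0 -> measurable D ->
    Pr (P @^-1` D `&` (U @^-1` tuple_rect A `&` X0 @^-1` A0)) =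
    \int[Pr]_w \int[predictive (U w)]_x
      ((\1_(tuple_rect A) (U w))%:E * (\1_A0 x)%:E * update (U w) x D).
  move=> mA mA0 mD.
  pose g (mu : S) : \bar R := (\1_D mu)%:E * (mu : probability plane R) A0.
  have g0 mu : 0 <= g mu by rewrite mule_ge0// lee_fin.
  have mg : measurable_fun setT g.
    apply: emeasurable_funM; last exact: measurable_evaluation.
    exact/measurable_EFinP/measurable_indic.
  have mr : measurable_fun setT (fun t => (\1_(tuple_rect A) t)%:E : \bar R).
    by apply/measurable_EFinP; exact: (measurable_indic (measurable_tuple_rect mA)).
  transitivity (\int[Pr]_w ((\1_(tuple_rect A) (U w))%:E * g (P w))).
    rewrite sample_rect_integral//.
    have -> : U @^-1` tuple_rect A `&` X0 @^-1` A0 =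
        \bigcap_i (X i @^-1` (if unlift ord0 i is Some j then A j else A0)).
      rewrite preimage_tuple_rect; apply/seteqP; split => [w [h h0] i _ /=|w h].
        by case: unliftP => [j ->|-> //]; exact: h.
      split => [i _|]; first by have := h (lift ord0 i) I; rewrite /= liftK.
      by have := h ord0 I; rewrite /= unlift_none.
    rewrite sX//; last by move=> i; case: unlift.
    rewrite integral_indicM; apply: eq_integral => w _.
    rewrite big_ord_recl unlift_none /g muleA [RHS]muleC; congr (_ * _).
    by apply: eq_bigr => i _; rewrite liftK.
  pose f (p : m.-tuple plane * S) := (\1_(tuple_rect A) p.1)%:E * g p.2.
  have f0 p : 0 <= f p by rewrite mule_ge0// lee_fin.
  have mf : measurable_fun setT f.
    apply: emeasurable_funM; first exact: (measurableT_comp mr measurable_fst).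
    exact: (measurableT_comp mg measurable_snd).
  apply: etrans (D1 f f0 mf) _.
  apply: eq_integral => w _.
  transitivity ((\1_(tuple_rect A) (U w))%:E * \int[posterior (U w)]_mu g mu).
    have i0 : 0 <= (\1_(tuple_rect A) (U w))%:E :> \bar R by rewrite lee_fin.
    exact: (ge0_integralZl (posterior (U w)) measurableT mg (fun mu _ => g0 mu) i0).
  apply: etrans (congr1 (fun z => (\1_(tuple_rect A) (U w))%:E * z)
    (mecke_post k_gt0 invH (U w) DQ mA0 mD)) _.
  have mh : measurable_fun setT (fun x => (\1_A0 x)%:E * update (U w) x D).
    apply: emeasurable_funM; first exact/measurable_EFinP/measurable_indic.
    exact: (measurableT_comp (mupdate D mD) (measurable_pair1 (U w))).
  have h0 x : 0 <= (\1_A0 x)%:E * update (U w) x D by rewrite mule_ge0// lee_fin.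
  have i0 : 0 <= (\1_(tuple_rect A) (U w))%:E :> \bar R by rewrite lee_fin.
  apply: etrans (esym (ge0_integralZl (predictive (U w)) measurableT mh (fun x _ => h0 x) i0)) _.
  by apply: eq_integral => x _; rewrite muleA.
(* For D the whole space, [main] says that the predictive law is the conditional law of X0 given U.
   So the draw x in [main] can be turned back into X0. *)
have D2 : forall f : m.-tuple plane * plane -> \bar R, (forall p, 0 <= f p) ->
    measurable_fun setT f ->
    \int[Pr]_w f (U w, X0 w) = \int[Pr]_w \int[predictive (U w)]_x f (U w, x).
  apply: (integral_disintegration (k := fun t : m.-tuple plane => predictive t)) => //.
    by move=> A mA; exact: measurable_predictive.
  move=> E' A0 mE' mA0.
  have mh : measurable_fun setT (fun w => fine (predictive (U w) A0)).
    by apply: measurableT_comp => //; exact: (measurableT_comp (measurable_predictive mA0) mU).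
  have hE w : (fine (predictive (U w) A0))%:E = predictive (U w) A0.
    by rewrite fineK// fin_num_measure.
  transitivity (\int[Pr]_(w in U @^-1` E') (fine (predictive (U w) A0))%:E).
    apply: tuple_rect_extension => //.
    - exact: measurable_preimageT.
    - by move=> w; exact: fine_ge0.
    move=> A mA; have := main A A0 setT mA mA0 measurableT.
    rewrite preimage_setT setTI => ->; rewrite [RHS]integral_indicM.
    apply: eq_integral => w _; rewrite hE.
    rewrite (probability_integral_indic (predictive (U w)) mA0).
    rewrite -ge0_integralZl//.
    + by apply: eq_integral => x _; rewrite probability_setT mule1.
    + exact/measurable_EFinP/measurable_indic.
  by apply: eq_integral => w _.
have mV := measurable_sample_tuple X.
have mh : measurable_fun setT (fun w => fine (posterior (sample_tuple X w) C)).
  by apply: measurableT_comp => //; exact: (measurableT_comp (mpost _ C mC) mV).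
have hE w : (fine (posterior (sample_tuple X w) C))%:E = posterior (sample_tuple X w) C.
  by rewrite fineK// fin_num_measure.
transitivity (\int[Pr]_(w in sample_tuple X @^-1` E) (fine (posterior (sample_tuple X w) C))%:E);
  last by apply: eq_integral => w _.
apply: tuple_rect_extension => //.
- exact: measurable_preimageT.
- by move=> w; exact: fine_ge0.
move=> A mA.
have rectE w : sample_tuple X w \in tuple_rect A =
    ((U w \in tuple_rect (fun i => A (lift ord0 i))) && (X0 w \in A ord0)) :> bool.
  apply/idP/andP; rewrite !inE.
    move=> h; split => [i|]; last by have := h ord0; rewrite tnth_mktuple.
    by have := h (lift ord0 i); rewrite !tnth_mktuple.
  move=> [h h0] i; rewrite tnth_mktuple.
  case: (unliftP ord0 i) => [j ->|-> //].
  by have := h j; rewrite tnth_mktuple.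
have -> : sample_tuple X @^-1` tuple_rect A `&` P @^-1` C =
    P @^-1` C `&` (U @^-1` tuple_rect (fun i => A (lift ord0 i)) `&` X0 @^-1` A ord0).
  rewrite setIC; congr (_ `&` _); apply/seteqP; split => w.
    move=> h; have := rectE w; rewrite (mem_set (A := tuple_rect A) h).
    by move/esym/andP => []; rewrite !inE.
  move=> [h1 h2]; have := rectE w.
  rewrite (mem_set (A := tuple_rect (fun i => A (lift ord0 i))) h1).
  by rewrite (mem_set (A := A ord0) h2) /= => /set_mem.
rewrite main//.
pose f (p : m.-tuple plane * plane) := (\1_(tuple_rect (fun i => A (lift ord0 i))) p.1)%:E *
  (\1_(A ord0) p.2)%:E * update p.1 p.2 C.
have f0 p : 0 <= f p by rewrite !mule_ge0// lee_fin.
have mf : measurable_fun setT f.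
  apply: emeasurable_funM; last exact: mupdate.
  apply: emeasurable_funM; apply/measurable_EFinP.
    apply: (measurableT_comp (measurable_indic _) measurable_fst).
    exact: measurable_tuple_rect.
  exact: (measurableT_comp (measurable_indic _) measurable_snd).
apply: etrans (esym (D2 f f0 mf)) _.
rewrite [RHS]integral_indicM; apply: eq_integral => w _; rewrite hE /f.
congr (_ * _).
  rewrite -EFinM !indicE; have -> : (w \in sample_tuple X @^-1` tuple_rect A) =
    (sample_tuple X w \in tuple_rect A) by [].
  by rewrite rectE -natrM mulnb.
by rewrite post_sampleS.
Qed.

End bayes_induction.

Section posterior_kernel.
Context {R : realType}.
Variables (k : nat) (k_gt0 : (0 < k)%N) (a : R).
Local Notation plane := (plane R).
Local Notation S := (random_prob 'cV[R]_2 R).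
Variables (Q : probability S R) (m : nat).

Definition posterior_kernel (t : m.-tuple plane) : {measure set S -> \bar R} :=
  post k_gt0 a Q t.

Let measurable_posterior_kernel C : measurable C ->
  measurable_fun setT (posterior_kernel ^~ C).
Proof. exact: measurable_post. Qed.

HB.instance Definition _ := isKernel.Build _ _ _ _ _ posterior_kernel
  measurable_posterior_kernel.

Let posterior_kernelT t : posterior_kernel t setT = 1%E.
Proof. exact: probability_setT. Qed.

HB.instance Definition _ := Kernel_isProbability.Build _ _ _ _ _
  posterior_kernel posterior_kernelT.

End posterior_kernel.

Theorem theorem3p1 (R : realType) (k : nat) (k_gt0 : (0 < k)%N) :
  finite_orthogonal_group (@rotation_group R k) /\
  forall (alpha : {posnum R}) (H : probability (plane R) R),
    invariant_measure (matrix_action (rotation_group k)) H ->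
  forall (d : measure_display) (Omega : measurableType d)
    (Pr : probability Omega R) (P : {RV Pr >-> random_prob 'cV[R]_2 R})
    (m : nat) (X : 'I_m -> {RV Pr >-> plane R}),
    is_DIP (matrix_action (rotation_group k)) alpha H (distribution Pr P) ->
    is_sample P X ->
  exists kappa : R.-pker m.-tuple (plane R) ~> random_prob 'cV[R]_2 R,
    is_conditional_distribution P (sample_tuple X) kappa /\
    forall x : m.-tuple (plane R),
      is_DIP (matrix_action (rotation_group k)) (alpha%:num + m%:R)%:pos
        (posterior_base k_gt0 alpha H x) (kappa x).
Proof.
split; first exact: finite_orthogonal_rotation_group.
move=> alpha H invH d Omega Pr P m X DP sX.
have DQ : dip_law k (base k alpha H [::]) (distribution Pr P).
  by apply: is_DIP_dip_law DP => // U mU; rewrite /base big_nil addr0.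
exists (posterior_kernel k_gt0 alpha%:num (distribution Pr P) (m := m)); split.
  by move=> E C mE mC; exact: (post_sample k_gt0 invH DQ sX mE mC).
(* Updates preserve Dirichlet invariant laws at every point, so no null set of observations is
   excepted. *)
move=> x; apply: (@dip_law_is_DIP _ _ k_gt0 _ _ _ (base k alpha H x)) => //.
- exact: base_posterior.
- exact: posterior_base_invariant.
- exact: post_dip_law.
Qed.
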